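(* Let $0<r_1<r_2<\infty$ and $A=\{\zeta\in\mathbb{C}\colon r_1\le|\zeta|\le r_2\}$. Let $f\colon A\to\mathbb{C}$ be a Hölder continuous function such that $$\frac{1}{2\pi}\int_0^{2\pi} f(a+\rho e^{i\theta})\,d\theta=0$$ for every circle $b\Delta(a,\rho)\subset A$ ($a\in\mathbb{C}$, $\rho>0$) which surrounds the origin. Then there are a bounded continuous function $G^+$ on $\Omega^+(A)\cup b\Omega^+(A)$ which is holomorphic on $\Omega^+(A)$ and a bounded continuous function $G^-$ on $\Omega^-(A)\cup b\Omega^-(A)$ which is holomorphic on $\Omega^-(A)$ such that $$f(z)=\frac{1}{\overline z}\,G^+(z,\overline z)+\frac{1}{z}\,G^-(z,\overline z)\qquad(z\in A).$$
   Context: For $a\in\mathbb{C}$ and $\rho>0$, $\Delta(a,\rho)=\{\zeta\in\mathbb{C}\colon|\zeta-a|<\rho\}$ and $b\Delta(a,\rho)$ is its boundary circle. A circle $b\Delta(a,\rho)\subset A$ surrounds the origin if $0\in\Delta(a,\rho)$, i.e. $|a|<\rho$. A function $f$ on a set $K\subset\mathbb{C}$ is Hölder continuous on $K$ if there are constants $M<\infty$ and $\alpha$, $0<\alpha<1$, such that $|f(z)-f(w)|\le M|z-w|^\alpha$ for all $z,w\in K$. All functions are complex-valued. For $a\in\mathbb{C}$, $\rho>0$ define the subsets of $\mathbb{C}^2$ $$\Lambda^+_{a,\rho}=\{(z,w)\in\mathbb{C}^2\colon (z-a)(w-\overline a)=\rho^2,\ 0<|z-a|<\rho\},$$ $$\Lambda^-_{a,\rho}=\{(z,w)\in\mathbb{C}^2\colon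 (z-a)(w-\overline a)=\rho^2,\ |z-a|>\rho\}.$$ $\Omega^+(A)$ is the union of all $\Lambda^+_{a,\rho}$ such that $b\Delta(a,\rho)\subset\mathrm{Int}\,A$ surrounds the origin, and $\Omega^-(A)$ is the union of all $\Lambda^-_{a,\rho}$ such that $b\Delta(a,\rho)\subset\mathrm{Int}\,A$ surrounds the origin. Here $\mathrm{Int}\,A=\{\zeta\colon r_1<|\zeta|<r_2\}$. The sets $\Omega^\pm(A)$ are domains (open connected sets) in $\mathbb{C}^2$; $b\Omega^\pm(A)$ denotes the topological boundary in $\mathbb{C}^2$, and it contains $\tilde A=\{(\zeta,\overline\zeta)\colon\zeta\in A\}$. *)

(* Defs.v *)
From Stdlib Require Import Reals.
From Coquelicot Require Import Coquelicot.

Open Scope R_scope.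

(** ** Circles in the plane *)

Definition disc (a : C) (rho : R) : C -> Prop := fun z => Cmod (z - a) < rho.

Definition circle (a : C) (rho : R) : C -> Prop := fun z => Cmod (z - a) = rho.

Definition surrounds_origin (a : C) (rho : R) : Prop := disc a rho (RtoC 0).

Definition annulus (r1 r2 : R) : C -> Prop := fun z => r1 <= Cmod z <= r2.

Definition int_annulus (r1 r2 : R) : C -> Prop := fun z => r1 < Cmod z < r2.

Definition expi (t : R) : C := (cos t, sin t).

(** The integrand is [C]-valued and the variable is real, so the integral is
    taken in [C] as a real normed space. *)
Definition circle_average (f : C -> C) (a : C) (rho : R) : C :=
  (RtoC (/ (2 * PI)) *
   RInt (V := C_R_CompleteNormedModule)
        (fun t : R => f (a + RtoC rho * expi t)) 0%R (2 * PI)%R)%C.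

(** The case [z = w] carries no information; it is left out because the
    Standard Library has [Rpower 0 alpha = 1] instead of [0]. *)
Definition holder_on (K : C -> Prop) (f : C -> C) : Prop :=
  exists M alpha : R, 0 < alpha < 1 /\
    forall z w : C, K z -> K w -> z <> w ->
      Cmod (f z - f w) <= M * Rpower (Cmod (z - w)) alpha.

(** ** The space [C^2]

    The scalar field is [C]: over [R] the same carrier would give real
    differentiability in [holomorphic_on] below. *)

Definition C2 : NormedModule C_AbsRing :=
  prod_NormedModule C_AbsRing C_NormedModule C_NormedModule.

Definition boundary (S : C2 -> Prop) : C2 -> Prop := fun p =>
  forall V : C2 -> Prop, locally p V ->
    (exists q, V q /\ S q) /\ (exists q, V q /\ ~ S q).

Definition with_boundary (S : C2 -> Prop) : C2 -> Prop :=
  fun p => S p \/ boundary S p.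

(** Meant for open [D]: existence, at each point of [D], of the [C]-linear
    Frechet differential with respect to full neighbourhoods of the point. *)
Definition holomorphic_on (D : C2 -> Prop) (G : C2 -> C_NormedModule) : Prop :=
  forall p : C2, D p -> ex_filterdiff G (locally p).

Definition bounded_on (D : C2 -> Prop) (G : C2 -> C_NormedModule) : Prop :=
  exists M : R, forall p : C2, D p -> Cmod (G p) <= M.

(** ** The varieties attached to circles, and their unions *)

Definition Lambda_plus (a : C) (rho : R) : C2 -> Prop := fun p =>
  let (z, w) := p in
  ((z - a) * (w - Cconj a))%C = RtoC (rho ^ 2) /\ 0 < Cmod (z - a) < rho.

Definition Lambda_minus (a : C) (rho : R) : C2 -> Prop := fun p =>
  let (z, w) := p in
  ((z - a) * (w - Cconj a))%C = RtoC (rho ^ 2) /\ Cmod (z - a) > rho.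

Definition Omega_plus (r1 r2 : R) : C2 -> Prop := fun p =>
  exists (a : C) (rho : R),
    0 < rho /\
    (forall z : C, circle a rho z -> int_annulus r1 r2 z) /\
    surrounds_origin a rho /\
    Lambda_plus a rho p.

Definition Omega_minus (r1 r2 : R) : C2 -> Prop := fun p =>
  exists (a : C) (rho : R),
    0 < rho /\
    (forall z : C, circle a rho z -> int_annulus r1 r2 z) /\
    surrounds_origin a rho /\
    Lambda_minus a rho p.

(* Main.v *)
Require Import Defs.
From Stdlib Require Import Reals Lra Lia List Psatz FinFun.
From Stdlib Require Import IndefiniteDescription FunctionalExtensionality.
From Coquelicot Require Import Coquelicot.

Open Scope R_scope.

(** Why the theorem is true.  Write zeta = e^(i al) and, for n >= 0, let g_n(z) be
    the mean over al of f(zeta z) zeta^n, the component of f of angular frequency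
    -n.  The annulus is invariant under rotations, so g_n inherits the vanishing
    averages, and z^n g_n(z) depends on |z|^2 alone.  The heart of the matter is
    that it is a polynomial in |z|^2 of degree less than n
    ([fourier_coef_radial_poly]).  Indeed, let z^n g_n(z) = p(|z|^2) with p
    smooth; the average of g_n over the circle with centre kappa rho and radius
    rho only sees the n-th Taylor coefficient of p at rho^2, up to
    o(kappa^n), because lower powers of |z|^2 - rho^2 average to zero against
    z^(-n); so the n-th derivative of p vanishes ([null_profile_smooth]).  For
    continuous p one averages p over dilations, which preserve the family of
    circles, to gain smoothness, and returns to p through divided differences
    ([null_profile_poly_class_C]).  Consequently g_0 = 0, and z g_n(z) is a
    polynomial in 1/z and conj z ([fourier_coef_poly2]).

    On Lambda^-_(a,rho) the variable xi = rho/(z-a) runs over the punctured unit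
    disc, 1/z and w belong to the disc algebra as functions of xi, and |xi| = 1
    means that w = conj z with z on the circle.  The maximum principle therefore
    bounds any polynomial in 1/z and w on Omega^- by its supremum over the points
    (z, conj z) with z in the annulus ([Lambda_minus_max]).  So a uniformly
    convergent series of such polynomials on the annulus gives a uniformly
    convergent series on the closure of Omega^-: its sum is bounded and
    continuous there, and holomorphic on Omega^- since second order Taylor
    estimates with uniform constants survive the limit ([limit_quadratic]).

    The polynomials are z times (truncated) Abel means, sums of t^n g_n over
    n >= 1.  Along t = 1 - 2^(-k-1) their successive differences are at most a
    Poisson integral of |f(zeta z) - f(z)|, which decays geometrically because f
    is Hoelder continuous ([abel_mean_step]).  This yields G^-.

    The positive frequencies of f are the negative ones of z |-> f(conj z), and
    (z, w) |-> (w, z) sends Omega^+ into Omega^-; this yields G^+.  The two Abel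
    means add up, as g_0 = 0, to a Poisson integral of f, which tends to f
    ([two_sided_means]).  The disc algebra, Cauchy's formula and the maximum
    principle are needed for uniform limits of polynomials only, and are derived
    here from the means of the powers of zeta over the unit circle. *)

(** * Averages of complex functions over a period *)

Lemma continuity_pt_cst (c t : R) : continuity_pt (fun _ => c) t.
Proof. apply continuity_pt_const. intros ? ?; reflexivity. Qed.

Lemma continuity_pt_Ropp (t : R) : continuity_pt Ropp t.
Proof. apply (continuity_pt_opp id), derivable_continuous_pt, derivable_pt_id. Qed.

(** Continuity is imposed on the two components, so that the lemmas on real
    functions apply to each of them. *)
Definition Ccont (g : R -> C) : Prop :=
  forall t, continuity_pt (fun s => Re (g s)) t /\ continuity_pt (fun s => Im (g s)) t.

Lemma continuity_pt_continuous (f : R -> R) (t : R) :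
  continuity_pt f t <-> continuous f t.
Proof. apply continuity_pt_filterlim. Qed.

Lemma Cmod_le_Rabs (z : C) : Cmod z <= Rabs (Re z) + Rabs (Im z).
Proof.
  replace z with (RtoC (Re z) + Ci * RtoC (Im z))%C at 1.
  - eapply Rle_trans; [apply Cmod_triangle|].
    rewrite Cmod_mult, Cmod_Ci, !Cmod_R; lra.
  - destruct z; unfold Ci, RtoC, Cplus, Cmult; simpl; f_equal; ring.
Qed.

Lemma Im_le_Cmod (z : C) : Rabs (Im z) <= Cmod z.
Proof. eapply Rle_trans; [apply Rmax_r | apply Rmax_Cmod]. Qed.

Lemma continuity_pt_eps (f : R -> R) (t : R) :
  (forall eps, 0 < eps -> exists d, 0 < d /\ forall s, Rabs (s - t) < d -> Rabs (f s - f t) < eps)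
  <-> continuity_pt f t.
Proof.
  split.
  - intros H eps He. destruct (H eps He) as [d [Hd Hs]].
    exists d; split; [exact Hd|]. intros s [_ Hs']. apply Hs, Hs'.
  - intros H eps He. destruct (H eps He) as [d [Hd Hs]].
    exists d; split; [exact Hd|]. intros s Hs'.
    destruct (Req_dec s t) as [->|Hn].
    + rewrite Rminus_diag, Rabs_R0; lra.
    + apply Hs. split; [|exact Hs']. split; [exact I|]. auto.
Qed.

Lemma Ccont_eps (g : R -> C) :
  (forall t eps, 0 < eps -> exists d, 0 < d /\
     forall s, Rabs (s - t) < d -> Cmod (g s - g t) < eps) <-> Ccont g.
Proof.
  split.
  - intros H t; split; apply continuity_pt_eps; intros eps He;
      destruct (H t eps He) as [d [Hd Hs]]; exists d; split; auto;
      intros s Hst; eapply Rle_lt_trans; [|apply (Hs s Hst)| |apply (Hs s Hst)].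
    + apply (re_le_Cmod (g s - g t)).
    + apply (Im_le_Cmod (g s - g t)).
  - intros H t eps He. destruct (H t) as [H1 H2].
    pose proof (proj2 (continuity_pt_eps _ _) H1) as H1'.
    pose proof (proj2 (continuity_pt_eps _ _) H2) as H2'.
    destruct (H1' (eps/2) ltac:(lra)) as [d1 [Hd1 Hs1]].
    destruct (H2' (eps/2) ltac:(lra)) as [d2 [Hd2 Hs2]].
    exists (Rmin d1 d2); split; [apply Rmin_pos; auto|].
    intros s Hs.
    pose proof (Rmin_l d1 d2). pose proof (Rmin_r d1 d2).
    eapply Rle_lt_trans; [apply Cmod_le_Rabs|].
    specialize (Hs1 s ltac:(lra)). specialize (Hs2 s ltac:(lra)).
    unfold Re, Im in *; simpl in *. unfold Rminus in *. lra.
Qed.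

Lemma Ccont_const (c : C) : Ccont (fun _ => c).
Proof. intros t; split; apply continuity_pt_cst. Qed.

Lemma Ccont_RtoC (f : R -> R) : (forall t, continuity_pt f t) -> Ccont (fun t => RtoC (f t)).
Proof. intros H t; split; [apply H|exact (continuity_pt_cst 0 t)]. Qed.

Lemma Ccont_expi : Ccont expi.
Proof. intros t; split; [apply continuity_cos|apply continuity_sin]. Qed.

Lemma Ccont_add (f g : R -> C) : Ccont f -> Ccont g -> Ccont (fun t => f t + g t)%C.
Proof.
  intros Hf Hg t; destruct (Hf t), (Hg t); split.
  - apply (continuity_pt_plus (fun s => Re (f s)) (fun s => Re (g s))); auto.
  - apply (continuity_pt_plus (fun s => Im (f s)) (fun s => Im (g s))); auto.
Qed.

Lemma Ccont_mul (f g : R -> C) : Ccont f -> Ccont g -> Ccont (fun t => f t * g t)%C.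
Proof.
  intros Hf Hg t; destruct (Hf t), (Hg t); split.
  - apply (continuity_pt_minus (fun s => Re (f s) * Re (g s)) (fun s => Im (f s) * Im (g s)));
      apply (continuity_pt_mult (fun s => _ (f s)) (fun s => _ (g s))); auto.
  - apply (continuity_pt_plus (fun s => Re (f s) * Im (g s)) (fun s => Im (f s) * Re (g s)));
      apply (continuity_pt_mult (fun s => _ (f s)) (fun s => _ (g s))); auto.
Qed.

Lemma Ccont_ext (f g : R -> C) : (forall t, f t = g t) -> Ccont f -> Ccont g.
Proof.
  intros H Hf. apply Ccont_eps. intros t e He.
  destruct (proj2 (Ccont_eps f) Hf t e He) as [d [Hd Hs]].
  exists d; split; auto. intros s; rewrite <- !H; auto.
Qed.

Lemma Ccont_opp (f : R -> C) : Ccont f -> Ccont (fun t => - f t)%C.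
Proof.
  intros Hf. apply (Ccont_ext (fun t => RtoC (-1) * f t)%C).
  - intros; apply injective_projections; simpl; ring.
  - apply Ccont_mul; auto using Ccont_const.
Qed.

Lemma Ccont_sub (f g : R -> C) : Ccont f -> Ccont g -> Ccont (fun t => f t - g t)%C.
Proof. intros Hf Hg; apply Ccont_add; auto using Ccont_opp. Qed.

Lemma Ccont_conj (f : R -> C) : Ccont f -> Ccont (fun t => Cconj (f t)).
Proof.
  intros Hf t; destruct (Hf t); split; auto.
  apply (continuity_pt_opp (fun s => Im (f s))); auto.
Qed.

Lemma Ccont_pow (f : R -> C) n : Ccont f -> Ccont (fun t => f t ^ n)%C.
Proof.
  intros Hf; induction n; simpl.
  - apply Ccont_const.
  - apply Ccont_mul; auto.
Qed.

Create HintDb ccont.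
Hint Resolve Ccont_const Ccont_expi Ccont_add Ccont_mul Ccont_sub Ccont_opp Ccont_conj Ccont_pow : ccont.

Lemma Ccont_comp (f : R -> C) (phi : R -> R) :
  Ccont f -> (forall t, continuity_pt phi t) -> Ccont (fun t => f (phi t)).
Proof.
  intros Hf Hp t. destruct (Hf (phi t)); split.
  - apply (continuity_pt_comp phi (fun s => Re (f s))); auto.
  - apply (continuity_pt_comp phi (fun s => Im (f s))); auto.
Qed.

Lemma Ccont_inv (f : R -> C) : Ccont f -> (forall t, f t <> 0%C) -> Ccont (fun t => / f t)%C.
Proof.
  intros Hf Hn t. destruct (Hf t) as [H1 H2].
  assert (Hc : continuity_pt (fun s => Re (f s) ^ 2 + Im (f s) ^ 2) t).
  { apply (continuity_pt_plus (fun s => Re (f s) ^ 2) (fun s => Im (f s) ^ 2)); simpl;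
    apply (continuity_pt_mult (fun s => _ (f s)) (fun s => _ (f s) * 1)); auto;
    apply (continuity_pt_mult (fun s => _ (f s)) (fun s => 1)); auto;
    apply continuity_pt_cst. }
  assert (Hz : Re (f t) ^ 2 + Im (f t) ^ 2 <> 0).
  { rewrite <- Cmod2_alt. apply pow_nonzero. intro E. apply (Hn t), Cmod_eq_0, E. }
  split.
  - apply (continuity_pt_div (fun s => Re (f s)) (fun s => Re (f s) ^ 2 + Im (f s) ^ 2)); auto.
  - apply (continuity_pt_div (fun s => - Im (f s)) (fun s => Re (f s) ^ 2 + Im (f s) ^ 2)); auto.
    apply (continuity_pt_opp (fun s => Im (f s))); auto.
Qed.

Lemma Ccont_Cmod (f : R -> C) : Ccont f -> forall t, continuity_pt (fun s => Cmod (f s)) t.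
Proof.
  intros Hf t. apply continuity_pt_eps. intros e He.
  destruct (proj2 (Ccont_eps f) Hf t e He) as [d [Hd Hs]].
  exists d; split; auto. intros s Hst. specialize (Hs s Hst).
  eapply Rle_lt_trans; [|exact Hs].
  pose proof (Cmod_triangle (f s - f t) (f t)). pose proof (Cmod_triangle (f t - f s) (f s)).
  replace (f s - f t + f t)%C with (f s) in H by ring.
  replace (f t - f s + f s)%C with (f t) in H0 by ring.
  replace (f t - f s)%C with (- (f s - f t))%C in H0 by ring. rewrite Cmod_opp in H0.
  apply Rabs_le. lra.
Qed.

Definition Ravg (phi : R -> R) : R := / (2 * PI) * RInt phi 0 (2 * PI).
Definition Cavg (g : R -> C) : C := (Ravg (fun t => Re (g t)), Ravg (fun t => Im (g t))).

Lemma twoPI_pos : 0 < 2 * PI.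
Proof. pose proof PI_RGT_0; lra. Qed.

Lemma ex_RInt_cont (phi : R -> R) a b : (forall t, continuity_pt phi t) -> ex_RInt phi a b.
Proof.
  intros H. apply (ex_RInt_continuous (V := R_CompleteNormedModule)). intros.
  apply continuity_pt_continuous, H.
Qed.

Lemma Ravg_le (f g : R -> R) : (forall t, continuity_pt f t) -> (forall t, continuity_pt g t) ->
  (forall t, f t <= g t) -> Ravg f <= Ravg g.
Proof.
  intros Hf Hg H. unfold Ravg. pose proof twoPI_pos.
  apply Rmult_le_compat_l; [left; apply Rinv_0_lt_compat; auto|].
  apply RInt_le; auto using ex_RInt_cont; lra.
Qed.

Lemma Ravg_ext (f g : R -> R) : (forall t, f t = g t) -> Ravg f = Ravg g.
Proof. intros H; unfold Ravg; f_equal. apply RInt_ext; intros; auto. Qed.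

Lemma Ravg_plus (f g : R -> R) : (forall t, continuity_pt f t) -> (forall t, continuity_pt g t) ->
  Ravg (fun t => f t + g t) = Ravg f + Ravg g.
Proof.
  intros Hf Hg. unfold Ravg.
  rewrite (RInt_plus (V := R_CompleteNormedModule)); auto using ex_RInt_cont.
  unfold plus; simpl; ring.
Qed.

Lemma Ravg_scal (c : R) (f : R -> R) : (forall t, continuity_pt f t) ->
  Ravg (fun t => c * f t) = c * Ravg f.
Proof.
  intros Hf. unfold Ravg.
  rewrite (RInt_scal (V := R_CompleteNormedModule)); auto using ex_RInt_cont.
  unfold scal; simpl; unfold mult; simpl; ring.
Qed.

Lemma Ravg_const (c : R) : Ravg (fun _ => c) = c.
Proof.
  unfold Ravg. rewrite (RInt_const (V := R_CompleteNormedModule)).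
  unfold scal; simpl; unfold mult; simpl. pose proof twoPI_pos. field.
  pose proof PI_RGT_0; lra.
Qed.

Lemma Cavg_ext (f g : R -> C) : (forall t, f t = g t) -> Cavg f = Cavg g.
Proof. intros H; unfold Cavg; f_equal; apply Ravg_ext; intros; now rewrite H. Qed.

Lemma Cavg_const (c : C) : Cavg (fun _ => c) = c.
Proof. unfold Cavg; rewrite !Ravg_const; now destruct c. Qed.

Lemma Ccont_re (f : R -> C) : Ccont f -> forall t, continuity_pt (fun s => Re (f s)) t.
Proof. intros H t; apply H. Qed.
Lemma Ccont_im (f : R -> C) : Ccont f -> forall t, continuity_pt (fun s => Im (f s)) t.
Proof. intros H t; apply H. Qed.

Lemma Cavg_add (f g : R -> C) : Ccont f -> Ccont g ->
  Cavg (fun t => f t + g t)%C = (Cavg f + Cavg g)%C.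
Proof.
  intros Hf Hg. unfold Cavg, Cplus; simpl.
  f_equal; rewrite <- Ravg_plus; auto using Ccont_re, Ccont_im.
Qed.

Lemma continuity_pt_cmul (c : R) (f : R -> R) t : continuity_pt f t ->
  continuity_pt (fun s => c * f s) t.
Proof. intros; apply (continuity_pt_scal f c); auto. Qed.

Lemma Cavg_scal (c : C) (f : R -> C) : Ccont f -> Cavg (fun t => c * f t)%C = (c * Cavg f)%C.
Proof.
  intros Hf. unfold Cavg, Cmult; simpl. f_equal.
  - transitivity (Ravg (fun t => fst c * Re (f t) + (- snd c) * Im (f t))).
    + apply Ravg_ext; intros; unfold Re, Im; ring.
    + rewrite Ravg_plus, !Ravg_scal; auto using Ccont_re, Ccont_im, continuity_pt_cmul. ring.
  - transitivity (Ravg (fun t => fst c * Im (f t) + snd c * Re (f t))).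
    + apply Ravg_ext; intros; unfold Re, Im; ring.
    + rewrite Ravg_plus, !Ravg_scal; auto using Ccont_re, Ccont_im, continuity_pt_cmul.
Qed.

Lemma Cavg_opp (f : R -> C) : Ccont f -> Cavg (fun t => - f t)%C = (- Cavg f)%C.
Proof.
  intros Hf. rewrite (Cavg_ext _ (fun t => (RtoC (-1)) * f t)%C).
  - rewrite Cavg_scal; auto. apply injective_projections; simpl; ring.
  - intros; apply injective_projections; simpl; ring.
Qed.

Lemma Cavg_sub (f g : R -> C) : Ccont f -> Ccont g ->
  Cavg (fun t => f t - g t)%C = (Cavg f - Cavg g)%C.
Proof.
  intros Hf Hg. unfold Cminus. rewrite Cavg_add, Cavg_opp; auto using Ccont_opp.
Qed.

Lemma Cavg_conj (f : R -> C) : Ccont f -> Cavg (fun t => Cconj (f t)) = Cconj (Cavg f).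
Proof.
  intros Hf. unfold Cavg, Cconj; simpl. f_equal.
  transitivity (Ravg (fun t => (-1) * Im (f t))).
  - apply Ravg_ext; intros; unfold Im; ring.
  - rewrite Ravg_scal; auto using Ccont_im. ring.
Qed.

(** Multiplying g by the conjugate of its mean w reduces the bound to the real
    inequality |w|^2 <= |w| phi, averaged. *)
Lemma Cavg_norm (g : R -> C) (phi : R -> R) : Ccont g -> (forall t, continuity_pt phi t) ->
  (forall t, Cmod (g t) <= phi t) -> Cmod (Cavg g) <= Ravg phi.
Proof.
  intros Hg Hp H. set (w := Cavg g).
  destruct (Req_dec (Cmod w) 0) as [E|E].
  { rewrite E. rewrite <- (Ravg_const 0). apply Ravg_le; auto.
    - intros; apply continuity_pt_cst.
    - intros t. eapply Rle_trans; [apply Cmod_ge_0|apply H]. }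
  assert (E2 : Cmod w ^ 2 = Ravg (fun t => Re (Cconj w * g t)%C)).
  { transitivity (Re (Cavg (fun t => Cconj w * g t)%C)); [|reflexivity].
    rewrite Cavg_scal; auto. fold w. rewrite Cmod2_alt.
    destruct w as [a b]; simpl; ring. }
  assert (E3 : Ravg (fun t => Re (Cconj w * g t)%C) <= Ravg (fun t => Cmod w * phi t)).
  { apply Ravg_le.
    - apply Ccont_re. apply Ccont_mul; auto using Ccont_const.
    - intros; apply continuity_pt_cmul; auto.
    - intros t. eapply Rle_trans; [apply Rle_abs|]. eapply Rle_trans; [apply re_le_Cmod|].
      rewrite Cmod_mult, Cmod_conj. apply Rmult_le_compat_l; auto using Cmod_ge_0. }
  rewrite Ravg_scal in E3; auto. pose proof (Cmod_ge_0 w).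
  apply Rmult_le_reg_l with (Cmod w); nra.
Qed.

Lemma Cavg_norm_const (g : R -> C) M : Ccont g -> (forall t, Cmod (g t) <= M) -> Cmod (Cavg g) <= M.
Proof.
  intros Hg H. rewrite <- (Ravg_const M). apply Cavg_norm; auto.
  intros; apply continuity_pt_cst.
Qed.

(** The integrals over [2 pi, 2 pi + a] and [0, a] agree by periodicity. *)
Lemma RInt_shift_period (phi : R -> R) (a : R) : (forall t, continuity_pt phi t) ->
  (forall t, phi (t + 2 * PI) = phi t) ->
  RInt (fun t => phi (t + a)) 0 (2 * PI) = RInt phi 0 (2 * PI).
Proof.
  intros Hc Hp.
  assert (Hex : forall x y, ex_RInt phi x y) by (intros; apply ex_RInt_cont; auto).
  assert (Hsh : forall x y c, RInt (fun t => phi (t + c)) x y = RInt phi (x + c) (y + c)).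
  { intros x y c. transitivity (RInt (fun t => scal 1 (phi (1 * t + c))) x y).
    - apply RInt_ext; intros. unfold scal; simpl; unfold mult; simpl.
      rewrite Rmult_1_l. f_equal; ring.
    - rewrite (RInt_comp_lin (V := R_CompleteNormedModule)); auto.
      f_equal; ring. }
  rewrite Hsh.
  rewrite <- (RInt_Chasles phi (0 + a) 0 (2 * PI + a)); auto.
  rewrite <- (RInt_Chasles phi 0 (2 * PI) (2 * PI + a)); auto.
  replace (RInt phi (2 * PI) (2 * PI + a)) with (RInt phi 0 (0 + a)).
  - rewrite <- (opp_RInt_swap phi (0 + a) 0); auto. unfold plus, opp; simpl; ring.
  - replace (2 * PI) with (0 + 2 * PI) at 1 by ring.
    replace (2 * PI + a) with (a + 2 * PI) by ring.
    rewrite <- Hsh. replace (0 + a) with a by ring.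
    apply RInt_ext; intros; rewrite Hp; reflexivity.
Qed.

Lemma Cavg_shift (g : R -> C) (a : R) : Ccont g -> (forall t, g (t + 2 * PI) = g t) ->
  Cavg (fun t => g (t + a)) = Cavg g.
Proof.
  intros Hg Hp. unfold Cavg, Ravg. f_equal; f_equal.
  - apply (RInt_shift_period (fun t => Re (g t))); auto using Ccont_re. intros; now rewrite Hp.
  - apply (RInt_shift_period (fun t => Im (g t))); auto using Ccont_im. intros; now rewrite Hp.
Qed.

Lemma RInt_reflect (phi : R -> R) : (forall t, continuity_pt phi t) ->
  (forall t, phi (t + 2 * PI) = phi t) ->
  RInt (fun t => phi (- t)) 0 (2 * PI) = RInt phi 0 (2 * PI).
Proof.
  intros Hc Hp.
  transitivity (RInt (fun t => scal (-1) (scal (-1) (phi (-1 * t + 2 * PI)))) 0 (2 * PI)).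
  - apply RInt_ext; intros. unfold scal; simpl; unfold mult; simpl.
    rewrite Hp. replace (-1 * x) with (- x) by ring. ring.
  - rewrite (RInt_scal (V := R_CompleteNormedModule)).
    + rewrite (RInt_comp_lin (V := R_CompleteNormedModule)).
      * replace (-1 * 0 + 2 * PI) with (2 * PI) by ring.
        replace (-1 * (2 * PI) + 2 * PI) with 0 by ring.
        rewrite <- (opp_RInt_swap (V := R_CompleteNormedModule) phi 0 (2 * PI));
          auto using ex_RInt_cont.
        unfold scal, opp; simpl; unfold mult; simpl. ring.
      * apply ex_RInt_cont; auto.
    + apply (ex_RInt_comp_lin (V := R_CompleteNormedModule)). apply ex_RInt_cont; auto.
Qed.

Lemma Cavg_reflect (g : R -> C) : Ccont g -> (forall t, g (t + 2 * PI) = g t) ->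
  Cavg (fun t => g (- t)) = Cavg g.
Proof.
  intros Hg Hp. unfold Cavg, Ravg. f_equal; f_equal.
  - apply (RInt_reflect (fun t => Re (g t))); auto using Ccont_re. intros; now rewrite Hp.
  - apply (RInt_reflect (fun t => Im (g t))); auto using Ccont_im. intros; now rewrite Hp.
Qed.

Lemma circle_average_Cavg (f : C -> C) (a : C) (rho : R) :
  Ccont (fun t => f (a + RtoC rho * expi t)%C) ->
  circle_average f a rho = Cavg (fun t => f (a + RtoC rho * expi t)%C).
Proof.
  intros H. unfold circle_average.
  rewrite (is_RInt_unique (V := C_R_CompleteNormedModule) _ _ _
    (RInt (fun t => Re (f (a + RtoC rho * expi t)%C)) 0 (2 * PI),
     RInt (fun t => Im (f (a + RtoC rho * expi t)%C)) 0 (2 * PI))).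
  - unfold Cavg, Ravg, Cmult, RtoC; simpl. f_equal; ring.
  - apply (is_RInt_fct_extend_pair (U := R_NormedModule) (V := R_NormedModule));
      apply (RInt_correct (V := R_CompleteNormedModule)); apply ex_RInt_cont.
    + apply (Ccont_re _ H).
    + apply (Ccont_im _ H).
Qed.

Lemma expi_add s t : expi (s + t) = (expi s * expi t)%C.
Proof. unfold expi, Cmult; simpl. rewrite cos_plus, sin_plus. f_equal; ring. Qed.
Lemma expi_0 : expi 0 = 1%C.
Proof. unfold expi; now rewrite cos_0, sin_0. Qed.
Lemma expi_neg t : expi (- t) = Cconj (expi t).
Proof. unfold expi, Cconj; simpl. now rewrite cos_neg, sin_neg. Qed.
Lemma expi_period t : expi (t + 2 * PI) = expi t.
Proof. rewrite expi_add. unfold expi at 2. rewrite cos_2PI, sin_2PI. apply Cmult_1_r. Qed.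
Lemma Cmod_expi t : Cmod (expi t) = 1.
Proof.
  unfold expi, Cmod, fst, snd. pose proof (sin2_cos2 t). unfold Rsqr in H.
  replace (cos t ^ 2 + sin t ^ 2) with 1 by (simpl; lra). apply sqrt_1.
Qed.
Lemma expi_conj_r t : (expi t * Cconj (expi t))%C = 1%C.
Proof. rewrite <- expi_neg, <- expi_add, Rplus_opp_r, expi_0. reflexivity. Qed.
Lemma expi_pow t n : (expi t ^ n)%C = expi (INR n * t).
Proof.
  induction n; [simpl; rewrite Rmult_0_l, expi_0; reflexivity|].
  rewrite Cpow_S, IHn, <- expi_add, S_INR. f_equal; ring.
Qed.

Lemma Cavg_expi_pow n : (0 < n)%nat -> Cavg (fun t => expi t ^ n)%C = 0%C.
Proof.
  intros Hn. set (w := Cavg _).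
  assert (Hc : Ccont (fun t => expi t ^ n)%C) by (apply Ccont_pow, Ccont_expi).
  (* A shift by PI / n changes the sign of the integrand. *)
  assert (E : w = (- w)%C).
  { unfold w at 1. rewrite <- (Cavg_shift _ (PI / INR n)); auto.
    - rewrite (Cavg_ext _ (fun t => - (expi t ^ n))%C).
      + rewrite Cavg_opp; auto.
      + intros t. rewrite expi_add, Cpow_mult_l, (expi_pow (PI / INR n)).
        replace (INR n * (PI / INR n)) with PI.
        * unfold expi at 2. rewrite cos_PI, sin_PI.
          apply injective_projections; simpl; ring.
        * field. apply not_0_INR; lia.
    - intros t; now rewrite expi_period. }
  apply injective_projections; simpl.
  - apply (f_equal Re) in E. unfold Re in E; simpl in E. lra.
  - apply (f_equal Im) in E. unfold Im in E; simpl in E. lra.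
Qed.

(** * Polynomials, the disc algebra and the maximum principle *)

Fixpoint peval (l : list C) (x : C) : C :=
  match l with nil => 0%C | c :: l' => (c + x * peval l' x)%C end.

Definition ispoly (h : C -> C) : Prop := exists l, forall x, h x = peval l x.

Lemma ispoly_ext h1 h2 : (forall x, h1 x = h2 x) -> ispoly h1 -> ispoly h2.
Proof. intros H [l Hl]; exists l; intros; rewrite <- H; auto. Qed.

Lemma ispoly_const c : ispoly (fun _ => c).
Proof. exists (c :: nil); intros; simpl; ring. Qed.

Lemma ispoly_id : ispoly (fun x => x).
Proof. exists (RtoC 0 :: RtoC 1 :: nil)%C; intros; simpl; ring. Qed.

Lemma ispoly_cons c h : ispoly h -> ispoly (fun x => c + x * h x)%C.
Proof. intros [l Hl]; exists (c :: l); intros; simpl; now rewrite Hl. Qed.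

Lemma ispoly_scal c h : ispoly h -> ispoly (fun x => c * h x)%C.
Proof.
  intros [l Hl]. apply (ispoly_ext (fun x => c * peval l x)%C); [intros; now rewrite Hl|].
  clear Hl. induction l as [|d l IH].
  - apply (ispoly_ext (fun _ => 0%C)); [intros; simpl; ring|apply ispoly_const].
  - apply (ispoly_ext (fun x => c * d + x * (c * peval l x))%C);
      [intros; simpl; ring|apply ispoly_cons, IH].
Qed.

Lemma ispoly_add h1 h2 : ispoly h1 -> ispoly h2 -> ispoly (fun x => h1 x + h2 x)%C.
Proof.
  intros [l1 H1] [l2 H2].
  apply (ispoly_ext (fun x => peval l1 x + peval l2 x)%C); [intros; now rewrite H1, H2|].
  clear H1 H2. revert l2. induction l1 as [|c l1 IH]; intros l2.
  - exists l2; intros; simpl; ring.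
  - destruct l2 as [|d l2].
    + exists (c :: l1); intros; simpl; ring.
    + apply (ispoly_ext (fun x => (c + d) + x * (peval l1 x + peval l2 x))%C);
        [intros; simpl; ring|apply ispoly_cons, IH].
Qed.

Lemma ispoly_mul h1 h2 : ispoly h1 -> ispoly h2 -> ispoly (fun x => h1 x * h2 x)%C.
Proof.
  intros [l1 H1] H2.
  apply (ispoly_ext (fun x => peval l1 x * h2 x)%C); [intros; now rewrite H1|].
  clear H1. induction l1 as [|c l1 IH].
  - apply (ispoly_ext (fun _ => 0%C)); [intros; simpl; ring|apply ispoly_const].
  - apply (ispoly_ext (fun x => c * h2 x + (0 + x * (peval l1 x * h2 x)))%C);
      [intros; simpl; ring|].
    apply ispoly_add; [apply ispoly_scal, H2|apply ispoly_cons, IH].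
Qed.

Lemma ispoly_pow h n : ispoly h -> ispoly (fun x => h x ^ n)%C.
Proof.
  intros H; induction n; simpl; [apply ispoly_const|now apply ispoly_mul].
Qed.

Lemma ispoly_bounded h : ispoly h -> exists B, 0 <= B /\ forall x, Cmod x <= 1 -> Cmod (h x) <= B.
Proof.
  intros [l Hl]. enough (exists B, 0 <= B /\ forall x, Cmod x <= 1 -> Cmod (peval l x) <= B)
    as [B [HB H]] by (exists B; split; auto; intros; rewrite Hl; auto).
  clear. induction l as [|c l [B [HB IH]]].
  - exists 0; split; [lra|]. intros; simpl. rewrite Cmod_0; lra.
  - exists (Cmod c + B). pose proof (Cmod_ge_0 c). split; [lra|]. intros x Hx; simpl.
    eapply Rle_trans; [apply Cmod_triangle|]. apply Rplus_le_compat_l.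
    rewrite Cmod_mult. specialize (IH x Hx). pose proof (Cmod_ge_0 x).
    pose proof (Cmod_ge_0 (peval l x)). nra.
Qed.

Lemma Ccont_peval l g : Ccont g -> Ccont (fun t => peval l (g t)).
Proof.
  intros Hg. induction l; simpl; [apply Ccont_const|].
  apply Ccont_add; [apply Ccont_const|apply Ccont_mul; auto].
Qed.

Lemma geometric_small q K e : 0 <= q < 1 -> 0 < e -> exists N, q ^ N * K < e.
Proof.
  intros Hq He. destruct (Rle_lt_dec K 0) as [HK|HK].
  - exists 0%nat. simpl. lra.
  - destruct (pow_lt_1_zero q) with (y := e / K) as [N HN].
    + rewrite Rabs_pos_eq; lra.
    + apply Rdiv_lt_0_compat; auto.
    + exists N. specialize (HN N (Nat.le_refl _)).
      rewrite Rabs_pos_eq in HN by (apply pow_le; lra).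
      apply Rmult_lt_compat_r with (r := K) in HN; auto.
      replace (e / K * K) with e in HN by (field; lra). exact HN.
Qed.

Lemma geometric_le_0 q K x : 0 <= q < 1 -> (forall N, x <= q ^ N * K) -> x <= 0.
Proof.
  intros Hq H. destruct (Rle_lt_dec x 0) as [|Hx]; auto.
  destruct (geometric_small q K x Hq Hx) as [N HN]. specialize (H N). lra.
Qed.

Lemma Cmod_sub_ge x y : Cmod x - Cmod y <= Cmod (x - y).
Proof.
  pose proof (Cmod_triangle (x - y) y). replace (x - y + y)%C with x in H by ring. lra.
Qed.

Lemma Cmod_sub_sym x y : Cmod (x - y) = Cmod (y - x).
Proof. rewrite <- Cmod_opp. f_equal; ring. Qed.

Lemma Cminus_nz (x y : C) : Cmod y < Cmod x -> (x - y)%C <> 0%C.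
Proof.
  intros H E. assert (x = y) by (replace x with (x - y + y)%C by ring; rewrite E; ring).
  subst; lra.
Qed.

(** Iterating the recursion N times gains a factor |xi|^N. *)
Lemma decaying_recursion (xi : C) (a : nat -> C) (K : R) : Cmod xi < 1 ->
  (forall k, a k = (xi * a (S k))%C) -> (forall k, Cmod (a k) <= K) -> forall k, a k = 0%C.
Proof.
  intros Hx Hs Hb k. apply Cmod_eq_0. apply Rle_antisym; [|apply Cmod_ge_0].
  apply (geometric_le_0 (Cmod xi) K); [split; [apply Cmod_ge_0|auto]|].
  intros N. revert k. induction N as [|N IH]; intros k; simpl.
  - rewrite Rmult_1_l. apply Hb.
  - rewrite Hs, Cmod_mult, Rmult_assoc. apply Rmult_le_compat_l; [apply Cmod_ge_0|apply IH].
Qed.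

Section Kernel.
Variable xi : C.
Hypothesis Hxi : Cmod xi < 1.

Let ker (t : R) : C := (/ (1 - xi * Cconj (expi t)))%C.

Lemma ker_den_nz t : (1 - xi * Cconj (expi t))%C <> 0%C.
Proof. apply Cminus_nz. rewrite Cmod_mult, Cmod_conj, Cmod_expi, Cmod_1; lra. Qed.

Lemma ker_cont : Ccont ker.
Proof.
  apply Ccont_inv; [|apply ker_den_nz].
  auto with ccont.
Qed.

Lemma ker_bound t : Cmod (ker t) <= / (1 - Cmod xi).
Proof.
  unfold ker. rewrite Cmod_inv by apply ker_den_nz.
  apply Rinv_le_contravar; [lra|].
  eapply Rle_trans; [|apply Cmod_sub_ge].
  rewrite Cmod_mult, Cmod_conj, Cmod_expi, Cmod_1; lra.
Qed.

(** The geometric series of the kernel in recursive form; applied under the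
    mean it gives all the moments without summing a series. *)
Lemma ker_rec t : ker t = (1 + xi * Cconj (expi t) * ker t)%C.
Proof. unfold ker. field. apply ker_den_nz. Qed.

Lemma ker_conj_moment m : Cavg (fun t => Cconj (expi t) ^ S m * ker t)%C = 0%C.
Proof.
  assert (Hc : forall m, Ccont (fun t => Cconj (expi t) ^ m)%C)
    by auto with ccont.
  assert (Hs : forall m, Cavg (fun t => Cconj (expi t) ^ S m * ker t)%C =
     (xi * Cavg (fun t => Cconj (expi t) ^ S (S m) * ker t))%C).
  { intros k. rewrite <- Cavg_scal by (apply Ccont_mul; auto using ker_cont).
    transitivity (Cavg (fun t => Cconj (expi t ^ S k) +
        xi * (Cconj (expi t) ^ S (S k) * ker t))%C).
    - apply Cavg_ext; intros t. rewrite ker_rec at 1. rewrite Cpow_conj. simpl. ring.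
    - rewrite Cavg_add.
      + rewrite Cavg_conj by (apply Ccont_pow, Ccont_expi).
        rewrite Cavg_expi_pow by lia. unfold Cconj; simpl.
        rewrite Ropp_0. apply Cplus_0_l.
      + auto with ccont.
      + auto using ker_cont with ccont. }
  assert (Hb : forall k, Cmod (Cavg (fun t => Cconj (expi t) ^ S k * ker t)%C) <= / (1 - Cmod xi)).
  { intros k. apply Cavg_norm_const; [apply Ccont_mul; auto using ker_cont|].
    intros t. rewrite Cmod_mult, Cmod_pow, Cmod_conj, Cmod_expi, pow1, Rmult_1_l.
    apply ker_bound. }
  exact (decaying_recursion xi (fun k => Cavg (fun t => Cconj (expi t) ^ S k * ker t)%C) _
           Hxi Hs Hb m).
Qed.

Lemma ker_moment j : Cavg (fun t => expi t ^ j * ker t)%C = (xi ^ j)%C.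
Proof.
  assert (Hc : forall m, Ccont (fun t => Cconj (expi t) ^ m)%C)
    by auto with ccont.
  induction j.
  - simpl. transitivity (Cavg (fun t => 1 + xi * (Cconj (expi t) ^ 1 * ker t))%C).
    + apply Cavg_ext; intros t. rewrite ker_rec at 1. simpl; ring.
    + rewrite Cavg_add, Cavg_const, Cavg_scal, ker_conj_moment.
      * ring.
      all: auto using ker_cont with ccont.
  - transitivity (Cavg (fun t => expi t ^ S j + xi * (expi t ^ j * ker t))%C).
    + apply Cavg_ext; intros t. rewrite ker_rec at 1. rewrite !Cpow_S.
      transitivity (expi t * expi t ^ j + xi * (expi t ^ j) * (expi t * Cconj (expi t)) * ker t)%C;
        [ring|]. rewrite expi_conj_r. ring.
    + rewrite Cavg_add, Cavg_expi_pow, Cavg_scal, IHj; try lia.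
      * rewrite Cpow_S. ring.
      * auto using ker_cont with ccont.
      * auto with ccont.
      * auto using ker_cont with ccont.
Qed.

(** Cauchy's formula, with the kernel 1/(1 - xi conj zeta) on the unit circle.
    The power zeta^j makes the induction over the coefficients go through. *)
Lemma Cauchy_formula_peval l j :
  Cavg (fun t => expi t ^ j * peval l (expi t) * ker t)%C = (xi ^ j * peval l xi)%C.
Proof.
  revert j. induction l as [|c l IH]; intros j; simpl.
  - rewrite (Cavg_ext _ (fun _ => 0%C)) by (intros; ring). rewrite Cavg_const; ring.
  - rewrite (Cavg_ext _ (fun t => c * (expi t ^ j * ker t) +
       expi t ^ S j * peval l (expi t) * ker t)%C) by (intros; simpl; ring).
    rewrite Cavg_add, IH, Cavg_scal, ker_moment.
    + simpl; ring.
    + auto using ker_cont with ccont.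
    + auto using ker_cont with ccont.
    + auto 6 using ker_cont, Ccont_peval with ccont.
Qed.

Lemma Cauchy_bound h M : ispoly h -> (forall x, Cmod x = 1 -> Cmod (h x) <= M) ->
  Cmod (h xi) <= / (1 - Cmod xi) * M.
Proof.
  intros [l Hl] HM.
  assert (E : h xi = Cavg (fun t => peval l (expi t) * ker t)%C).
  { rewrite Hl. transitivity (xi ^ 0 * peval l xi)%C; [simpl; ring|].
    rewrite <- Cauchy_formula_peval. apply Cavg_ext; intros; simpl; ring. }
  rewrite E. apply Cavg_norm_const.
  - apply Ccont_mul; [apply Ccont_peval, Ccont_expi|apply ker_cont].
  - intros t. rewrite Cmod_mult, Rmult_comm, <- Hl.
    apply Rmult_le_compat; auto using Cmod_ge_0, ker_bound, Cmod_expi.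
Qed.
End Kernel.

(** Applied to the powers of a function, this removes the constant K from an
    estimate that is uniform over a class closed under products. *)
Lemma power_trick x M K : 0 <= x -> 0 <= M -> (forall m, x ^ m <= K * M ^ m) -> x <= M.
Proof.
  intros Hx HM H. destruct (Rle_lt_dec x M) as [|Hlt]; auto. exfalso.
  assert (1 <= 0); [|lra].
  apply (geometric_le_0 (M / x) K).
  - split; [apply Rmult_le_pos; auto; left; apply Rinv_0_lt_compat; lra|].
    apply Rmult_lt_reg_r with x; [lra|]. unfold Rdiv. rewrite Rmult_assoc, Rinv_l; lra.
  - intros N. specialize (H N). unfold Rdiv. rewrite Rpow_mult_distr, pow_inv.
    assert (0 < x ^ N) by (apply pow_lt; lra).
    apply Rmult_le_reg_r with (x ^ N); auto.
    replace (M ^ N * / x ^ N * K * x ^ N) with (K * M ^ N) by (field; lra). lra.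
Qed.

(** Cauchy's formula loses the factor 1/(1 - |xi|), which does not depend on
    the polynomial; using the formula for h^m and taking m-th roots removes it. *)
Lemma max_principle_poly h M xi : ispoly h -> (forall x, Cmod x = 1 -> Cmod (h x) <= M) ->
  Cmod xi <= 1 -> Cmod (h xi) <= M.
Proof.
  intros Hh HM [Hx|Hx]; [|auto].
  assert (0 <= M) by (eapply Rle_trans; [apply Cmod_ge_0|apply (HM 1%C), Cmod_1]).
  apply power_trick with (/ (1 - Cmod xi)); auto using Cmod_ge_0.
  intros m. rewrite <- Cmod_pow.
  apply (Cauchy_bound xi Hx (fun x => h x ^ m)%C); [apply ispoly_pow, Hh|].
  intros x E. rewrite Cmod_pow. apply pow_incr. split; auto using Cmod_ge_0.
Qed.

(** Uniform limits of polynomials on the closed disc.  The class is stable under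
    products and contains 1/(b + a x), so that the rational functions met on
    Lambda^- can be treated without power series. *)
Definition diskalg (h : C -> C) : Prop := forall e, 0 < e ->
  exists q, ispoly q /\ forall x, Cmod x <= 1 -> Cmod (h x - q x) <= e.

Lemma diskalg_poly h : ispoly h -> diskalg h.
Proof.
  intros Hh e He; exists h; split; auto. intros.
  replace (h x - h x)%C with (RtoC 0) by ring. rewrite Cmod_0; lra.
Qed.

Lemma diskalg_ext h1 h2 : (forall x, Cmod x <= 1 -> h1 x = h2 x) -> diskalg h1 -> diskalg h2.
Proof.
  intros H H1 e He. destruct (H1 e He) as [q [Hq Hb]]. exists q; split; auto.
  intros x Hx. rewrite <- H; auto.
Qed.

Lemma diskalg_bounded h : diskalg h -> exists B, 0 <= B /\ forall x, Cmod x <= 1 -> Cmod (h x) <= B.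
Proof.
  intros H. destruct (H 1 Rlt_0_1) as [q [Hq Hb]].
  destruct (ispoly_bounded q Hq) as [B [HB HqB]]. exists (1 + B); split; [lra|].
  intros x Hx. replace (h x) with ((h x - q x) + q x)%C by ring.
  eapply Rle_trans; [apply Cmod_triangle|]. specialize (Hb x Hx). specialize (HqB x Hx). lra.
Qed.

Lemma diskalg_add h1 h2 : diskalg h1 -> diskalg h2 -> diskalg (fun x => h1 x + h2 x)%C.
Proof.
  intros H1 H2 e He. destruct (H1 (e/2) ltac:(lra)) as [q1 [Q1 B1]].
  destruct (H2 (e/2) ltac:(lra)) as [q2 [Q2 B2]].
  exists (fun x => q1 x + q2 x)%C; split; [now apply ispoly_add|].
  intros x Hx. specialize (B1 x Hx). specialize (B2 x Hx).
  replace (h1 x + h2 x - (q1 x + q2 x))%C with ((h1 x - q1 x) + (h2 x - q2 x))%C by ring.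
  eapply Rle_trans; [apply Cmod_triangle|]. lra.
Qed.

Lemma diskalg_mul h1 h2 : diskalg h1 -> diskalg h2 -> diskalg (fun x => h1 x * h2 x)%C.
Proof.
  intros H1 H2 e He.
  destruct (diskalg_bounded h2 H2) as [M2 [HM2 HB2]].
  destruct (H1 (e / 2 / (M2 + 1))) as [q1 [Q1 B1]].
  { apply Rdiv_lt_0_compat; lra. }
  destruct (ispoly_bounded q1 Q1) as [M1 [HM1 HB1]].
  destruct (H2 (e / 2 / (M1 + 1))) as [q2 [Q2 B2]].
  { apply Rdiv_lt_0_compat; lra. }
  exists (fun x => q1 x * q2 x)%C; split; [now apply ispoly_mul|].
  intros x Hx. specialize (B1 x Hx). specialize (B2 x Hx).
  specialize (HB1 x Hx). specialize (HB2 x Hx).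
  replace (h1 x * h2 x - q1 x * q2 x)%C with ((h1 x - q1 x) * h2 x + q1 x * (h2 x - q2 x))%C by ring.
  eapply Rle_trans; [apply Cmod_triangle|]. rewrite !Cmod_mult.
  assert (Cmod (h1 x - q1 x) * Cmod (h2 x) <= e / 2 / (M2 + 1) * (M2 + 1)).
  { apply Rmult_le_compat; auto using Cmod_ge_0; lra. }
  assert (Cmod (q1 x) * Cmod (h2 x - q2 x) <= (M1 + 1) * (e / 2 / (M1 + 1))).
  { apply Rmult_le_compat; auto using Cmod_ge_0; lra. }
  replace (e / 2 / (M2 + 1) * (M2 + 1)) with (e / 2) in H by (field; lra).
  replace ((M1 + 1) * (e / 2 / (M1 + 1))) with (e / 2) in H0 by (field; lra). lra.
Qed.

Lemma diskalg_const c : diskalg (fun _ => c).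
Proof. apply diskalg_poly, ispoly_const. Qed.
Lemma diskalg_id : diskalg (fun x => x).
Proof. apply diskalg_poly, ispoly_id. Qed.
Lemma diskalg_pow h n : diskalg h -> diskalg (fun x => h x ^ n)%C.
Proof. intros H; induction n; simpl; [apply diskalg_const|now apply diskalg_mul]. Qed.

Fixpoint geom (N : nat) (y : C) : C :=
  match N with O => 0%C | S N => (1 + y * geom N y)%C end.

Lemma geom_eq N y : ((1 - y) * geom N y)%C = (1 - y ^ N)%C.
Proof.
  induction N; simpl; [ring|].
  transitivity (1 - y + y * ((1 - y) * geom N y))%C; [ring|]. rewrite IHN. ring.
Qed.

(** The partial sums of the geometric series are the polynomials that
    approximate 1/(b + a x) in [diskalg_inv_lin]. *)
Lemma geom_poly c N : ispoly (fun x => geom N (c * x)%C).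
Proof.
  induction N; simpl; [apply ispoly_const|].
  apply ispoly_add; [apply ispoly_const|]. apply ispoly_mul; auto.
  apply ispoly_scal, ispoly_id.
Qed.

Lemma geom_error N y q : Cmod y <= q -> q < 1 ->
  Cmod (/ (1 - y) - geom N y) <= q ^ N * / (1 - q).
Proof.
  intros H1 H2. pose proof (Cmod_ge_0 y).
  assert (Hn : (1 - y)%C <> 0%C) by (apply Cminus_nz; rewrite Cmod_1; lra).
  replace (/ (1 - y) - geom N y)%C with (y ^ N / (1 - y))%C.
  - rewrite Cmod_div by auto. rewrite Cmod_pow. unfold Rdiv.
    apply Rmult_le_compat.
    + apply pow_le; auto.
    + left; apply Rinv_0_lt_compat. now apply Cmod_gt_0.
    + apply pow_incr; auto.
    + apply Rinv_le_contravar; [lra|].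
      eapply Rle_trans; [|apply Cmod_sub_ge]. rewrite Cmod_1; lra.
  - replace (y ^ N)%C with (1 - (1 - y) * geom N y)%C by (rewrite geom_eq; ring).
    field. auto.
Qed.

Lemma diskalg_inv_lin (b a : C) : Cmod a < Cmod b -> diskalg (fun x => / (b + a * x))%C.
Proof.
  intros Hab. pose proof (Cmod_ge_0 a).
  assert (Hb : b <> 0%C) by (apply Cmod_gt_0; lra).
  set (c := (- (a / b))%C). set (q := Cmod c).
  assert (Hq : 0 <= q < 1).
  { unfold q, c. rewrite Cmod_opp, Cmod_div by auto. split.
    - apply Rmult_le_pos; auto. left; apply Rinv_0_lt_compat; lra.
    - apply Rmult_lt_reg_r with (Cmod b); [lra|]. unfold Rdiv. rewrite Rmult_assoc, Rinv_l; lra. }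
  apply (diskalg_ext (fun x => / b * / (1 - c * x))%C).
  { intros x Hx. unfold c. field. repeat split; auto.
    - replace (b + a * x)%C with (b - (- (a * x)))%C by ring. apply Cminus_nz.
      rewrite Cmod_opp, Cmod_mult. pose proof (Cmod_ge_0 x); nra. }
  apply diskalg_mul; [apply diskalg_const|].
  intros e He. destruct (geometric_small q (/ (1 - q)) e Hq He) as [N HN].
  exists (fun x => geom N (c * x)%C); split; [apply geom_poly|].
  intros x Hx. eapply Rle_trans; [|left; exact HN]. apply geom_error; [|lra].
  rewrite Cmod_mult. fold q. nra.
Qed.

Lemma diskalg_max h M xi : diskalg h -> (forall x, Cmod x = 1 -> Cmod (h x) <= M) ->
  Cmod xi <= 1 -> Cmod (h xi) <= M.
Proof.
  intros Hh HM Hx. apply le_epsilon. intros e He.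
  destruct (Hh (e/2) ltac:(lra)) as [p [Hp Hb]].
  assert (Cmod (p xi) <= M + e / 2).
  { apply (max_principle_poly p); auto. intros x E.
    replace (p x) with (h x - (h x - p x))%C by ring.
    unfold Cminus at 1. eapply Rle_trans; [apply Cmod_triangle|]. rewrite Cmod_opp.
    specialize (HM x E). specialize (Hb x ltac:(lra)). lra. }
  replace (h xi) with (h xi - p xi + p xi)%C by ring.
  eapply Rle_trans; [apply Cmod_triangle|]. specialize (Hb xi Hx). lra.
Qed.

Lemma Cavg_peval l : Cavg (fun t => peval l (expi t)) = peval l 0%C.
Proof.
  destruct l as [|c l]; simpl; [apply Cavg_const|].
  rewrite Cavg_add, Cavg_const.
  - rewrite (Cavg_ext _ (fun t => expi t ^ 1 * peval l (expi t) * / (1 - 0 * Cconj (expi t)))%C).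
    + rewrite Cauchy_formula_peval; [simpl; ring|]. rewrite Cmod_0; lra.
    + intros; simpl. field.
  - apply Ccont_const.
  - auto using Ccont_peval with ccont.
Qed.

Lemma diskalg_mean h : diskalg h -> Ccont (fun t => h (expi t)) ->
  Cavg (fun t => h (expi t)) = h 0%C.
Proof.
  intros Hh Hc.
  assert (E : Cmod (Cavg (fun t => h (expi t)) - h 0%C) <= 0).
  { apply le_epsilon. intros e He. rewrite Rplus_0_l.
    destruct (Hh (e/2) ltac:(lra)) as [p [[l Hl] Hb]].
    replace (Cavg (fun t => h (expi t)) - h 0)%C with
      (Cavg (fun t => h (expi t) - peval l (expi t)) - (h 0 - peval l 0))%C.
    - unfold Cminus at 1. eapply Rle_trans; [apply Cmod_triangle|]. rewrite Cmod_opp, <- Hl.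
      assert (Cmod (h 0 - p 0)%C <= e / 2) by (apply Hb; rewrite Cmod_0; lra).
      assert (Cmod (Cavg (fun t => h (expi t) - peval l (expi t))%C) <= e / 2).
      { apply Cavg_norm_const; [apply Ccont_sub; auto; apply Ccont_peval, Ccont_expi|].
        intros t. rewrite <- Hl. apply Hb. rewrite Cmod_expi; lra. }
      lra.
    - rewrite Cavg_sub, Cavg_peval; auto; [ring|apply Ccont_peval, Ccont_expi]. }
  apply Ceq_minus. apply Cmod_eq_0. apply Rle_antisym; auto using Cmod_ge_0.
Qed.

Lemma diskalg_mean_conj h : diskalg h -> Ccont (fun t => h (expi t)) ->
  Cavg (fun t => h (Cconj (expi t))) = h 0%C.
Proof.
  intros Hh Hc. rewrite <- (diskalg_mean h Hh Hc).
  rewrite <- (Cavg_reflect (fun t => h (expi t))); auto.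
  - apply Cavg_ext; intros; now rewrite expi_neg.
  - intros; now rewrite expi_period.
Qed.

(** * Exchanging integrals of continuous functions *)

Lemma cont2_slice1 (h : R -> R -> R) x y : continuity_2d_pt h x y -> continuity_pt (fun u => h u y) x.
Proof.
  intros H. apply continuity_pt_eps. intros e He.
  destruct (H (mkposreal e He)) as [d Hd]. exists d; split; [apply cond_pos|].
  intros s Hs. apply Hd; auto. rewrite Rminus_diag, Rabs_R0. apply cond_pos.
Qed.

Lemma cont2_slice2 (h : R -> R -> R) x y : continuity_2d_pt h x y -> continuity_pt (fun v => h x v) y.
Proof.
  intros H. apply continuity_pt_eps. intros e He.
  destruct (H (mkposreal e He)) as [d Hd]. exists d; split; [apply cond_pos|].
  intros s Hs. apply Hd; auto. rewrite Rminus_diag, Rabs_R0. apply cond_pos.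
Qed.

Lemma cont_RInt_param (h : R -> R -> R) c d : c <= d -> (forall x y, continuity_2d_pt h x y) ->
  forall x, continuity_pt (fun x => RInt (fun y => h x y) c d) x.
Proof.
  intros Hcd Hc x0. apply continuity_pt_eps. intros e He.
  assert (He' : 0 < e / (d - c + 1)) by (apply Rdiv_lt_0_compat; lra).
  destruct (uniform_continuity_2d_1d' h c d x0 (fun x _ => Hc x0 x) (mkposreal _ He')) as [dl Hd].
  simpl in Hd. exists dl; split; [apply cond_pos|]. intros s Hs.
  assert (Hex : forall u, ex_RInt (fun y => h u y) c d).
  { intros u. apply ex_RInt_cont. intros t. apply cont2_slice2, Hc. }
  replace (RInt (fun y => h s y) c d - RInt (fun y => h x0 y) c d)
    with (RInt (fun y => h s y - h x0 y) c d).
  2:{ rewrite (RInt_minus (V := R_CompleteNormedModule)); auto. }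
  apply Rle_lt_trans with (RInt (fun _ => e / (d - c + 1)) c d).
  - eapply Rle_trans; [apply abs_RInt_le; auto|].
    + apply (ex_RInt_minus (V := R_CompleteNormedModule)); auto.
    + apply RInt_le; auto.
      * apply ex_RInt_cont. intros t. apply (continuity_pt_comp (fun y => h s y - h x0 y) Rabs).
        -- apply (continuity_pt_minus (fun y => h s y) (fun y => h x0 y)); apply cont2_slice2, Hc.
        -- apply Rcontinuity_abs.
      * apply (ex_RInt_const (V := R_CompleteNormedModule)).
      * intros y Hy. left. apply Hd; try lra.
        -- pose proof (cond_pos dl); lra.
        -- apply Rabs_lt_between in Hs. lra.
        -- rewrite Rminus_diag, Rabs_R0. apply cond_pos.
  - rewrite (RInt_const (V := R_CompleteNormedModule)). unfold scal; simpl; unfold mult; simpl.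
    apply Rmult_lt_reg_r with (d - c + 1); [lra|].
    replace ((d - c) * (e / (d - c + 1)) * (d - c + 1)) with ((d - c) * e) by (field; lra). nra.
Qed.

Lemma continuity_2d_swap (h : R -> R -> R) x y :
  continuity_2d_pt h x y -> continuity_2d_pt (fun u v => h v u) y x.
Proof. intros H e. destruct (H e) as [d Hd]. exists d. intros u v Hu Hv. apply Hd; auto. Qed.

(** As functions of the upper limit b, both sides have the derivative
    x |-> RInt (h x) c d, and both vanish at b = a. *)
Lemma Fubini (h : R -> R -> R) a b c d : a <= b -> c <= d ->
  (forall x y, continuity_2d_pt h x y) ->
  RInt (fun x => RInt (fun y => h x y) c d) a b = RInt (fun y => RInt (fun x => h x y) a b) c d.
Proof.
  intros Hab Hcd Hc.
  destruct Hab as [Hab| <-].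
  2:{ rewrite RInt_point. rewrite (RInt_ext _ (fun _ => 0)).
      - rewrite (RInt_const (V := R_CompleteNormedModule)).
        unfold scal, zero; simpl; unfold mult; simpl; ring.
      - intros. apply (RInt_point (V := R_CompleteNormedModule)). }
  set (Phi X := RInt (fun x => RInt (fun y => h x y) c d) a X).
  set (Psi X := RInt (fun y => RInt (fun x => h x y) a X) c d).
  assert (Hp := cont_RInt_param h c d Hcd Hc).
  assert (D1 : forall X, is_derive Phi X (RInt (fun y => h X y) c d)).
  { intros X. apply (is_derive_RInt (V := R_NormedModule) (fun x => RInt (fun y => h x y) c d) Phi a).
    - exists (mkposreal 1 Rlt_0_1). intros y _. apply (RInt_correct (V := R_CompleteNormedModule)).
      apply ex_RInt_cont; auto.
    - apply continuity_pt_continuous; auto. }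
  assert (DD : forall X y, is_derive (fun z => RInt (fun x => h x y) a z) X (h X y)).
  { intros X y. apply (is_derive_RInt (V :=
    R_NormedModule) (fun x => h x y) (fun z => RInt (fun x => h x y) a z) a).
    - exists (mkposreal 1 Rlt_0_1). intros z _. apply (RInt_correct (V := R_CompleteNormedModule)).
      apply ex_RInt_cont. intros t. apply cont2_slice1, Hc.
    - apply continuity_pt_continuous. apply cont2_slice1, Hc. }
  assert (D2 : forall X, is_derive Psi X (RInt (fun y => h X y) c d)).
  { intros X.
    replace (RInt (fun y => h X y) c d) with
      (RInt (fun t => Derive (fun u => RInt (fun x => h x t) a u) X) c d).
    2:{ apply RInt_ext. intros t _. apply is_derive_unique, DD. }
    apply (is_derive_RInt_param (fun u t => RInt (fun x => h x t) a u) c d X).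
    - exists (mkposreal 1 Rlt_0_1). intros z _ t _. exists (h z t). apply DD.
    - intros t _. apply (continuity_2d_pt_ext h); [|apply Hc].
      intros. symmetry. apply is_derive_unique, DD.
    - exists (mkposreal 1 Rlt_0_1). intros z _. apply ex_RInt_cont.
      intros t. destruct (Rle_lt_dec a z) as [Haz|Haz].
      + apply (cont_RInt_param (fun y x => h x y) a z Haz).
        intros; apply continuity_2d_swap, Hc.
      + apply (continuity_pt_ext (fun t => - RInt (fun x => h x t) z a)).
        * intros s. apply (opp_RInt_swap (V := R_CompleteNormedModule)).
          apply ex_RInt_cont. intros w. apply cont2_slice1, Hc.
        * apply (continuity_pt_opp (fun t => RInt (fun x => h x t) z a)).
          apply (cont_RInt_param (fun y x => h x y) z a (Rlt_le _ _ Haz)).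
          intros; apply continuity_2d_swap, Hc. }
  assert (E : Phi a - Psi a = Phi b - Psi b).
  { apply (eq_is_derive (V := R_NormedModule) (fun X => Phi X - Psi X)); auto.
    intros t _. evar_last; [apply (is_derive_minus (V := R_NormedModule) Phi Psi); auto|].
    unfold minus, plus, opp, zero; simpl. ring. }
  assert (Phi a = 0) by (apply (RInt_point (V := R_CompleteNormedModule))).
  assert (Psi a = 0).
  { unfold Psi. rewrite (RInt_ext _ (fun _ => 0)).
    - rewrite (RInt_const (V := R_CompleteNormedModule)). unfold scal; simpl; unfold mult; simpl; ring.
    - intros. apply (RInt_point (V := R_CompleteNormedModule)). }
  fold (Phi b). fold (Psi b). lra.
Qed.

Definition Ccont2 (F : R -> R -> C) : Prop := forall x y,
  continuity_2d_pt (fun u v => Re (F u v)) x y /\ continuity_2d_pt (fun u v => Im (F u v)) x y.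

Definition Cint (g : R -> C) (a b : R) : C :=
  (RInt (fun t => Re (g t)) a b, RInt (fun t => Im (g t)) a b).

Lemma Cavg_Cint g : Cavg g = (RtoC (/ (2 * PI)) * Cint g 0 (2 * PI))%C.
Proof. unfold Cavg, Cint, Ravg, Cmult, RtoC; simpl. f_equal; ring. Qed.

Lemma Ccont2_slice1 F y : Ccont2 F -> Ccont (fun x => F x y).
Proof.
  intros H t. destruct (H t y) as [H1 H2]. split.
  - apply (cont2_slice1 (fun u v => Re (F u v)) t y H1).
  - apply (cont2_slice1 (fun u v => Im (F u v)) t y H2).
Qed.

Lemma Ccont_Cint F a b : a <= b -> Ccont2 F -> Ccont (fun y => Cint (fun x => F x y) a b).
Proof.
  intros Hab H t. split.
  - apply (cont_RInt_param (fun y x => Re (F x y)) a b Hab).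
    intros; apply (continuity_2d_swap (fun u v => Re (F u v))), H.
  - apply (cont_RInt_param (fun y x => Im (F x y)) a b Hab).
    intros; apply (continuity_2d_swap (fun u v => Im (F u v))), H.
Qed.

Lemma Cavg_Cint_0 F a b : a <= b -> Ccont2 F ->
  (forall x, a <= x <= b -> Cavg (fun y => F x y) = 0%C) ->
  Cavg (fun y => Cint (fun x => F x y) a b) = 0%C.
Proof.
  intros Hab HF H0. pose proof twoPI_pos as Hpi.
  assert (Hr : forall x, a <= x <= b -> RInt (fun y => Re (F x y)) 0 (2 * PI) = 0 /\
                         RInt (fun y => Im (F x y)) 0 (2 * PI) = 0).
  { intros x Hx. specialize (H0 x Hx). unfold Cavg, Ravg in H0.
    assert (Hn : / (2 * PI) <> 0) by (apply Rinv_neq_0_compat; lra).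
    split; apply Rmult_eq_reg_l with (/ (2 * PI)); auto; rewrite Rmult_0_r;
      [apply (f_equal Re H0)|apply (f_equal Im H0)]. }
  unfold Cavg, Ravg, Cint; cbn [Re Im fst snd].
  assert (E1 : RInt (fun y => RInt (fun x => Re (F x y)) a b) 0 (2 * PI) = 0).
  { rewrite <- (Fubini (fun x y => Re (F x y))); [|auto|lra|intros; apply HF].
    rewrite (RInt_ext _ (fun _ => 0)).
    - rewrite (RInt_const (V := R_CompleteNormedModule)). unfold scal; simpl; unfold mult; simpl; ring.
    - intros x Hx. rewrite Rmin_left, Rmax_right in Hx by auto. exact (proj1 (Hr x ltac:(lra))). }
  assert (E2 : RInt (fun y => RInt (fun x => Im (F x y)) a b) 0 (2 * PI) = 0).
  { rewrite <- (Fubini (fun x y => Im (F x y))); [|auto|lra|intros; apply HF].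
    rewrite (RInt_ext _ (fun _ => 0)).
    - rewrite (RInt_const (V := R_CompleteNormedModule)). unfold scal; simpl; unfold mult; simpl; ring.
    - intros x Hx. rewrite Rmin_left, Rmax_right in Hx by auto. exact (proj2 (Hr x ltac:(lra))). }
  simpl. rewrite E1, E2. unfold RtoC. f_equal; ring.
Qed.

Lemma Ccont2_eps F : (forall x y e, 0 < e -> exists d, 0 < d /\ forall u v,
    Rabs (u - x) < d -> Rabs (v - y) < d -> Cmod (F u v - F x y) < e) -> Ccont2 F.
Proof.
  intros H x y. split; intros [e He]; destruct (H x y e He) as [d [Hd Hs]];
    exists (mkposreal d Hd); intros u v Hu Hv; simpl in *;
    (eapply Rle_lt_trans; [|apply (Hs u v Hu Hv)]).
  - apply (re_le_Cmod (F u v - F x y)).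
  - apply (Im_le_Cmod (F u v - F x y)).
Qed.

Lemma Ccont2_eps' F : Ccont2 F -> forall x y e, 0 < e -> exists d, 0 < d /\ forall u v,
    Rabs (u - x) < d -> Rabs (v - y) < d -> Cmod (F u v - F x y) < e.
Proof.
  intros H x y e He. destruct (H x y) as [H1 H2].
  assert (He2 : 0 < e / 2) by lra.
  destruct (H1 (mkposreal _ He2)) as [d1 Hd1]. destruct (H2 (mkposreal _ He2)) as [d2 Hd2].
  simpl in *. exists (Rmin d1 d2). split; [apply Rmin_pos; apply cond_pos|].
  pose proof (Rmin_l d1 d2). pose proof (Rmin_r d1 d2).
  intros u v Hu Hv. eapply Rle_lt_trans; [apply Cmod_le_Rabs|].
  specialize (Hd1 u v ltac:(lra) ltac:(lra)). specialize (Hd2 u v ltac:(lra) ltac:(lra)).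
  unfold Re, Im in *. simpl in *. unfold Rminus in *. lra.
Qed.

Lemma Ccont2_mul F G : Ccont2 F -> Ccont2 G -> Ccont2 (fun x y => F x y * G x y)%C.
Proof.
  intros HF HG x y. destruct (HF x y), (HG x y). split; simpl.
  - apply (continuity_2d_pt_minus (fun u v => Re (F u v) * Re (G u v)) (fun u v => Im (F u v) * Im (G u v)));
    apply (continuity_2d_pt_mult (fun u v => _ (F u v)) (fun u v => _ (G u v))); auto.
  - apply (continuity_2d_pt_plus (fun u v => Re (F u v) * Im (G u v)) (fun u v => Im (F u v) * Re (G u v)));
    apply (continuity_2d_pt_mult (fun u v => _ (F u v)) (fun u v => _ (G u v))); auto.
Qed.

Lemma Ccont2_of1 f : Ccont f -> Ccont2 (fun x _ => f x).
Proof.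
  intros H. apply Ccont2_eps. intros x y e He.
  destruct (proj2 (Ccont_eps f) H x e He) as [d [Hd Hs]]. exists d; split; auto.
Qed.

Lemma Ccont2_of2 f : Ccont f -> Ccont2 (fun _ y => f y).
Proof.
  intros H. apply Ccont2_eps. intros x y e He.
  destruct (proj2 (Ccont_eps f) H y e He) as [d [Hd Hs]]. exists d; split; auto.
Qed.

(** * Functions of class C^k and their Taylor polynomials *)

(** Class C^k on an open interval, stated through explicit successive
    derivatives: this form is stable under the operations used below by
    induction on k. *)
Fixpoint class_C (k : nat) (lo hi : R) (p : R -> R) : Prop :=
  match k with
  | O => forall s, lo < s < hi -> continuity_pt p s
  | S k => exists p', (forall s, lo < s < hi -> is_derive p s (p' s)) /\ class_C k lo hi p'
  end.

Lemma is_derive_continuity_pt (p : R -> R) s l : is_derive p s l -> continuity_pt p s.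
Proof.
  intros H. apply continuity_pt_continuous. apply (ex_derive_continuous (V := R_NormedModule)).
  exists l; exact H.
Qed.

Lemma class_C_continuous k lo hi p : class_C k lo hi p -> forall s, lo < s < hi -> continuity_pt p s.
Proof.
  destruct k as [|k]; simpl; auto.
  intros [p' [H _]] s Hs. eapply is_derive_continuity_pt, H, Hs.
Qed.

Lemma class_C_weaken k : forall lo hi p, class_C (S k) lo hi p -> class_C k lo hi p.
Proof.
  induction k as [|k IH]; intros lo hi p [p' [H1 H2]].
  - intros s Hs. eapply is_derive_continuity_pt, H1, Hs.
  - exists p'; split; auto.
Qed.

Lemma locally_open_interval (lo hi s : R) : lo < s < hi -> locally s (fun u => lo < u < hi).
Proof.
  intros H. assert (Hd : 0 < Rmin (s - lo) (hi - s)) by (apply Rmin_pos; lra).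
  exists (mkposreal _ Hd). intros u Hu. simpl in Hu.
  unfold ball in Hu; simpl in Hu. unfold AbsRing_ball, abs, minus, plus, opp in Hu; simpl in Hu.
  pose proof (Rmin_l (s - lo) (hi - s)). pose proof (Rmin_r (s - lo) (hi - s)).
  apply Rabs_lt_between in Hu. lra.
Qed.

Lemma class_C_ext k : forall lo hi p q, (forall s, lo < s < hi -> p s = q s) ->
  class_C k lo hi p -> class_C k lo hi q.
Proof.
  destruct k as [|k]; intros lo hi p q He.
  - intros H s Hs. apply continuity_pt_continuous.
    apply (continuous_ext_loc _ p).
    + apply (filter_imp _ _ (fun u Hu => He u Hu) (locally_open_interval lo hi s Hs)).
    + apply continuity_pt_continuous; auto.
  - intros [p' [H1 H2]]. exists p'; split; auto. intros s Hs.
    apply (is_derive_ext_loc p); auto.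
    apply (filter_imp _ _ (fun u Hu => He u Hu) (locally_open_interval lo hi s Hs)).
Qed.

Lemma class_C_minus k : forall lo hi p q, class_C k lo hi p -> class_C k lo hi q ->
  class_C k lo hi (fun s => p s - q s).
Proof.
  induction k as [|k IH]; simpl; intros lo hi p q.
  - intros Hp Hq s Hs. apply (continuity_pt_minus p q); auto.
  - intros [p' [P1 P2]] [q' [Q1 Q2]]. exists (fun s => p' s - q' s); split; auto.
    intros s Hs. apply (is_derive_minus (V := R_NormedModule)); auto.
Qed.

Lemma class_C_scal k c : forall lo hi p, class_C k lo hi p -> class_C k lo hi (fun s => c * p s).
Proof.
  induction k as [|k IH]; simpl; intros lo hi p.
  - intros Hp s Hs. apply (continuity_pt_scal p c); auto.
  - intros [p' [P1 P2]]. exists (fun s => c * p' s); split; auto.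
    intros s Hs. apply (is_derive_scal p); auto.
Qed.

Lemma class_C_dil k c : forall lo hi lo' hi' p, (forall s, lo' < s < hi' -> lo < c * s < hi) ->
  class_C k lo hi p -> class_C k lo' hi' (fun s => p (c * s)).
Proof.
  induction k as [|k IH]; simpl; intros lo hi lo' hi' p Hi.
  - intros Hp s Hs. apply (continuity_pt_comp (fun s => c * s) p); auto.
    apply continuity_pt_continuous, (continuous_scal_r (V := R_NormedModule)), continuous_id.
  - intros [p' [P1 P2]]. exists (fun s => c * p' (c * s)); split.
    + intros s Hs. evar_last.
      * apply (is_derive_comp (V := R_NormedModule) p (fun s => c * s)).
        -- apply P1, Hi, Hs.
        -- apply is_derive_scal, is_derive_id.
      * unfold scal, one; simpl; unfold mult; simpl; ring.
    + apply (class_C_scal k c lo' hi' (fun s => p' (c * s))). apply (IH lo hi); auto.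
Qed.

Lemma class_C_div_id k : forall lo hi p, 0 <= lo -> class_C k lo hi p ->
  class_C k lo hi (fun s => p s / s).
Proof.
  induction k as [|k IH]; intros lo hi p Hlo.
  - intros Hp s Hs. apply (continuity_pt_div p (fun s => s)); [apply Hp, Hs| |lra].
    apply derivable_continuous_pt, derivable_pt_id.
  - intros Hp. pose proof (class_C_weaken k lo hi p Hp) as Hw. destruct Hp as [p' [P1 P2]].
    exists (fun s => p' s / s - p s / s / s); split.
    + intros s Hs. evar_last.
      * apply (is_derive_div p (fun s => s)); [apply P1, Hs|apply is_derive_id|lra].
      * unfold one; simpl. field. lra.
    + apply class_C_minus; auto. 
Qed.

Fixpoint rpeval (l : list R) (x : R) : R :=
  match l with nil => 0 | c :: l' => c + x * rpeval l' x end.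

(** Coefficients q such that x^(n+1) q(x) is a primitive of x^n l(x). *)
Fixpoint primitive_coeffs (l : list R) (n : nat) : list R :=
  match l with nil => nil | c :: l' => c / INR (S n) :: primitive_coeffs l' (S n) end.

Lemma primitive_coeffs_length l : forall n, length (primitive_coeffs l n) = length l.
Proof. induction l; simpl; auto. Qed.

Lemma primitive_coeffs_derive l : forall n x,
  is_derive (fun x => x ^ S n * rpeval (primitive_coeffs l n) x) x (x ^ n * rpeval l x).
Proof.
  induction l as [|c l IH]; intros n x.
  - apply (is_derive_ext (fun _ => 0)); [intros; simpl; ring|].
    evar_last; [apply (is_derive_const (V := R_NormedModule))|]. unfold zero; simpl; ring.
  - apply (is_derive_ext (fun x => c / INR (S n) * x ^ S n + x ^ S (S n) * rpeval (primitive_coeffs l (S n)) x)).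
    + intros t. cbn [rpeval primitive_coeffs]. simpl pow. unfold plus; simpl. ring.
    + evar_last.
      * apply (is_derive_plus (V := R_NormedModule)).
        -- apply is_derive_scal. apply is_derive_pow, is_derive_id.
        -- apply IH.
      * cbn [rpeval]. unfold plus, one, Nat.pred. simpl pow. cbn -[INR]. field. apply not_0_INR; lia.
Qed.

Lemma primitive_coeffs_derive0 l x : is_derive (fun x => x * rpeval (primitive_coeffs l 0) x) x (rpeval l x).
Proof.
  apply (is_derive_ext (fun x => x ^ 1 * rpeval (primitive_coeffs l 0) x)); [intros; simpl; ring|].
  evar_last; [apply primitive_coeffs_derive|simpl; ring].
Qed.

(** Here d is the k-th derivative of p divided by k!.  Both parts go by
    integration of the statement for the derivative p': a remainder o(h^k) of p'
    integrates to o(h^(k+1)), and a polynomial p' has polynomial primitives. *)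
Lemma Taylor_Peano k : forall lo hi p, lo < hi -> class_C k lo hi p -> exists d : R -> R,
  (forall s, lo < s < hi -> exists l, length l = k /\ forall e, 0 < e -> exists dl, 0 < dl /\
     forall h, Rabs h < dl -> Rabs (p (s + h) - (rpeval l h + d s * h ^ k)) <= e * Rabs h ^ k) /\
  ((forall s, lo < s < hi -> d s = 0) -> exists l, length l = k /\
     forall s, lo < s < hi -> p s = rpeval l s).
Proof.
  induction k as [|k IH]; intros lo hi p Hlh Hp.
  - exists p; split.
    + intros s Hs. exists nil; split; auto. intros e He.
      destruct (proj2 (continuity_pt_eps _ _) (Hp s Hs) e He) as [dl [Hd Hh]].
      exists dl; split; auto. intros h Hh'. simpl.
      replace (p (s + h) - (0 + p s * 1)) with (p (s + h) - p s) by ring.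
      rewrite Rmult_1_r. left. apply Hh. replace (s + h - s) with h by ring. auto.
    + intros H0. exists nil; split; auto.
  - destruct Hp as [p' [P1 P2]]. destruct (IH lo hi p' Hlh P2) as [d' [T Z]].
    exists (fun s => d' s / INR (S k)). assert (HS : INR (S k) <> 0) by (apply not_0_INR; lia).
    split.
    + intros s Hs. destruct (T s Hs) as [l [Hl Ht]].
      exists (p s :: primitive_coeffs l 0); split; [simpl; rewrite primitive_coeffs_length; auto|].
      intros e He. destruct (Ht e He) as [dl [Hd Hh]].
      destruct (locally_open_interval lo hi s Hs) as [dl2 Hd2].
      exists (Rmin dl dl2); split; [apply Rmin_pos; auto; apply cond_pos|].
      intros y Hy. pose proof (Rmin_l dl dl2). pose proof (Rmin_r dl dl2).
      set (phi := fun h => p (s + h) - (rpeval (p s :: primitive_coeffs l 0) h + d' s / INR (S k) * h ^ S k)).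
      set (dphi := fun h => p' (s + h) - (rpeval l h + d' s * h ^ k)).
      assert (B : Rabs (phi y - phi 0) <= (e * Rabs y ^ k) * Rabs (y - 0)).
      { apply (bounded_variation phi dphi). intros t Htt. rewrite !Rminus_0_r in Htt. split.
        - unfold phi, dphi. cbn [rpeval].
          apply (is_derive_minus (V := R_NormedModule)).
          + evar_last.
            * apply (is_derive_comp (V := R_NormedModule) p (fun h => s + h)).
              -- apply P1. apply Hd2. unfold ball; simpl.
                 unfold AbsRing_ball, abs, minus, plus, opp; simpl.
                 replace (s + t + - s) with t by ring. lra.
              -- apply (is_derive_plus (V := R_NormedModule));
                   [apply is_derive_const|apply is_derive_id].
            * unfold scal, plus, zero, one; simpl; unfold mult; simpl; ring.
          + apply (is_derive_ext (fun h => plus (plus (p s) (h * rpeval (primitive_coeffs l 0) h))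
                (d' s / INR (S k) * h ^ S k))); [intros; unfold plus; simpl; ring|].
            evar_last.
            * apply (is_derive_plus (V := R_NormedModule)).
              -- apply (is_derive_plus (V := R_NormedModule));
                [apply is_derive_const|apply primitive_coeffs_derive0].
              -- apply is_derive_scal, is_derive_pow, is_derive_id.
            * unfold plus, zero, one, Nat.pred. cbn -[INR]. field. auto.
        - eapply Rle_trans; [apply Hh; lra|].
          apply Rmult_le_compat_l; [lra|]. apply pow_incr. split; auto using Rabs_pos. }
      replace (phi 0) with 0 in B.
      * rewrite !Rminus_0_r in B. unfold phi in B. eapply Rle_trans; [apply B|].
        simpl; right; ring.
      * unfold phi. cbn [rpeval]. rewrite Rplus_0_r, pow_ne_zero by lia. ring.
    + intros H0. destruct Z as [l [Hl Hp']].
      { intros s Hs. specialize (H0 s Hs). simpl in H0.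
        apply Rmult_eq_reg_r with (/ INR (S k)); [|apply Rinv_neq_0_compat; auto].
        rewrite Rmult_0_l. exact H0. }
      set (phi := fun s => p s - s * rpeval (primitive_coeffs l 0) s).
      set (m := (lo + hi) / 2).
      exists (phi m :: primitive_coeffs l 0); split; [simpl; rewrite primitive_coeffs_length; auto|].
      assert (C : forall a b, lo < a -> b < hi -> a < b -> phi a = phi b).
      { intros a b Ha Hb Hab. apply (eq_is_derive (V := R_NormedModule)); auto. intros t Ht.
        evar_last.
        - apply (is_derive_minus (V := R_NormedModule)); [apply P1; lra|apply primitive_coeffs_derive0].
        - rewrite Hp' by lra. unfold minus, plus, opp, zero; simpl; ring. }
      intros s Hs. cbn [rpeval].
      assert (E : phi m = phi s).
      { destruct (Rtotal_order m s) as [Hms|[Hms|Hms]].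
        - apply C; unfold m in *; lra.
        - now rewrite Hms.
        - symmetry; apply C; unfold m in *; lra. }
      rewrite E. unfold phi. ring.
Qed.

(** * Divided differences *)

Definition Ctends (u : nat -> C) (l : C) : Prop :=
  forall e, 0 < e -> exists N, forall j, (N <= j)%nat -> Cmod (u j - l) < e.

Lemma Ctends_const c : Ctends (fun _ => c) c.
Proof.
  intros e He; exists O; intros. replace (c - c)%C with (RtoC 0) by ring. rewrite Cmod_0; lra.
Qed.

Lemma Ctends_sub u v a b : Ctends u a -> Ctends v b -> Ctends (fun j => u j - v j)%C (a - b)%C.
Proof.
  intros Hu Hv e He. destruct (Hu (e/2) ltac:(lra)) as [N1 H1].
  destruct (Hv (e/2) ltac:(lra)) as [N2 H2]. exists (max N1 N2). intros j Hj.
  replace (u j - v j - (a - b))%C with ((u j - a) + - (v j - b))%C by ring.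
  eapply Rle_lt_trans; [apply Cmod_triangle|]. rewrite Cmod_opp.
  specialize (H1 j ltac:(lia)). specialize (H2 j ltac:(lia)). lra.
Qed.

Lemma Ctends_mul_r u a c : Ctends u a -> Ctends (fun j => u j * c)%C (a * c)%C.
Proof.
  intros Hu e He. pose proof (Cmod_ge_0 c).
  destruct (Hu (e / (Cmod c + 1))) as [N HN]; [apply Rdiv_lt_0_compat; lra|].
  exists N; intros j Hj. specialize (HN j Hj).
  replace (u j * c - a * c)%C with ((u j - a) * c)%C by ring. rewrite Cmod_mult.
  apply Rle_lt_trans with (e / (Cmod c + 1) * Cmod c).
  - apply Rmult_le_compat_r; lra.
  - apply Rmult_lt_reg_r with (Cmod c + 1); [lra|].
    replace (e / (Cmod c + 1) * Cmod c * (Cmod c + 1)) with (e * Cmod c) by (field; lra). nra.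
Qed.

Lemma Ctends_unique u a b : Ctends u a -> Ctends u b -> a = b.
Proof.
  intros Ha Hb. apply Ceq_minus, Cmod_eq_0, Rle_antisym; [|apply Cmod_ge_0].
  apply le_epsilon. intros e He. destruct (Ha (e/2) ltac:(lra)) as [N1 H1].
  destruct (Hb (e/2) ltac:(lra)) as [N2 H2].
  specialize (H1 (max N1 N2) ltac:(lia)). specialize (H2 (max N1 N2) ltac:(lia)).
  replace (a - b)%C with (- (u (max N1 N2) - a) + (u (max N1 N2) - b))%C by ring.
  eapply Rle_trans; [apply Cmod_triangle|]. rewrite Cmod_opp. lra.
Qed.

(** Newton's divided difference of p at the points xs and s.  It depends on
    finitely many values of p only, hence is continuous for pointwise
    convergence, and its vanishing characterizes the polynomials of degree less
    than the number of points in xs. *)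
Fixpoint divdiff (xs : list R) (p : R -> C) (s : R) : C :=
  match xs with
  | nil => p s
  | x :: xs' => divdiff xs' (fun t => (p t - p x) * / RtoC (t - x))%C s
  end.

Lemma divdiff_lim xs : forall (pj : nat -> R -> C) p s, NoDup (s :: xs) ->
  (forall y, In y (s :: xs) -> Ctends (fun j => pj j y) (p y)) ->
  Ctends (fun j => divdiff xs (pj j) s) (divdiff xs p s).
Proof.
  induction xs as [|x xs IH]; intros pj p s Hn Hl.
  - apply Hl; simpl; auto.
  - simpl. apply (IH (fun j t => (pj j t - pj j x) * / RtoC (t - x))%C).
    + inversion_clear Hn as [|? ? H1 H2]. inversion_clear H2. constructor; auto.
      intro; apply H1; simpl; auto.
    + intros y Hy. apply Ctends_mul_r, Ctends_sub; apply Hl; simpl in *; tauto.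
Qed.

(** Horner division by y - x. *)
Lemma peval_quotient l x : exists l', length l' = pred (length l) /\
  forall y, (peval l y - peval l x = (y - x) * peval l' y)%C.
Proof.
  induction l as [|c l [l' [Hl H]]].
  - exists nil; split; auto. intros; simpl; ring.
  - destruct l as [|c2 l].
    + exists nil; split; auto. intros; simpl; ring.
    + exists (peval (c2 :: l) x :: l'); split; [simpl in *; lia|].
      intros y. cbn [peval] in H |- *.
      transitivity ((y - x) * (c2 + x * peval l x) + y * (c2 + y * peval l y - (c2 + x * peval l x)))%C;
        [ring|]. rewrite H. ring.
Qed.

Lemma RtoC_minus_nz (y x : R) : y <> x -> (RtoC y - RtoC x)%C <> 0%C.
Proof.
  intros H E. apply H. apply (f_equal Re) in E. unfold Re in E; simpl in E. lra.
Qed.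

Lemma divdiff_poly xs : forall l p s, NoDup (s :: xs) -> (length l <= length xs)%nat ->
  (forall y, In y (s :: xs) -> p y = peval l (RtoC y)) -> divdiff xs p s = 0%C.
Proof.
  induction xs as [|x xs IH]; intros l p s Hn Hl Hp.
  - destruct l; [|simpl in Hl; lia]. simpl. rewrite Hp; simpl; auto.
  - simpl. destruct (peval_quotient l (RtoC x)) as [l' [Hl' Hq]].
    apply (IH l').
    + inversion_clear Hn as [|? ? H1 H2]. inversion_clear H2. constructor; auto.
      intro; apply H1; simpl; auto.
    + simpl in Hl; lia.
    + intros y Hy. assert (Hyx : y <> x).
      { inversion_clear Hn as [|? ? H1 H2]. inversion_clear H2 as [|? ? H3 _].
        intros ->. destruct Hy as [->|Hy]; [apply H1; simpl; auto|auto]. }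
      rewrite (Hp y), (Hp x), Hq by (simpl in *; tauto).
      rewrite RtoC_minus. field. apply RtoC_minus_nz; auto.
Qed.

Lemma peval_newton l : forall a x, exists l', length l' = S (length l) /\
  forall y, (peval l' y = a + (y - x) * peval l y)%C.
Proof.
  induction l as [|c l IH]; intros a x.
  - exists (a :: nil); split; auto. intros; simpl; ring.
  - destruct (IH c x) as [l' [Hl H]]. exists ((a - x * c)%C :: l'); split; [simpl; lia|].
    intros y. cbn [peval]. rewrite H. ring.
Qed.

Lemma divdiff_zero xs : forall (D : R -> Prop) p, NoDup xs ->
  (forall s, D s -> ~ In s xs -> divdiff xs p s = 0%C) ->
  exists l, length l = length xs /\ forall s, D s \/ In s xs -> p s = peval l (RtoC s).
Proof.
  induction xs as [|x xs IH]; intros D p Hn Hd.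
  - exists nil; split; auto. intros s [Hs|[]]. apply Hd; auto.
  - inversion_clear Hn as [|? ? H1 H2].
    destruct (IH (fun s => D s /\ s <> x) (fun t => (p t - p x) * / RtoC (t - x))%C H2) as [l [Hl H]].
    { intros s [Hs Hsx] Hin. apply (Hd s Hs). intros [E|E]; auto. }
    destruct (peval_newton l (p x) (RtoC x)) as [l' [Hl' H']].
    exists l'; split; [simpl; lia|]. intros s Hs. rewrite H'.
    destruct (Req_dec s x) as [->|Hsx]; [ring|].
    rewrite <- H.
    + rewrite RtoC_minus. field. apply RtoC_minus_nz; auto.
    + destruct Hs as [Hs|[Hs|Hs]]; auto. congruence.
Qed.

(** Any n distinct points of the interval would do. *)
Definition nodes (lo hi : R) (n : nat) : list R :=
  map (fun i => lo + (hi - lo) / (INR i + 2)) (seq 0 n).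

Lemma nodes_length lo hi n : length (nodes lo hi n) = n.
Proof. unfold nodes. now rewrite length_map, length_seq. Qed.

Lemma nodes_in lo hi n x : lo < hi -> In x (nodes lo hi n) -> lo < x < hi.
Proof.
  intros H Hx. apply in_map_iff in Hx. destruct Hx as [i [<- _]].
  pose proof (pos_INR i).
  assert (0 < (hi - lo) / (INR i + 2)) by (apply Rdiv_lt_0_compat; lra).
  assert ((hi - lo) / (INR i + 2) < hi - lo); [|lra].
  apply Rmult_lt_reg_r with (INR i + 2); [lra|]. unfold Rdiv.
  rewrite Rmult_assoc, Rinv_l; nra.
Qed.

Lemma nodes_NoDup lo hi n : lo < hi -> NoDup (nodes lo hi n).
Proof.
  intros H. apply Injective_map_NoDup; [|apply seq_NoDup].
  intros i j E. pose proof (pos_INR i). pose proof (pos_INR j).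
  apply INR_eq. apply Rplus_eq_reg_l in E. unfold Rdiv in E.
  apply Rmult_eq_reg_l in E; [|lra].
  apply (f_equal Rinv) in E. rewrite !Rinv_inv in E. lra.
Qed.

(** * Profiles with vanishing off-centre averages: the smooth case *)

Definition Ccont_pos (p : R -> C) : Prop := forall s, 0 < s ->
  continuity_pt (fun s => Re (p s)) s /\ continuity_pt (fun s => Im (p s)) s.

(** With z = rho (zeta + k) on the circle of centre k rho and radius rho, [kern]
    is (z / rho)^(-n) and [msq] is |z / rho|^2. *)
Definition kern (n : nat) (k t : R) : C := (/ (expi t + RtoC k) ^ n)%C.
Definition msq (k t : R) : R := Cmod (expi t + RtoC k) ^ 2.

(** The function z |-> z^(-n) p(|z|^2) has vanishing average over the circles
    with centre k sqrt(s) and radius sqrt(s) inside lo < |z|^2 < hi. *)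
Definition null_profile (n : nat) (lo hi : R) (p : R -> C) : Prop :=
  Ccont_pos p /\ forall k s, 0 < k < 1 -> 0 < s -> lo < s * (1 - k) ^ 2 -> s * (1 + k) ^ 2 < hi ->
    Cavg (fun t => kern n k t * p (s * msq k t)%R)%C = 0%C.

Lemma shift_bounds k t : 0 < k < 1 -> 1 - k <= Cmod (expi t + RtoC k) <= 1 + k.
Proof.
  intros Hk. split.
  - pose proof (Cmod_sub_ge (expi t) (- RtoC k)) as H.
    replace (expi t - - RtoC k)%C with (expi t + RtoC k)%C in H by ring.
    rewrite Cmod_opp, Cmod_expi, Cmod_R, Rabs_pos_eq in H; lra.
  - eapply Rle_trans; [apply Cmod_triangle|]. rewrite Cmod_expi, Cmod_R, Rabs_pos_eq; lra.
Qed.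

Lemma shift_nz k t : 0 < k < 1 -> (expi t + RtoC k)%C <> 0%C.
Proof. intros Hk. apply Cmod_gt_0. pose proof (shift_bounds k t Hk). lra. Qed.

Lemma Ccont_shift k : Ccont (fun t => expi t + RtoC k)%C.
Proof. apply Ccont_add; [apply Ccont_expi|apply Ccont_const]. Qed.

Lemma Ccont_kern n k : 0 < k < 1 -> Ccont (kern n k).
Proof.
  intros Hk. apply Ccont_inv; [apply Ccont_pow, Ccont_shift|].
  intros t. apply Cpow_nz, shift_nz, Hk.
Qed.

Lemma cont_msq k t : continuity_pt (msq k) t.
Proof.
  unfold msq. simpl. pose proof (Ccont_Cmod _ (Ccont_shift k) t) as H.
  apply (continuity_pt_mult (fun t => Cmod (expi t + RtoC k)) (fun t => Cmod (expi t + RtoC k) * 1));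
    auto.
  apply (continuity_pt_mult (fun t => Cmod (expi t + RtoC k)) (fun _ => 1)); auto.
  apply continuity_pt_cst.
Qed.

Lemma msq_bounds k t : 0 < k < 1 -> (1 - k) ^ 2 <= msq k t <= (1 + k) ^ 2.
Proof.
  intros Hk. pose proof (shift_bounds k t Hk). unfold msq. split; apply pow_incr; lra.
Qed.

Lemma msq_pos k t : 0 < k < 1 -> 0 < msq k t.
Proof. intros Hk. pose proof (msq_bounds k t Hk). nra. Qed.

Lemma Ccont_pos_comp p (phi : R -> R) : Ccont_pos p -> (forall t, continuity_pt phi t) ->
  (forall t, 0 < phi t) -> Ccont (fun t => p (phi t)).
Proof.
  intros Hp Hc H0 t. destruct (Hp (phi t) (H0 t)). split.
  - apply (continuity_pt_comp phi (fun s => Re (p s))); auto.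
  - apply (continuity_pt_comp phi (fun s => Im (p s))); auto.
Qed.

Lemma Ccont_msq k : Ccont (fun t => RtoC (msq k t - 1)).
Proof.
  apply Ccont_RtoC. intros t. apply (continuity_pt_minus (msq k) (fun _ => 1)).
  - apply cont_msq.
  - apply continuity_pt_cst.
Qed.

Lemma msq_conj k t : RtoC (msq k t - 1) = (RtoC k * expi t + RtoC k * Cconj (expi t) + RtoC k ^ 2)%C.
Proof.
  rewrite RtoC_minus. unfold msq. rewrite RtoC_pow, <- RtoC_pow, Cmod2_conj, Cplus_conj.
  replace (Cconj (RtoC k)) with (RtoC k) by (unfold Cconj, RtoC; simpl; f_equal; ring).
  transitivity (expi t * Cconj (expi t) + RtoC k * expi t + RtoC k * Cconj (expi t) + RtoC k ^ 2 - 1)%C;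
    [ring|]. rewrite expi_conj_r. ring.
Qed.

(** The holomorphic extension to the disc, in the variable x = conj zeta, of
    [kern] times the m-th power of [msq] - 1: the factor x^n of the kernel
    absorbs the poles as long as m <= n. *)
Definition moment_fun (n m : nat) (k : R) (x : C) : C :=
  (x ^ (n - m) * (/ (1 + RtoC k * x)) ^ n * (RtoC k + RtoC k * (x * x) + RtoC k ^ 2 * x) ^ m)%C.

Lemma moment_fun_diskalg n m k : 0 < k < 1 -> diskalg (moment_fun n m k).
Proof.
  intros Hk. unfold moment_fun. apply diskalg_mul; [apply diskalg_mul|].
  - apply diskalg_pow, diskalg_id.
  - apply (diskalg_pow (fun x => / (1 + RtoC k * x))%C). apply diskalg_inv_lin.
    rewrite Cmod_R, Cmod_1, Rabs_pos_eq; lra.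
  - apply (diskalg_pow (fun x => RtoC k + RtoC k * (x * x) + RtoC k ^ 2 * x)%C).
    apply diskalg_add; [apply diskalg_add|]; auto using diskalg_const, diskalg_mul, diskalg_id.
Qed.

Lemma moment_fun_eq n m k t : 0 < k < 1 -> (m <= n)%nat ->
  (kern n k t * RtoC (msq k t - 1) ^ m)%C = moment_fun n m k (Cconj (expi t)).
Proof.
  intros Hk Hm. unfold kern, moment_fun. set (z := expi t). set (x := Cconj z).
  assert (Hzx : (z * x)%C = 1%C) by apply expi_conj_r.
  assert (Hb : (z + RtoC k)%C <> 0%C) by apply shift_nz, Hk.
  assert (Hx : x <> 0%C).
  { intro E. rewrite E, Cmult_0_r in Hzx. symmetry in Hzx. revert Hzx. apply C1_nz. }
  assert (E1 : (1 + RtoC k * x)%C = (x * (z + RtoC k))%C).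
  { transitivity (z * x + RtoC k * x)%C; [now rewrite Hzx|ring]. }
  assert (E2 : (RtoC k + RtoC k * (x * x) + RtoC k ^ 2 * x)%C = (x * RtoC (msq k t - 1))%C).
  { rewrite msq_conj. fold z. fold x.
    transitivity (RtoC k * (z * x) + RtoC k * (x * x) + RtoC k ^ 2 * x)%C; [rewrite Hzx; ring|ring]. }
  rewrite E1, E2, Cpow_inv by (apply Cmult_neq_0; auto).
  rewrite !Cpow_mult_l.
  replace n with ((n - m) + m)%nat at 3 by lia. rewrite Cpow_add_r.
  field. repeat split; apply Cpow_nz; auto.
Qed.

(** The mean of a function of conj zeta in the disc algebra is its value at 0. *)
Lemma kern_moment n m k : 0 < k < 1 -> (m <= n)%nat ->
  Cavg (fun t => kern n k t * RtoC (msq k t - 1) ^ m)%C = if Nat.eqb m n then (RtoC k ^ n)%C else 0%C.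
Proof.
  intros Hk Hm.
  rewrite (Cavg_ext _ (fun t => moment_fun n m k (Cconj (expi t))))
    by (intros; apply moment_fun_eq; auto).
  rewrite diskalg_mean_conj.
  - unfold moment_fun. destruct (Nat.eqb_spec m n) as [->|Hn].
    + rewrite Nat.sub_diag. rewrite !Cmult_0_r, !Cplus_0_r. 
      replace (/ 1)%C with (RtoC 1) by (field; apply C1_nz). rewrite Cpow_1_l. simpl. ring.
    + destruct (n - m)%nat eqn:E; [lia|]. simpl. ring.
  - apply moment_fun_diskalg, Hk.
  - apply (Ccont_ext (fun t => moment_fun n m k (Cconj (expi (- t))))).
    + intros; rewrite expi_neg, Cconj_conj; reflexivity.
    + apply (Ccont_ext (fun t => kern n k (- t) * RtoC (msq k (- t) - 1) ^ m)%C).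
      * intros. apply moment_fun_eq; auto.
      * apply (Ccont_comp (fun t => kern n k t * RtoC (msq k t - 1) ^ m)%C Ropp).
        -- apply Ccont_mul; [apply Ccont_kern, Hk|apply Ccont_pow, Ccont_msq].
        -- apply continuity_pt_Ropp.
Qed.

Lemma kern_moment_list n k s l : 0 < k < 1 -> forall j, (j + length l <= n)%nat ->
  Cavg (fun t => kern n k t * (RtoC (msq k t - 1) ^ j * peval l (RtoC s * RtoC (msq k t - 1))))%C = 0%C.
Proof.
  intros Hk. induction l as [|c l IH]; intros j Hj.
  - rewrite (Cavg_ext _ (fun _ => 0%C)) by (intros; simpl; ring). apply Cavg_const.
  - simpl in Hj.
    rewrite (Cavg_ext _ (fun t => c * (kern n k t * RtoC (msq k t - 1) ^ j) +
      RtoC s * (kern n k t * (RtoC (msq k t - 1) ^ S j * peval l (RtoC s * RtoC (msq k t - 1)))))%C)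
      by (intros; simpl; ring).
    assert (H1 : Ccont (fun t => kern n k t * RtoC (msq k t - 1) ^ j)%C)
      by (apply Ccont_mul; [apply Ccont_kern, Hk|apply Ccont_pow, Ccont_msq]).
    assert (H2 : Ccont (fun t => kern n k t * (RtoC (msq k t - 1) ^ S j * peval l (RtoC s * RtoC (msq k t - 1))))%C).
    { apply Ccont_mul; [apply Ccont_kern, Hk|]. apply Ccont_mul; [apply Ccont_pow, Ccont_msq|].
      apply (Ccont_peval l (fun t => RtoC s * RtoC (msq k t - 1))%C).
      apply Ccont_mul; [apply Ccont_const|apply Ccont_msq]. }
    rewrite Cavg_add; [|apply Ccont_mul; auto using Ccont_const..].
    rewrite !Cavg_scal by auto. rewrite IH by lia. rewrite kern_moment by (auto; lia).
    destruct (Nat.eqb_spec j n); [lia|]. ring.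
Qed.

Lemma peval_combine l1 : forall l2 h, length l1 = length l2 ->
  peval (combine l1 l2) (RtoC h) = (rpeval l1 h, rpeval l2 h).
Proof.
  induction l1 as [|c l1 IH]; intros [|c2 l2] h Hl; simpl in *; try lia; auto.
  rewrite IH by lia. unfold Cplus, Cmult, RtoC; simpl. f_equal; ring.
Qed.

Lemma kern_bound n k t : 0 < k <= 1 / 2 -> Cmod (kern n k t) <= 2 ^ n.
Proof.
  intros Hk. pose proof (shift_bounds k t ltac:(lra)) as [H _]. unfold kern.
  rewrite Cmod_inv by (apply Cpow_nz, shift_nz; lra). rewrite Cmod_pow.
  rewrite <- pow_inv. apply pow_incr. split.
  - left; apply Rinv_0_lt_compat; lra.
  - rewrite <- (Rinv_inv 2). apply Rinv_le_contravar; lra.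
Qed.

(** The radius k is so small that the circle stays inside the annulus and that
    s times ([msq] - 1), at most 3 k s in modulus, stays below dl. *)
Lemma small_radius lo hi s dl : 0 < s -> lo < s < hi -> 0 < dl -> exists k, 0 < k <= 1 / 2 /\
  3 * k * s < dl /\ lo < s * (1 - k) ^ 2 /\ s * (1 + k) ^ 2 < hi.
Proof.
  intros Hs Hi Hd. set (m := Rmin dl (Rmin (s - lo) (hi - s))).
  assert (Hm : 0 < m) by (repeat apply Rmin_pos; lra).
  assert (m <= dl) by apply Rmin_l.
  assert (m <= Rmin (s - lo) (hi - s)) by apply Rmin_r.
  pose proof (Rmin_l (s - lo) (hi - s)). pose proof (Rmin_r (s - lo) (hi - s)).
  set (k := Rmin (1 / 2) (m / (4 * s))).
  assert (k <= 1 / 2) by apply Rmin_l.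
  assert (0 < k) by (apply Rmin_pos; [lra|apply Rdiv_lt_0_compat; lra]).
  assert (k * (4 * s) <= m).
  { apply Rle_trans with (m / (4 * s) * (4 * s)).
    - apply Rmult_le_compat_r; [lra|apply Rmin_r].
    - right; field; lra. }
  exists k. repeat split; try lra; try nra.
Qed.

(** Insert the Taylor expansion of order n of p at s into the average for a
    small k: the terms of degree below n average to zero, that of degree n gives
    d s^n k^n, and the remainder is at most 2 e (3 k s)^n times the bound 2^n of
    the kernel.  Since e is arbitrary, d = 0, which makes p polynomial. *)
Lemma null_profile_smooth n lo hi p : 0 <= lo < hi -> null_profile n lo hi p ->
  class_C n lo hi (fun s => Re (p s)) -> class_C n lo hi (fun s => Im (p s)) ->
  exists l, length l = n /\ forall s, lo < s < hi -> p s = peval l (RtoC s).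
Proof.
  intros Hlh [Hc Hsol] H1 H2.
  destruct (Taylor_Peano n lo hi _ ltac:(lra) H1) as [d1 [T1 Z1]].
  destruct (Taylor_Peano n lo hi _ ltac:(lra) H2) as [d2 [T2 Z2]].
  assert (Hd : forall s, lo < s < hi -> (d1 s, d2 s) = RtoC 0).
  { intros s Hs. set (d := (d1 s, d2 s) : C).
    destruct (T1 s Hs) as [l1 [L1 E1]]. destruct (T2 s Hs) as [l2 [L2 E2]].
    set (L := combine l1 l2). assert (HL : length L = n) by (unfold L; rewrite length_combine; lia).
    assert (Hpos : 0 < 2 * 6 ^ n) by (pose proof (pow_lt 6 n); lra).
    assert (Hb : forall e, 0 < e -> Cmod d <= 2 * 6 ^ n * e).
    { intros e He. destruct (E1 e He) as [dl1 [D1 B1]]. destruct (E2 e He) as [dl2 [D2 B2]].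
      destruct (small_radius lo hi s (Rmin dl1 dl2)) as [k [Hk [Hk1 [Hk2 Hk3]]]];
        [lra|lra|apply Rmin_pos; auto|].
      pose proof (Rmin_l dl1 dl2). pose proof (Rmin_r dl1 dl2).
      assert (Hk' : 0 < k < 1) by lra.
      assert (S0 := Hsol k s Hk' ltac:(lra) Hk2 Hk3).
      set (x := fun t => RtoC (msq k t - 1)).
      (* The Taylor polynomial of order n, as a function on the circle. *)
      set (main := fun t => (kern n k t * (x t ^ 0 * peval L (RtoC s * x t)) +
             d * RtoC s ^ n * (kern n k t * x t ^ n))%C).
      assert (C1 : Ccont (fun t => kern n k t * (x t ^ 0 * peval L (RtoC s * x t)))%C).
      { apply Ccont_mul; [apply Ccont_kern, Hk'|]. apply Ccont_mul; [apply (Ccont_pow x), Ccont_msq|].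
        apply (Ccont_peval L (fun t => RtoC s * x t)%C), Ccont_mul;
          [apply Ccont_const|apply Ccont_msq]. }
      assert (C2 : Ccont (fun t => kern n k t * x t ^ n)%C)
        by (apply Ccont_mul; [apply Ccont_kern, Hk'|apply Ccont_pow, Ccont_msq]).
      assert (C3 : Ccont (fun t => d * RtoC s ^ n * (kern n k t * x t ^ n))%C)
        by (apply (Ccont_mul (fun _ => (d * RtoC s ^ n)%C)); auto using Ccont_const).
      assert (Cm : Ccont main) by (apply Ccont_add; auto).
      assert (Am : Cavg main = (d * RtoC s ^ n * RtoC k ^ n)%C).
      { unfold main. rewrite Cavg_add, Cavg_scal by auto. unfold x.
        rewrite (kern_moment_list n k s L Hk' 0) by exact (Nat.eq_le_incl _ _ HL).
          rewrite (kern_moment n n k Hk') by lia.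
        rewrite Nat.eqb_refl. ring. }
      assert (Cp : Ccont (fun t => kern n k t * p (s * msq k t)%R)%C).
      { apply Ccont_mul; [apply Ccont_kern, Hk'|]. apply (Ccont_pos_comp p (fun t => s * msq k t)); auto.
        - intros t. apply (continuity_pt_scal (msq k) s), cont_msq.
        - intros t. apply Rmult_lt_0_compat; [lra|apply msq_pos, Hk']. }
      assert (Hr : Cmod (Cavg (fun t => kern n k t * p (s * msq k t)%R - main t)%C)
                   <= 2 ^ n * (2 * e * (3 * k * s) ^ n)).
      { apply Cavg_norm_const; [apply Ccont_sub; auto|]. intros t.
        set (h := s * (msq k t - 1)).
        assert (Hh : Rabs h <= 3 * k * s).
        { unfold h. rewrite Rabs_mult, Rabs_pos_eq by lra.
          pose proof (msq_bounds k t Hk').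
          assert (Rabs (msq k t - 1) <= 3 * k) by (apply Rabs_le; nra). nra. }
        replace (kern n k t * p (s * msq k t)%R - main t)%C with
          (kern n k t * (p (s + h)%R - (peval L (RtoC h) + d * RtoC h ^ n)))%C.
        2:{ unfold main, x. replace (s + h) with (s * msq k t) by (unfold h; ring).
            replace (RtoC h) with (RtoC s * RtoC (msq k t - 1))%C
              by (unfold h; now rewrite RtoC_mult).
            rewrite Cpow_mult_l. cbn [Cpow]. ring. }
        rewrite Cmod_mult. apply Rmult_le_compat; auto using Cmod_ge_0, kern_bound.
        unfold L. rewrite peval_combine by lia. eapply Rle_trans; [apply Cmod_le_Rabs|].
        specialize (B1 h ltac:(lra)). specialize (B2 h ltac:(lra)).
        assert (Rabs h ^ n <= (3 * k * s) ^ n) by (apply pow_incr; split; auto using Rabs_pos).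
        rewrite <- RtoC_pow.
        assert (R1 : Re (p (s + h)%R - ((rpeval l1 h, rpeval l2 h) + d * RtoC (h ^ n)))%C =
            Re (p (s + h)) - (rpeval l1 h + d1 s * h ^ n)).
        { unfold d, Re, Cminus, Cplus, Copp, Cmult, RtoC. cbn [fst snd]. ring. }
        assert (R2 : Im (p (s + h)%R - ((rpeval l1 h, rpeval l2 h) + d * RtoC (h ^ n)))%C =
            Im (p (s + h)) - (rpeval l2 h + d2 s * h ^ n)).
        { unfold d, Im, Cminus, Cplus, Copp, Cmult, RtoC. cbn [fst snd]. ring. }
        rewrite R1, R2.
        assert (e * Rabs h ^ n <= e * (3 * k * s) ^ n) by (apply Rmult_le_compat_l; lra).
        lra. }
      rewrite Cavg_sub, S0, Am in Hr by auto.
      replace (0 - d * RtoC s ^ n * RtoC k ^ n)%C with (- (d * RtoC ((s * k) ^ n)))%C in Hr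
        by (rewrite RtoC_pow, RtoC_mult, Cpow_mult_l; ring).
      assert (Hsk : 0 < (s * k) ^ n) by (apply pow_lt, Rmult_lt_0_compat; lra).
      rewrite Cmod_opp, Cmod_mult, Cmod_R, Rabs_pos_eq in Hr by lra.
      apply Rmult_le_reg_r with ((s * k) ^ n); auto.
      replace (2 * 6 ^ n * e * (s * k) ^ n) with (2 ^ n * (2 * e * (3 * k * s) ^ n)); auto.
      replace (3 * k * s) with (3 * (s * k)) by ring. replace 6 with (2 * 3) by ring.
      rewrite !Rpow_mult_distr. ring. }
    apply Cmod_eq_0, Rle_antisym; [|apply Cmod_ge_0]. apply le_epsilon. intros e He.
    rewrite Rplus_0_l. specialize (Hb (e / (2 * 6 ^ n)) ltac:(apply Rdiv_lt_0_compat; lra)).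
    replace (2 * 6 ^ n * (e / (2 * 6 ^ n))) with e in Hb by (field; apply pow_nonzero; lra). exact Hb. }
  destruct Z1 as [l1 [L1 E1]]; [intros s Hs; apply (f_equal Re (Hd s Hs))|].
  destruct Z2 as [l2 [L2 E2]]; [intros s Hs; apply (f_equal Im (Hd s Hs))|].
  exists (combine l1 l2). split; [etransitivity; [exact (length_combine l1 l2)|lia]|].
  intros s Hs. rewrite peval_combine by lia. rewrite <- E1, <- E2 by auto.
  now destruct (p s).
Qed.

(** * Profiles with vanishing off-centre averages: smoothing by dilations *)

(** The mean of v |-> q (v s) over [1, 1 + h].  Dilations rather than
    translations, because they preserve the condition [null_profile]. *)
Definition dilation_meanR (h : R) (q : R -> R) (s : R) : R := / h * RInt (fun v => q (v * s)) 1 (1 + h).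
Definition dilation_mean (h : R) (p : R -> C) (s : R) : C :=
  (RtoC (/ h) * Cint (fun v => p (v * s)%R) 1 (1 + h))%C.

Lemma dilation_mean_re h p s : Re (dilation_mean h p s) = dilation_meanR h (fun s => Re (p s)) s.
Proof. unfold dilation_mean, dilation_meanR, Cint, Cmult, RtoC, Re; simpl. ring. Qed.
Lemma dilation_mean_im h p s : Im (dilation_mean h p s) = dilation_meanR h (fun s => Im (p s)) s.
Proof. unfold dilation_mean, dilation_meanR, Cint, Cmult, RtoC, Im; simpl. ring. Qed.

Section Dilation.
Variable q : R -> R.
Hypothesis Hq : forall s, 0 < s -> continuity_pt q s.
Let Q (s : R) : R := RInt q 1 s.

Lemma ex_RInt_pos a b : 0 < a -> 0 < b -> ex_RInt q a b.
Proof.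
  intros Ha Hb. apply (ex_RInt_continuous (V := R_CompleteNormedModule)). intros z [Hz _].
  apply continuity_pt_continuous, Hq. eapply Rlt_le_trans; [|exact Hz]. now apply Rmin_pos.
Qed.

Lemma antiderivative_derive s : 0 < s -> is_derive Q s (q s).
Proof.
  intros Hs. apply (is_derive_RInt (V := R_NormedModule) q Q 1).
  - apply (filter_imp (fun u => 0 < u < s + 1) _).
    + intros u Hu. apply (RInt_correct (V := R_CompleteNormedModule)). apply ex_RInt_pos; lra.
    + apply (locally_open_interval 0 (s + 1)); lra.
  - apply continuity_pt_continuous, Hq, Hs.
Qed.

(** The primitive Q makes the gain of one derivative visible. *)
Lemma dilation_meanR_eq h s : 0 < h -> 0 < s ->
  dilation_meanR h q s = / h * ((Q ((1 + h) * s) - Q (1 * s)) / s).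
Proof.
  intros Hh Hs. unfold dilation_meanR. f_equal.
  assert (E : s * RInt (fun v => q (v * s)) 1 (1 + h) = Q ((1 + h) * s) - Q (1 * s)).
  { assert (H1 : 0 < (1 + h) * s) by (apply Rmult_lt_0_compat; lra).
    transitivity (RInt (fun v => scal s (q (s * v + 0))) 1 (1 + h)).
    - symmetry. rewrite <- (RInt_scal (V := R_CompleteNormedModule)).
      + apply RInt_ext. intros v _. do 2 f_equal. ring.
      + apply (ex_RInt_continuous (V := R_CompleteNormedModule)). intros z Hz.
        rewrite Rmin_left, Rmax_right in Hz by lra.
        apply continuity_pt_continuous. apply (continuity_pt_comp (fun v => v * s) q).
        * apply continuity_pt_continuous, (continuous_scal_l (V := R_NormedModule)), continuous_id.
        * apply Hq, Rmult_lt_0_compat; lra.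
    - rewrite (RInt_comp_lin (V := R_CompleteNormedModule)).
      + replace (s * 1 + 0) with (1 * s) by ring. replace (s * (1 + h) + 0) with ((1 + h) * s) by ring.
        unfold Q. rewrite <- (RInt_Chasles q 1 (1 * s) ((1 + h) * s)).
        * unfold plus; simpl. symmetry. apply Rplus_minus_l.
        * apply ex_RInt_pos; lra.
        * apply ex_RInt_pos; lra.
      + apply ex_RInt_pos; nra. }
  rewrite <- E. unfold Rdiv. rewrite Rmult_comm, <- Rmult_assoc, Rinv_l, Rmult_1_l by lra. reflexivity.
Qed.

Lemma dilation_meanR_class_C k lo hi h : 0 <= lo -> 0 < h -> class_C k lo hi q ->
  class_C (S k) lo (hi / (1 + h)) (dilation_meanR h q).
Proof.
  intros Hlo Hh Hk.
  assert (HQ : class_C (S k) lo hi Q).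
  { exists q; split; auto. intros s Hs. apply antiderivative_derive; lra. }
  apply (class_C_ext (S k) _ _ (fun s => / h * ((Q ((1 + h) * s) - Q (1 * s)) / s))).
  { intros s Hs. symmetry. apply dilation_meanR_eq; lra. }
  assert (Hi : forall s, lo < s < hi / (1 + h) -> lo < s /\ s * (1 + h) < hi).
  { intros s [Hs1 Hs2]. split; auto. apply Rmult_lt_compat_r with (r := 1 + h) in Hs2; [|lra].
    replace (hi / (1 + h) * (1 + h)) with hi in Hs2 by (field; lra). auto. }
  apply class_C_scal, (class_C_div_id (S k)); auto.
  apply (class_C_minus (S k) _ _ (fun s => Q ((1 + h) * s)) (fun s => Q (1 * s))).
  - apply (class_C_dil (S k) (1 + h) lo hi); auto. intros s Hs. destruct (Hi s Hs). split; nra.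
  - apply (class_C_dil (S k) 1 lo hi); auto. intros s Hs. destruct (Hi s Hs). split; nra.
Qed.

Lemma dilation_meanR_cont h s : 0 < h -> 0 < s -> continuity_pt (dilation_meanR h q) s.
Proof.
  intros Hh Hs. apply (class_C_continuous 1 0 ((2 * s * (1 + h)) / (1 + h))).
  - apply dilation_meanR_class_C; [lra|auto|]. intros u Hu. apply Hq; lra.
  - split; auto. replace (2 * s * (1 + h) / (1 + h)) with (2 * s) by (field; lra). lra.
Qed.

(** By [dilation_meanR_eq] the mean is a difference quotient of Q at s. *)
Lemma dilation_meanR_lim s e : 0 < s -> 0 < e -> exists d, 0 < d /\
  forall h, 0 < h < d -> Rabs (dilation_meanR h q s - q s) < e.
Proof.
  intros Hs He. pose proof (proj1 (is_derive_Reals _ _ _) (antiderivative_derive s Hs)) as HD.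
  destruct (HD e He) as [d Hd]. exists (d / s). split; [apply Rdiv_lt_0_compat; auto; apply cond_pos|].
  intros h [Hh1 Hh2].
  assert (Hhs : h * s < d).
  { apply Rmult_lt_compat_r with (r := s) in Hh2; auto.
    replace (d / s * s) with (d : R) in Hh2 by (field; lra). auto. }
  assert (0 < h * s) by (apply Rmult_lt_0_compat; auto).
  specialize (Hd (h * s) ltac:(lra) ltac:(rewrite Rabs_pos_eq; lra)).
  rewrite dilation_meanR_eq by auto.
  replace (/ h * ((Q ((1 + h) * s) - Q (1 * s)) / s)) with ((Q (s + h * s) - Q s) / (h * s)); auto.
  replace ((1 + h) * s) with (s + h * s) by ring. rewrite Rmult_1_l. field. lra.
Qed.
End Dilation.

Lemma Cint_scal c f a b : Ccont f -> Cint (fun t => c * f t)%C a b = (c * Cint f a b)%C.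
Proof.
  intros Hf.
  assert (E1 := ex_RInt_cont _ a b (Ccont_re f Hf)).
  assert (E2 := ex_RInt_cont _ a b (Ccont_im f Hf)).
  assert (Hl : forall x y, RInt (fun t => x * Re (f t) + y * Im (f t)) a b =
     x * RInt (fun t => Re (f t)) a b + y * RInt (fun t => Im (f t)) a b).
  { intros x y. rewrite (RInt_plus (V := R_CompleteNormedModule)).
    - rewrite (RInt_scal (V := R_CompleteNormedModule) (fun t => Re (f t))), (RInt_scal (V :=
      R_CompleteNormedModule) (fun t => Im (f t))) by auto. reflexivity.
    - apply (ex_RInt_scal (V := R_CompleteNormedModule) (fun t => Re (f t))); auto.
    - apply (ex_RInt_scal (V := R_CompleteNormedModule) (fun t => Im (f t))); auto. }
  unfold Cint, Cmult; simpl. f_equal.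
  - unfold Rminus. rewrite Ropp_mult_distr_l, <- Hl. apply RInt_ext. intros. unfold Re, Im; simpl. ring.
  - rewrite Rplus_comm, <- Hl. apply RInt_ext. intros. unfold Re, Im; simpl. ring.
Qed.

Lemma continuity_2d_comp_pos p (phi : R -> R -> R) : Ccont_pos p ->
  (forall x y, continuity_2d_pt phi x y) -> (forall x y, 0 < phi x y) -> Ccont2 (fun x y => p (phi x y)).
Proof.
  intros Hp Hc H0 x y. destruct (Hp _ (H0 x y)). split.
  - apply (continuity_1d_2d_pt_comp (fun s => Re (p s)) phi); auto.
  - apply (continuity_1d_2d_pt_comp (fun s => Im (p s)) phi); auto.
Qed.

Lemma continuity_Rmax_l c x : continuity_pt (fun v => Rmax v c) x.
Proof.
  apply continuity_pt_eps. intros e He. exists e; split; auto. intros s Hs.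
  eapply Rle_lt_trans; [|exact Hs]. unfold Rmax, Rabs.
  repeat destruct Rle_dec; repeat destruct Rcase_abs; lra.
Qed.

(** Exchange the mean over v with the mean over the circle; for each v the
    circle dilated by v is again admissible. *)
Lemma null_profile_dilation_mean n lo hi p h : 0 < h -> null_profile n lo hi p ->
  null_profile n lo (hi / (1 + h)) (dilation_mean h p).
Proof.
  intros Hh [Hc Hs]. split.
  - intros s Hs0. split.
    + apply (continuity_pt_ext (dilation_meanR h (fun s => Re (p s)))); [intros;
      now rewrite dilation_mean_re|].
      apply dilation_meanR_cont; auto. apply Hc.
    + apply (continuity_pt_ext (dilation_meanR h (fun s => Im (p s)))); [intros;
      now rewrite dilation_mean_im|].
      apply dilation_meanR_cont; auto. apply Hc.
  - intros k s Hk Hs0 H1 H2.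
    (* The value of p is needed for v >= 1 only; Rmax keeps the argument positive. *)
    set (F := fun v t => (kern n k t * p (Rmax v 1 * (s * msq k t))%R)%C).
    assert (Hpc : Ccont2 (fun v t => p (Rmax v 1 * (s * msq k t)))).
    { apply (continuity_2d_comp_pos p (fun v t => Rmax v 1 * (s * msq k t))); auto.
      - intros x y. apply (continuity_2d_pt_mult (fun v _ => Rmax v 1) (fun _ t => s * msq k t)).
        + apply (continuity_1d_2d_pt_comp (fun v => Rmax v 1) (fun v _ => v));
            [apply continuity_Rmax_l|apply continuity_2d_pt_id1].
        + apply (continuity_1d_2d_pt_comp (fun t => s * msq k t) (fun _ t => t));
            [apply (continuity_pt_scal (msq k) s), cont_msq|apply continuity_2d_pt_id2].
      - intros x y. pose proof (Rmax_r x 1). pose proof (msq_pos k y Hk).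
        apply Rmult_lt_0_compat; [lra|]. apply Rmult_lt_0_compat; lra. }
    assert (HF : Ccont2 F).
    { apply Ccont2_mul; auto. apply (Ccont2_of2 (kern n k)), Ccont_kern, Hk. }
    assert (E : forall t, (kern n k t * dilation_mean h p (s * msq k t)%R)%C =
               (RtoC (/ h) * Cint (fun v => F v t) 1 (1 + h))%C).
    { intros t. unfold dilation_mean, F.
      rewrite (Cint_scal (kern n k t) (fun v => p (Rmax v 1 * (s * msq k t))%R))
        by (apply (Ccont2_slice1 (fun v t => p (Rmax v 1 * (s * msq k t)))); auto).
      replace (Cint (fun v => p (Rmax v 1 * (s * msq k t))%R) 1 (1 + h)) with
        (Cint (fun v => p (v * (s * msq k t))%R) 1 (1 + h)).
      - ring.
      - unfold Cint; f_equal; apply RInt_ext; intros v Hv;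
          rewrite Rmin_left, Rmax_right in Hv by lra; rewrite (Rmax_left v 1) by lra; reflexivity. }
    rewrite (Cavg_ext _ _ E), Cavg_scal by (apply Ccont_Cint; auto; lra).
    rewrite Cavg_Cint_0; auto; [ring|lra|].
    intros v Hv. unfold F. rewrite (Rmax_left v 1) by lra.
    rewrite (Cavg_ext _ (fun t => kern n k t * p ((v * s) * msq k t)%R)%C)
      by (intros; do 2 f_equal; ring).
    apply Hs; auto.
    + nra.
    + assert (0 <= s * (1 - k) ^ 2) by (apply Rmult_le_pos; [lra|apply pow2_ge_0]).
      rewrite Rmult_assoc. nra.
    + apply Rmult_lt_compat_r with (r := 1 + h) in H2; [|lra].
      replace (hi / (1 + h) * (1 + h)) with hi in H2 by (field; lra).
      assert (0 <= s * (1 + k) ^ 2) by (apply Rmult_le_pos; [lra|apply pow2_ge_0]).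
      rewrite Rmult_assoc. nra.
Qed.

Lemma dilation_mean_lim p s : Ccont_pos p -> 0 < s -> forall e, 0 < e -> exists d, 0 < d /\
  forall h, 0 < h < d -> Cmod (dilation_mean h p s - p s) < e.
Proof.
  intros Hp Hs e He.
  destruct (dilation_meanR_lim (fun s => Re (p s)) (fun s Hs => proj1 (Hp s Hs)) s (e / 2) Hs ltac:(lra)) as [d1 [D1 B1]].
  destruct (dilation_meanR_lim (fun s => Im (p s)) (fun s Hs => proj2 (Hp s Hs)) s (e / 2) Hs ltac:(lra)) as [d2 [D2 B2]].
  exists (Rmin d1 d2); split; [apply Rmin_pos; auto|]. intros h Hh.
  pose proof (Rmin_l d1 d2). pose proof (Rmin_r d1 d2).
  specialize (B1 h ltac:(lra)). specialize (B2 h ltac:(lra)).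
  eapply Rle_lt_trans; [apply Cmod_le_Rabs|].
  replace (Re (dilation_mean h p s - p s)%C) with (Re (dilation_mean h p s) - Re (p s)) by (unfold Re;
    simpl; ring).
  replace (Im (dilation_mean h p s - p s)%C) with (Im (dilation_mean h p s) - Im (p s)) by (unfold Im;
    simpl; ring).
  rewrite dilation_mean_re, dilation_mean_im. lra.
Qed.

(** Finitely many points below hi stay below hi under a common dilation. *)
Lemma uniform_room (hi : R) (xs : list R) : (forall y, In y xs -> 0 < y < hi) ->
  exists h0, 0 < h0 /\ forall y, In y xs -> y * (1 + h0) < hi.
Proof.
  induction xs as [|x xs IH]; intros H.
  - exists 1; split; [lra|]. intros y [].
  - destruct IH as [h0 [H0 H1]]; [intros; apply H; simpl; auto|].
    destruct (H x ltac:(simpl; auto)) as [Hx1 Hx2].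
    assert (Hd : 0 < (hi - x) / (2 * x)) by (apply Rdiv_lt_0_compat; lra).
    exists (Rmin h0 ((hi - x) / (2 * x))). split; [now apply Rmin_pos|].
    pose proof (Rmin_l h0 ((hi - x) / (2 * x))). pose proof (Rmin_r h0 ((hi - x) / (2 * x))).
    set (h := Rmin _ _) in *. intros y [<-|Hy].
    + assert (h * (2 * x) <= hi - x).
      { replace (hi - x) with ((hi - x) / (2 * x) * (2 * x)) by (field; lra).
        apply Rmult_le_compat_r; lra. }
      nra.
    + specialize (H1 y Hy). destruct (H y ltac:(simpl; auto)). nra.
Qed.

(** Downward induction on the smoothness k = n - m.  The dilation means of p are
    of class C^(k+1), hence polynomial on a slightly smaller interval that
    contains the finitely many nodes; their divided differences vanish, and so
    does that of their limit p. *)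
Lemma null_profile_poly_class_C n : forall m k, (k + m = n)%nat -> forall lo hi p, 0 <= lo < hi ->
  null_profile n lo hi p ->
  class_C k lo hi (fun s => Re (p s)) -> class_C k lo hi (fun s => Im (p s)) ->
  exists l, length l = n /\ forall s, lo < s < hi -> p s = peval l (RtoC s).
Proof.
  induction m as [|m IH]; intros k Hk lo hi p Hlh Hs H1 H2.
  - apply (null_profile_smooth n lo hi); auto; replace n with k by lia; auto.
  - assert (Hlh' : lo < hi) by lra.
    destruct (divdiff_zero (nodes lo hi n) (fun s => lo < s < hi) p (nodes_NoDup lo hi n Hlh')) as [l [Hl Hp]].
    2:{ exists l; split; [rewrite Hl; apply nodes_length|]. intros; apply Hp; auto. }
    intros s Hsd Hsn.
    assert (Hin : forall y, In y (s :: nodes lo hi n) -> lo < y < hi).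
    { intros y [<-|Hy]; auto. eapply nodes_in; eauto. }
    assert (Hnd : NoDup (s :: nodes lo hi n)) by (constructor; auto using nodes_NoDup).
    destruct (uniform_room hi (s :: nodes lo hi n)) as [h0 [Hh0 Hroom]].
    { intros y Hy. specialize (Hin y Hy). lra. }
    (* A sequence of dilation widths that tends to 0. *)
    set (hj := fun j : nat => h0 / (INR j + 1)).
    assert (Hhj : forall j, 0 < hj j <= h0).
    { intros j. pose proof (pos_INR j). unfold hj. split; [apply Rdiv_lt_0_compat; lra|].
      apply Rmult_le_reg_r with (INR j + 1); [lra|].
      replace (h0 / (INR j + 1) * (INR j + 1)) with h0 by (field; lra). nra. }
    set (pj := fun j => dilation_mean (hj j) p).
    assert (L : Ctends (fun j => divdiff (nodes lo hi n) (pj j) s) (divdiff (nodes lo hi n) p s)).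
    { apply divdiff_lim; auto. intros y Hy e He. specialize (Hin y Hy).
      destruct (dilation_mean_lim p y (proj1 Hs) ltac:(lra) e He) as [d [Hd Hb]].
      destruct (nfloor_ex (h0 / d)) as [N [_ HN]].
      { apply Rlt_le, Rdiv_lt_0_compat; auto. }
      exists N. intros j Hj. apply Hb. split; [apply Hhj|].
      unfold hj. apply le_INR in Hj. pose proof (pos_INR j).
      apply Rmult_lt_reg_r with (INR j + 1); [lra|].
      replace (h0 / (INR j + 1) * (INR j + 1)) with h0 by (field; lra).
      replace h0 with (d * (h0 / d)) by (field; lra). apply Rmult_lt_compat_l; lra. }
    apply (Ctends_unique _ _ _ L).
    replace (fun j => divdiff (nodes lo hi n) (pj j) s) with (fun _ : nat => RtoC 0);
      [apply Ctends_const|].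
    apply FunctionalExtensionality.functional_extensionality. intros j. symmetry.
    destruct (Hhj j) as [Hj1 Hj2].
    assert (Hin' : forall y, In y (s :: nodes lo hi n) -> lo < y < hi / (1 + hj j)).
    { intros y Hy. specialize (Hin y Hy). specialize (Hroom y Hy). split; [lra|].
      apply Rmult_lt_reg_r with (1 + hj j); [lra|].
      replace (hi / (1 + hj j) * (1 + hj j)) with hi by (field; lra). nra. }
    destruct (IH (S k) ltac:(lia) lo (hi / (1 + hj j)) (pj j)) as [l [Hl Hpl]].
    + specialize (Hin' s ltac:(simpl; auto)). lra.
    + apply null_profile_dilation_mean; auto.
    + apply (class_C_ext (S k) _ _ (dilation_meanR (hj j) (fun s => Re (p s)))).
      * intros; symmetry; apply dilation_mean_re.
      * apply dilation_meanR_class_C; auto; [apply Hs|lra].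
    + apply (class_C_ext (S k) _ _ (dilation_meanR (hj j) (fun s => Im (p s)))).
      * intros; symmetry; apply dilation_mean_im.
      * apply dilation_meanR_class_C; auto; [apply Hs|lra].
    + apply (divdiff_poly (nodes lo hi n) l); auto. rewrite nodes_length; lia.
Qed.

Lemma null_profile_poly n lo hi p : 0 <= lo < hi -> null_profile n lo hi p ->
  exists l, length l = n /\ forall s, lo < s < hi -> p s = peval l (RtoC s).
Proof.
  intros Hlh Hs. apply (null_profile_poly_class_C n n 0 ltac:(lia) lo hi p); auto;
    intros s Hs'; apply (proj1 Hs); lra.
Qed.

(** * Angular Fourier components of a Hoelder function on the annulus *)

(** A Hoelder bound M |z - w|^al replaced by a family of quadratic bounds, with
    q = 2^(-al/2): the bound of index k is best at the scale |z - w|^2 = 2^(-k), and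
    the product of |zeta - 1|^2 with a Poisson kernel is explicitly bounded. *)
Definition dyadic_holder (K : C -> Prop) (f : C -> C) (M q : R) : Prop :=
  forall (k : nat) z w, K z -> K w -> Cmod (f z - f w) <= M * q ^ k * (1 + 2 ^ k * Cmod (z - w) ^ 2).

(** With y = 2^k |z - w|^2 one has |z - w|^al = q^k y^(al/2), and
    y^(al/2) <= 1 + y because al/2 <= 1. *)
Lemma holder_dyadic K f : holder_on K f ->
  exists M q, 0 <= M /\ 0 < q < 1 /\ dyadic_holder K f M q.
Proof.
  intros [M [al [Hal H]]]. exists (Rabs M), (Rpower 2 (- (al / 2))).
  assert (Hq : 0 < Rpower 2 (- (al / 2)) < 1).
  { split; [apply exp_pos|]. rewrite <- (Rpower_O 2) by lra. apply Rpower_lt; lra. }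
  repeat split; try apply Hq; try apply Rabs_pos.
  intros k z w Hz Hw. set (q := Rpower 2 (- (al / 2))) in *.
  assert (Hqk : 0 < q ^ k) by (apply pow_lt; lra).
  assert (H2k : 0 < 2 ^ k) by (apply pow_lt; lra).
  set (x := Cmod (z - w)). assert (Hx : 0 <= x) by apply Cmod_ge_0.
  assert (Hr : 0 <= 1 + 2 ^ k * x ^ 2) by nra.
  destruct (Req_dec x 0) as [E|E].
  - replace (Cmod (f z - f w)) with 0.
    + apply Rmult_le_pos; auto. apply Rmult_le_pos; [apply Rabs_pos|lra].
    + apply Cmod_eq_0 in E. replace w with (z - (z - w))%C by ring. rewrite E.
      replace (z - 0)%C with z by ring. replace (f z - f z)%C with (RtoC 0) by ring. now rewrite Cmod_0.
  - assert (Hzw : z <> w).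
    { intros ->. apply E. unfold x. replace (w - w)%C with (RtoC 0) by ring. apply Cmod_0. }
    eapply Rle_trans; [apply (H z w Hz Hw Hzw)|]. fold x.
    assert (Hx0 : 0 < x) by lra.
    (* The distance measured at the scale 2^(-k/2). *)
    set (y := 2 ^ k * x ^ 2). assert (Hy : 0 < y) by (apply Rmult_lt_0_compat; auto; apply pow_lt; auto).
    assert (E1 : Rpower x al = q ^ k * Rpower y (al / 2)).
    { unfold y, q. rewrite <- !Rpower_pow; try apply exp_pos; try lra.
      rewrite Rpower_mult. rewrite <- Rpower_mult_distr by apply exp_pos.
      rewrite !Rpower_mult, <- Rmult_assoc, <- Rpower_plus.
      replace (- (al / 2) * INR k + INR k * (al / 2)) with 0 by ring.
      rewrite Rpower_O, Rmult_1_l by lra. f_equal. simpl. lra. }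
    assert (E2 : Rpower y (al / 2) <= 1 + y).
    { destruct (Rle_lt_dec y 1) as [Hy1|Hy1].
      - assert (Rpower y (al / 2) <= Rpower 1 (al / 2)) by (apply Rle_Rpower_l; lra).
        unfold Rpower in H0 at 2. rewrite ln_1, Rmult_0_r, exp_0 in H0. lra.
      - assert (Rpower y (al / 2) <= Rpower y 1) by (apply Rle_Rpower; lra).
        rewrite Rpower_1 in H0; lra. }
    rewrite E1. assert (0 <= Rpower y (al / 2)) by (left; apply exp_pos).
    apply Rle_trans with (Rabs M * (q ^ k * Rpower y (al / 2))).
    + apply Rmult_le_compat_r; [|apply Rle_abs]. apply Rmult_le_pos; lra.
    + rewrite Rmult_assoc. apply Rmult_le_compat_l; [apply Rabs_pos|].
      apply Rmult_le_compat_l; [lra|exact E2].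
Qed.

Definition unif_cont_on (K : C -> Prop) (f : C -> C) : Prop :=
  forall e, 0 < e -> exists d, 0 < d /\ forall z w, K z -> K w -> Cmod (z - w) < d ->
    Cmod (f z - f w) < e.

Lemma dyadic_unif_cont K f M q : 0 <= M -> 0 < q < 1 -> dyadic_holder K f M q -> unif_cont_on K f.
Proof.
  intros HM Hq H e He.
  destruct (geometric_small q (2 * M) e ltac:(lra) He) as [k Hk].
  assert (Hp : 0 < (1/2) ^ k) by (apply pow_lt; lra).
  exists ((1 / 2) ^ k). split; auto. intros z w Hz Hw Hzw.
  eapply Rle_lt_trans; [apply (H k); auto|].
  assert (H1 : (1 / 2) ^ k <= 1).
  { pose proof (pow_incr (1 / 2) 1 k ltac:(lra)) as H1. rewrite pow1 in H1. exact H1. }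
  assert (H2 : 2 ^ k * (1 / 2) ^ k = 1).
  { rewrite <- Rpow_mult_distr. replace (2 * (1 / 2)) with 1 by field. apply pow1. }
  assert (0 < 2 ^ k) by (apply pow_lt; lra).
  pose proof (Cmod_ge_0 (z - w)). set (x := Cmod (z - w)) in *.
  assert (x ^ 2 <= (1 / 2) ^ k) by nra.
  assert (2 ^ k * x ^ 2 <= 1) by nra.
  assert (0 < q ^ k) by (apply pow_lt; lra).
  assert (0 <= M * q ^ k) by nra. nra.
Qed.

Lemma Ccont_along K f g : unif_cont_on K f -> Ccont g -> (forall t, K (g t)) -> Ccont (fun t => f (g t)).
Proof.
  intros Hf Hg HK. apply Ccont_eps. intros t e He. destruct (Hf e He) as [d [Hd H]].
  destruct (proj2 (Ccont_eps g) Hg t d Hd) as [d2 [Hd2 H2]]. exists d2; split; auto.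
Qed.

Lemma Ccont2_along K f g : unif_cont_on K f -> Ccont2 g -> (forall s t, K (g s t)) ->
  Ccont2 (fun s t => f (g s t)).
Proof.
  intros Hf Hg HK. apply Ccont2_eps. intros x y e He. destruct (Hf e He) as [d [Hd H]].
  destruct (Ccont2_eps' g Hg x y d Hd) as [d2 [Hd2 H2]]. exists d2; split; auto.
Qed.

(** The component of f of angular frequency -n. *)
Definition fourier_coef (f : C -> C) (n : nat) (z : C) : C :=
  Cavg (fun al => f (expi al * z) * expi al ^ n)%C.

Lemma annulus_rot r1 r2 z t : annulus r1 r2 z -> annulus r1 r2 (expi t * z)%C.
Proof. unfold annulus. now rewrite Cmod_mult, Cmod_expi, Rmult_1_l. Qed.

Lemma Ccont_rot r1 r2 f z : unif_cont_on (annulus r1 r2) f -> annulus r1 r2 z ->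
  Ccont (fun al => f (expi al * z)%C).
Proof.
  intros Hf Hz. apply (Ccont_along (annulus r1 r2)); auto.
  - apply Ccont_mul; [apply Ccont_expi|apply Ccont_const].
  - intros; apply annulus_rot; auto.
Qed.

Lemma Ccont_fourier_integrand r1 r2 f n z : unif_cont_on (annulus r1 r2) f -> annulus r1 r2 z ->
  Ccont (fun al => f (expi al * z) * expi al ^ n)%C.
Proof.
  intros Hf Hz. apply Ccont_mul; [eapply Ccont_rot; eauto|apply Ccont_pow, Ccont_expi].
Qed.

Lemma fourier_coef_unif_cont r1 r2 f n : unif_cont_on (annulus r1 r2) f ->
  unif_cont_on (annulus r1 r2) (fourier_coef f n).
Proof.
  intros Hf e He. destruct (Hf (e / 2) ltac:(lra)) as [d [Hd H]]. exists d; split; auto.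
  intros z w Hz Hw Hzw. unfold fourier_coef.
    rewrite <- Cavg_sub by (eapply Ccont_fourier_integrand; eauto).
  apply Rle_lt_trans with (e / 2); [|lra]. apply Cavg_norm_const.
  - apply Ccont_sub; eapply Ccont_fourier_integrand; eauto.
  - intros t. replace (f (expi t * z) * expi t ^ n - f (expi t * w) * expi t ^ n)%C with
      ((f (expi t * z) - f (expi t * w)) * expi t ^ n)%C by ring.
    rewrite Cmod_mult, Cmod_pow, Cmod_expi, pow1, Rmult_1_r. left. apply H; auto using annulus_rot.
    replace (expi t * z - expi t * w)%C with (expi t * (z - w))%C by ring.
    rewrite Cmod_mult, Cmod_expi, Rmult_1_l. auto.
Qed.

(** Rotating z amounts to shifting the variable of integration. *)
Lemma fourier_coef_rot r1 r2 f n z phi : unif_cont_on (annulus r1 r2) f -> annulus r1 r2 z ->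
  (expi phi ^ n * fourier_coef f n (expi phi * z))%C = fourier_coef f n z.
Proof.
  intros Hf Hz. unfold fourier_coef.
  rewrite <- Cavg_scal by (eapply Ccont_fourier_integrand; eauto using annulus_rot).
  rewrite <- (Cavg_shift (fun al => f (expi al * z) * expi al ^ n)%C phi).
  - apply Cavg_ext. intros t. rewrite expi_add, Cpow_mult_l.
    replace (expi t * expi phi * z)%C with (expi t * (expi phi * z))%C by ring. ring.
  - eapply Ccont_fourier_integrand; eauto.
  - intros; now rewrite expi_period.
Qed.

Lemma polar z : exists phi, z = (RtoC (Cmod z) * expi phi)%C.
Proof.
  destruct (Req_dec (Cmod z) 0) as [E|E].
  { exists 0. rewrite E. apply Cmod_eq_0 in E. rewrite E. ring. }
  assert (H0 : 0 < Cmod z) by (pose proof (Cmod_ge_0 z); lra).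
  set (c := Re z / Cmod z). set (s := Im z / Cmod z).
  assert (Hcs : c ^ 2 + s ^ 2 = 1).
  { unfold c, s. pose proof (Cmod2_alt z) as H. 
    replace ((Re z / Cmod z) ^ 2 + (Im z / Cmod z) ^ 2)
      with ((Re z ^ 2 + Im z ^ 2) / Cmod z ^ 2) by (field; lra).
    rewrite <- H. field. lra. }
  assert (Hc : -1 <= c <= 1) by nra.
  assert (Hs : sqrt (1 - Rsqr c) = Rabs s).
  { rewrite <- sqrt_Rsqr_abs. f_equal. unfold Rsqr. nra. }
  assert (E2 : forall phi, cos phi = c -> sin phi = s -> z = (RtoC (Cmod z) * expi phi)%C).
  { intros phi E1 E3. unfold expi. rewrite E1, E3. destruct z as [a b].
    unfold c, s, Cmult, RtoC, Re, Im in *.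
    cbn [fst snd] in *. f_equal; field; auto. }
  destruct (Rle_lt_dec 0 s) as [Hp|Hn].
  - exists (acos c). apply E2; [apply cos_acos; lra|].
    rewrite sin_acos by lra. rewrite Hs. apply Rabs_pos_eq; auto.
  - exists (- acos c). apply E2; [rewrite cos_neg; apply cos_acos; lra|].
    rewrite sin_neg, sin_acos by lra. rewrite Hs. rewrite Rabs_left; lra.
Qed.

(** Clamping the variable turns a function on [lo, hi] into one that is
    continuous on the whole line. *)
Definition clamp (lo hi s : R) : R := Rmax lo (Rmin s hi).

Lemma clamp_in lo hi s : lo <= hi -> lo <= clamp lo hi s <= hi.
Proof. intros. unfold clamp, Rmax, Rmin. repeat destruct Rle_dec; lra. Qed.
Lemma clamp_id lo hi s : lo <= s <= hi -> clamp lo hi s = s.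
Proof. intros. unfold clamp, Rmax, Rmin. repeat destruct Rle_dec; lra. Qed.
Lemma clamp_cont lo hi s : continuity_pt (clamp lo hi) s.
Proof.
  apply continuity_pt_eps. intros e He. exists e; split; auto. intros u Hu.
  eapply Rle_lt_trans; [|exact Hu]. unfold clamp, Rmax, Rmin, Rabs.
  repeat destruct Rle_dec; repeat destruct Rcase_abs; lra.
Qed.

(** The function p with z^n g_n(z) = p(|z|^2), see [radial_profile_eq]. *)
Definition radial_profile (r1 r2 : R) (f : C -> C) (n : nat) (s : R) : C :=
  (RtoC (sqrt (clamp (r1 ^ 2) (r2 ^ 2) s)) ^ n * fourier_coef f n (RtoC (sqrt (clamp (r1 ^ 2) (r2 ^ 2) s))))%C.

Lemma sqrt_clamp r1 r2 s : 0 < r1 < r2 -> annulus r1 r2 (RtoC (sqrt (clamp (r1 ^ 2) (r2 ^ 2) s))).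
Proof.
  intros Hr. unfold annulus. rewrite Cmod_R, Rabs_pos_eq by apply sqrt_pos.
  pose proof (clamp_in (r1 ^ 2) (r2 ^ 2) s ltac:(nra)).
  set (c := clamp _ _ _) in *.
  rewrite <- (sqrt_pow2 r1), <- (sqrt_pow2 r2) by lra. split; apply sqrt_le_1_alt; lra.
Qed.

Lemma radial_profile_cont r1 r2 f n : 0 < r1 < r2 -> unif_cont_on (annulus r1 r2) f ->
  Ccont (radial_profile r1 r2 f n).
Proof.
  intros Hr Hf. unfold radial_profile.
  assert (H : Ccont (fun s => RtoC (sqrt (clamp (r1 ^ 2) (r2 ^ 2) s)))).
  { apply Ccont_RtoC. intros t. apply (continuity_pt_comp (clamp (r1 ^ 2) (r2 ^ 2)) sqrt).
    - apply clamp_cont.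
    - apply continuity_pt_sqrt. pose proof (clamp_in (r1 ^ 2) (r2 ^ 2) t ltac:(nra)). nra. }
  apply Ccont_mul; [apply Ccont_pow, H|].
  apply (Ccont_along (annulus r1 r2) (fourier_coef f n)); auto using fourier_coef_unif_cont.
  intros; apply sqrt_clamp, Hr.
Qed.

Lemma radial_profile_eq r1 r2 f n z : 0 < r1 < r2 -> unif_cont_on (annulus r1 r2) f -> annulus r1 r2 z ->
  radial_profile r1 r2 f n (Cmod z ^ 2) = (z ^ n * fourier_coef f n z)%C.
Proof.
  intros Hr Hf Hz. unfold radial_profile.
  rewrite clamp_id by (unfold annulus in Hz; pose proof (Cmod_ge_0 z); split; apply pow_incr; lra).
  rewrite sqrt_pow2 by apply Cmod_ge_0.
  destruct (polar z) as [phi E].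
  assert (Ha : annulus r1 r2 (RtoC (Cmod z))).
  { unfold annulus in *. rewrite Cmod_R, Rabs_pos_eq; auto using Cmod_ge_0. }
  rewrite <- (fourier_coef_rot r1 r2 f n _ phi Hf Ha).
  replace (expi phi * RtoC (Cmod z))%C with z by (rewrite E at 1; apply Cmult_comm).
  transitivity ((RtoC (Cmod z) * expi phi) ^ n * fourier_coef f n z)%C.
  - rewrite Cpow_mult_l. ring.
  - now rewrite <- E.
Qed.

Lemma circle_mod a rho z : Cmod (z - a) = rho -> rho - Cmod a <= Cmod z <= rho + Cmod a.
Proof.
  intros H. split.
  - pose proof (Cmod_triangle z (- a)). rewrite Cmod_opp in H0. fold (Cminus z a) in H0. lra.
  - pose proof (Cmod_triangle (z - a) a). replace (z - a + a)%C with z in H0 by ring. lra.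
Qed.

Definition zero_averages (r1 r2 : R) (f : C -> C) : Prop :=
  forall (a : C) (rho : R), 0 < rho -> (forall z : C, circle a rho z -> annulus r1 r2 z) ->
    surrounds_origin a rho -> circle_average f a rho = RtoC 0.

(** The average of g_n over a circle is the mean over al of the averages of f
    over the rotated circles, which vanish by hypothesis. *)
Lemma radial_profile_null r1 r2 f n : 0 < r1 < r2 -> unif_cont_on (annulus r1 r2) f ->
  zero_averages r1 r2 f ->
  null_profile n (r1 ^ 2) (r2 ^ 2) (radial_profile r1 r2 f n).
Proof.
  intros Hr Hf Hz. split.
  { intros s _. apply (radial_profile_cont r1 r2 f n Hr Hf s). }
  intros k s Hk Hs H1 H2.
  set (rho := sqrt s). assert (Hrho : 0 < rho) by (apply sqrt_lt_R0, Hs).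
  assert (Es : s = rho ^ 2) by (unfold rho; rewrite pow2_sqrt; lra).
  assert (B1 : r1 <= rho * (1 - k)).
  { left. apply Rsqr_incrst_0; [|lra|nra]. unfold Rsqr. rewrite Es in H1. nra. }
  assert (B2 : rho * (1 + k) <= r2).
  { left. apply Rsqr_incrst_0; [|nra|lra]. unfold Rsqr. rewrite Es in H2. nra. }
  set (a := RtoC (k * rho)).
  assert (Ha : Cmod a = k * rho) by (unfold a; rewrite Cmod_R, Rabs_pos_eq; nra).
  assert (Hann : forall al z, circle (expi al * a)%C rho z -> annulus r1 r2 z).
  { intros al z Hc. apply circle_mod in Hc. rewrite Cmod_mult, Cmod_expi, Ha in Hc.
    unfold annulus. nra. }
  set (pt := fun t => (a + RtoC rho * expi t)%C).
  assert (Hpt : forall al t, circle (expi al * a)%C rho (expi al * a + RtoC rho * expi t)%C).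
  { intros al t. unfold circle.
    replace (expi al * a + RtoC rho * expi t - expi al * a)%C with (RtoC rho * expi t)%C by ring.
    rewrite Cmod_mult, Cmod_expi, Cmod_R, Rabs_pos_eq; lra. }
  assert (Hpt0 : forall t, annulus r1 r2 (pt t)).
  { intros t. apply (Hann 0). replace (pt t) with (expi 0 * a + RtoC rho * expi t)%C; [apply Hpt|].
    unfold pt. rewrite expi_0. ring. }
  assert (Cpt : Ccont pt) by (unfold pt; auto with ccont).
  set (F := fun al t => (f (expi al * pt t) * expi al ^ n)%C).
  assert (HF : Ccont2 F).
  { apply Ccont2_mul.
    - apply (Ccont2_along (annulus r1 r2) f (fun al t => expi al * pt t)%C); auto.
      + apply Ccont2_mul; [apply (Ccont2_of1 expi), Ccont_expi|apply (Ccont2_of2 pt), Cpt].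
      + intros; apply annulus_rot; auto.
    - apply (Ccont2_of1 (fun al => expi al ^ n)%C), Ccont_pow, Ccont_expi. }
  assert (H0 : forall al, Cavg (fun t => F al t) = 0%C).
  { intros al. set (c := (expi al * a)%C).
    assert (Cc : Ccont (fun t => f (c + RtoC rho * expi t)%C)).
    { apply (Ccont_along (annulus r1 r2)); auto.
      - auto with ccont.
      - intros t. apply (Hann al), Hpt. }
    transitivity (Cavg (fun t => expi al ^ n * f (c + RtoC rho * expi (t + al)))%C).
    - apply Cavg_ext. intros t. unfold F, pt, c. rewrite expi_add, Cmult_comm. do 2 f_equal. ring.
    - rewrite Cavg_scal by (apply (Ccont_comp (fun t => f (c + RtoC rho * expi t)%C) (fun t => t + al)); auto;
        intros; apply (continuity_pt_plus id (fun _ => al));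
        [apply derivable_continuous_pt, derivable_pt_id|apply continuity_pt_cst]).
      rewrite (Cavg_shift (fun t => f (c + RtoC rho * expi t)%C)); auto.
      + rewrite <- circle_average_Cavg by auto. rewrite Hz; auto; [ring|apply Hann|].
        unfold surrounds_origin, Defs.disc, c.
          replace (0 - expi al * a)%C with (- (expi al * a))%C by ring.
        rewrite Cmod_opp, Cmod_mult, Cmod_expi, Ha. nra.
      + intros t. now rewrite expi_period. }
  assert (G0 : Cavg (fun t => fourier_coef f n (pt t)) = 0%C).
  { rewrite (Cavg_ext _ (fun t => RtoC (/ (2 * PI)) * Cint (fun al => F al t) 0 (2 * PI))%C)
      by (intros; unfold fourier_coef; apply Cavg_Cint).
    pose proof twoPI_pos.
    rewrite Cavg_scal by (apply Ccont_Cint; auto; lra).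
    rewrite Cavg_Cint_0; auto; [ring|lra]. }
  assert (Cg : Ccont (fun t => fourier_coef f n (pt t))).
  { apply (Ccont_along (annulus r1 r2)); auto using fourier_coef_unif_cont. }
  rewrite (Cavg_ext _ (fun t => RtoC rho ^ n * fourier_coef f n (pt t))%C).
  { rewrite Cavg_scal, G0 by auto. ring. }
  intros t. assert (Ept : pt t = (RtoC rho * (expi t + RtoC k))%C).
  { unfold pt, a. rewrite RtoC_mult. ring. }
  replace (s * msq k t) with (Cmod (pt t) ^ 2).
  - rewrite radial_profile_eq by auto. rewrite Ept at 1. unfold kern. rewrite Cpow_mult_l.
    field. apply Cpow_nz, shift_nz, Hk.
  - rewrite Ept, Cmod_mult, Cmod_R, Rabs_pos_eq by lra. unfold msq. rewrite Es. ring.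
Qed.

Lemma Ccont_zero_closed (g : R -> C) lo hi : lo < hi -> Ccont g ->
  (forall s, lo < s < hi -> g s = 0%C) -> forall s, lo <= s <= hi -> g s = 0%C.
Proof.
  intros Hlh Hg H0 s Hs. apply Cmod_eq_0, Rle_antisym; [|apply Cmod_ge_0].
  apply le_epsilon. intros e He. rewrite Rplus_0_l.
  destruct (proj2 (Ccont_eps g) Hg s e He) as [d [Hd Hh]].
  (* Move s slightly towards the middle of the interval. *)
  set (eta := Rmin (1 / 2) (d / (2 * (hi - lo)))).
  assert (He1 : 0 < eta) by (apply Rmin_pos; [lra|apply Rdiv_lt_0_compat; lra]).
  assert (He2 : eta <= 1 / 2) by apply Rmin_l.
  assert (He3 : eta * (hi - lo) < d).
  { apply Rle_lt_trans with (d / (2 * (hi - lo)) * (hi - lo)).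
    - apply Rmult_le_compat_r; [lra|apply Rmin_r].
    - replace (d / (2 * (hi - lo)) * (hi - lo)) with (d / 2) by (field; lra). lra. }
  set (u := s + eta * ((lo + hi) / 2 - s)).
  assert (Hu : lo < u < hi) by (unfold u; nra).
  assert (Hus : Rabs (u - s) < d).
  { unfold u. replace (s + eta * ((lo + hi) / 2 - s) - s) with (eta * ((lo + hi) / 2 - s)) by ring.
    rewrite Rabs_mult, (Rabs_pos_eq eta) by lra. eapply Rle_lt_trans; [|exact He3].
    apply Rmult_le_compat_l; [lra|]. apply Rabs_le. lra. }
  specialize (Hh u Hus). rewrite H0 in Hh by auto.
  replace (0 - g s)%C with (- g s)%C in Hh by ring. rewrite Cmod_opp in Hh. lra.
Qed.

(** * Polynomials in two variables *)

Inductive poly2 : (C -> C -> C) -> Prop :=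
  | poly2_const c : poly2 (fun _ _ => c)
  | poly2_fst : poly2 (fun u _ => u)
  | poly2_snd : poly2 (fun _ w => w)
  | poly2_add P Q : poly2 P -> poly2 Q -> poly2 (fun u w => P u w + Q u w)%C
  | poly2_mul P Q : poly2 P -> poly2 Q -> poly2 (fun u w => P u w * Q u w)%C.

(** The form of degree m - 1 in (u, w) with coefficients l, where m = length l;
    for u = 1/z it is z^(1-m) l(z w). *)
Fixpoint homogenization (l : list C) (u w : C) : C :=
  match l with nil => 0%C | c :: l' => (c * u ^ length l' + w * homogenization l' u w)%C end.

Lemma poly2_homogenization l : poly2 (homogenization l).
Proof.
  induction l as [|c l IH]; simpl.
  - apply poly2_const.
  - apply (poly2_add (fun u w => c * u ^ length l)%C (fun u w => w * homogenization l u w)%C).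
    + apply (poly2_mul (fun _ _ => c) (fun u _ => u ^ length l)%C); [apply poly2_const|].
      induction (length l); simpl; [apply poly2_const|].
      apply (poly2_mul (fun u _ => u) (fun u _ => u ^ n)%C); auto using poly2_fst.
    + apply (poly2_mul (fun _ w => w)); auto using poly2_snd.
Qed.

Lemma homogenization_eq (l : list C) (z : C) : z <> 0%C ->
  (homogenization l (/ z) (Cconj z) * z ^ length l)%C = (z * peval l (RtoC (Cmod z ^ 2)))%C.
Proof.
  intros Hz. assert (Es : RtoC (Cmod z ^ 2) = (z * Cconj z)%C) by (rewrite RtoC_pow, <- RtoC_pow;
    apply Cmod2_conj).
  rewrite Es. clear Es. induction l as [|c l IH]; cbn [length homogenization peval]; [ring|].
  rewrite Cpow_S, Cpow_inv by auto.
  assert (z ^ length l <> 0)%C by (apply Cpow_nz; auto).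
  transitivity (c * z + z * Cconj z * (homogenization l (/ z) (Cconj z) * z ^ length l))%C; [field;
    auto|].
  rewrite IH. ring.
Qed.

Lemma annulus_nz r1 r2 z : 0 < r1 -> annulus r1 r2 z -> z <> 0%C.
Proof. intros Hr [H _]. apply Cmod_gt_0. lra. Qed.

(** On the open interval this is [null_profile_poly]; the end points follow by
    continuity. *)
Lemma fourier_coef_radial_poly r1 r2 f n : 0 < r1 < r2 -> unif_cont_on (annulus r1 r2) f ->
  zero_averages r1 r2 f ->
  exists l, length l = n /\ forall z, annulus r1 r2 z ->
    (z ^ n * fourier_coef f n z)%C = peval l (RtoC (Cmod z ^ 2)).
Proof.
  intros Hr Hf Hz.
  assert (Hlt : r1 ^ 2 < r2 ^ 2) by nra.
  destruct (null_profile_poly n (r1 ^ 2) (r2 ^ 2) _ ltac:(nra) (radial_profile_null r1 r2 f n Hr Hf Hz)) as [l [Hl Hp]].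
  exists l; split; auto. intros z Ha. rewrite <- (radial_profile_eq r1 r2) by auto.
  apply Ceq_minus.
  apply (Ccont_zero_closed (fun s => radial_profile r1 r2 f n s - peval l (RtoC s))%C (r1 ^ 2) (r2 ^ 2) Hlt).
  - apply Ccont_sub; [apply radial_profile_cont; auto|]. apply Ccont_peval, Ccont_RtoC.
    intros; apply derivable_continuous_pt, derivable_pt_id.
  - intros s Hs. rewrite Hp by auto. ring.
  - destruct Ha. split; apply pow_incr; lra.
Qed.

Lemma fourier_coef_zero r1 r2 f z : 0 < r1 < r2 -> unif_cont_on (annulus r1 r2) f ->
  zero_averages r1 r2 f ->
  annulus r1 r2 z -> fourier_coef f 0 z = 0%C.
Proof.
  intros Hr Hf H0 Hz. destruct (fourier_coef_radial_poly r1 r2 f 0 Hr Hf H0) as [[|] [Hl Hp]];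
    [|simpl in Hl; lia].
  specialize (Hp z Hz). simpl in Hp. rewrite <- Hp. ring.
Qed.

Lemma fourier_coef_poly2 r1 r2 f n : 0 < r1 < r2 -> unif_cont_on (annulus r1 r2) f ->
  zero_averages r1 r2 f ->
  exists H, poly2 H /\ forall z, annulus r1 r2 z -> (z * fourier_coef f n z)%C = H (/ z)%C (Cconj z).
Proof.
  intros Hr Hf H0. destruct (fourier_coef_radial_poly r1 r2 f n Hr Hf H0) as [l [Hl Hp]].
  exists (homogenization l); split; [apply poly2_homogenization|]. intros z Hz.
  assert (Hn : z <> 0%C) by (eapply annulus_nz; [|eauto]; lra).
  pose proof (homogenization_eq l z Hn) as E. rewrite Hl, <- Hp in E by auto.
  assert (Hzn : (z ^ n)%C <> 0%C) by (apply Cpow_nz; auto).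
  transitivity (homogenization l (/ z) (Cconj z) * z ^ n * / z ^ n)%C; [rewrite E|]; field; auto.
Qed.

(** * Abel means and the Poisson kernel *)

Lemma kernel_mean_poly2_aux r1 r2 f l : 0 < r1 < r2 -> unif_cont_on (annulus r1 r2) f ->
  zero_averages r1 r2 f ->
  forall j, exists H, poly2 H /\ forall z, annulus r1 r2 z ->
    (z * Cavg (fun al => f (expi al * z) * (expi al ^ j * peval l (expi al))))%C = H (/ z)%C (Cconj z).
Proof.
  intros Hr Hf Hz. induction l as [|c l IH]; intros j.
  - exists (fun _ _ => 0%C); split; [apply poly2_const|]. intros z Ha.
    rewrite (Cavg_ext _ (fun _ => 0%C)) by (intros; simpl; ring). rewrite Cavg_const. ring.
  - destruct (IH (S j)) as [H1 [P1 E1]].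
    destruct (fourier_coef_poly2 r1 r2 f j Hr Hf Hz) as [H2 [P2 E2]].
    exists (fun u w => c * H2 u w + H1 u w)%C; split.
    + apply (poly2_add (fun u w => c * H2 u w)%C); auto.
      apply (poly2_mul (fun _ _ => c)); auto using poly2_const.
    + intros z Ha. rewrite <- E1, <- E2 by auto. unfold fourier_coef.
      assert (C1 := Ccont_fourier_integrand r1 r2 f j z Hf Ha).
      assert (C2 : Ccont (fun al => f (expi al * z) * (expi al ^ S j * peval l (expi al)))%C).
      { apply Ccont_mul; [eapply Ccont_rot; eauto|]. apply Ccont_mul; [apply Ccont_pow, Ccont_expi|].
        apply Ccont_peval, Ccont_expi. }
      rewrite (Cavg_ext _ (fun al => c * (f (expi al * z) * expi al ^ j) +
         f (expi al * z) * (expi al ^ S j * peval l (expi al)))%C) by (intros; simpl; ring).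
      rewrite Cavg_add, Cavg_scal; auto; [ring|].
      apply (Ccont_mul (fun _ => c)); auto using Ccont_const.
Qed.

(** Integrating f(zeta z) against a polynomial in zeta produces a combination of
    the components g_n. *)
Lemma kernel_mean_poly2 r1 r2 f k : 0 < r1 < r2 -> unif_cont_on (annulus r1 r2) f ->
  zero_averages r1 r2 f ->
  ispoly k -> exists H, poly2 H /\ forall z, annulus r1 r2 z ->
    (z * Cavg (fun al => f (expi al * z) * k (expi al)))%C = H (/ z)%C (Cconj z).
Proof.
  intros Hr Hf Hz [l Hl]. destruct (kernel_mean_poly2_aux r1 r2 f l Hr Hf Hz 0) as [H [P E]].
  exists H; split; auto. intros z Ha. rewrite <- E by auto. f_equal. apply Cavg_ext.
  intros t. rewrite Hl. simpl. ring.
Qed.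

Definition poisson_den (t al : R) : C := (1 - RtoC t * expi al)%C.
Definition poisson (t al : R) : R := (1 - t ^ 2) / Cmod (poisson_den t al) ^ 2.

Lemma poisson_den_lower t al : 0 <= t < 1 -> 1 - t <= Cmod (poisson_den t al).
Proof.
  intros Ht. unfold poisson_den. eapply Rle_trans; [|apply Cmod_sub_ge].
  rewrite Cmod_1, Cmod_mult, Cmod_R, Cmod_expi, Rabs_pos_eq; lra.
Qed.

Lemma poisson_den_nz t al : 0 <= t < 1 -> poisson_den t al <> 0%C.
Proof. intros Ht. apply Cmod_gt_0. pose proof (poisson_den_lower t al Ht). lra. Qed.

Lemma Ccont_poisson_den t : Ccont (poisson_den t).
Proof.
  unfold poisson_den; auto with ccont.
Qed.

Lemma poisson_den_sq t al : Cmod (poisson_den t al) ^ 2 = 1 - 2 * t * cos al + t ^ 2.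
Proof.
  rewrite Cmod2_alt. unfold poisson_den, expi, Re, Im, Cminus, Cplus, Copp, Cmult, RtoC; cbn [fst snd].
  pose proof (sin2_cos2 al) as H. unfold Rsqr in H. nra.
Qed.

Lemma poisson_cont t : 0 <= t < 1 -> forall al, continuity_pt (poisson t) al.
Proof.
  intros Ht al. unfold poisson.
  apply (continuity_pt_div (fun _ => 1 - t ^ 2) (fun al => Cmod (poisson_den t al) ^ 2)).
  - apply continuity_pt_cst.
  - pose proof (Ccont_Cmod _ (Ccont_poisson_den t) al).
    apply (continuity_pt_mult (fun t0 => Cmod (poisson_den t t0)) (fun t0 => Cmod (poisson_den t t0) * 1)); auto.
    apply (continuity_pt_mult (fun t0 => Cmod (poisson_den t t0)) (fun _ => 1)); auto.
    apply continuity_pt_cst.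
  - apply pow_nonzero. pose proof (poisson_den_lower t al Ht). lra.
Qed.

Lemma poisson_eq t al : 0 <= t < 1 ->
  RtoC (poisson t al) = (/ (1 - RtoC t * expi al) + / (1 - RtoC t * Cconj (expi al)) - 1)%C.
Proof.
  intros Ht. set (d := poisson_den t al).
  assert (Hd : d <> 0%C) by (apply poisson_den_nz, Ht).
  assert (Ec : (1 - RtoC t * Cconj (expi al))%C = Cconj d).
  { unfold d, poisson_den. rewrite Cminus_conj, Cmult_conj. unfold Cconj, RtoC; simpl.
    apply injective_projections; simpl; ring. }
  assert (Hcd : Cconj d <> 0%C).
  { intro E. apply Hd. rewrite <- (Cconj_conj d), E. unfold Cconj; simpl.
    apply injective_projections; simpl; ring. }
  rewrite Ec. unfold poisson. fold d. change (1 - RtoC t * expi al)%C with d.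
  rewrite RtoC_div by (apply pow_nonzero; pose proof (poisson_den_lower t al Ht); fold d in H; lra).
  rewrite (RtoC_pow (Cmod d)), <- RtoC_pow, Cmod2_conj.
  replace (RtoC (1 - t ^ 2)) with (d + Cconj d - d * Cconj d)%C; [field; auto|].
  rewrite <- Ec. unfold d, poisson_den. rewrite RtoC_minus, RtoC_pow.
  transitivity (1 - RtoC t ^ 2 * (expi al * Cconj (expi al)))%C; [ring|].
  rewrite expi_conj_r. ring.
Qed.

(** The Poisson kernel is 2 Re 1/(1 - t zeta) - 1, and 1/(1 - t x) is in the disc
    algebra. *)
Lemma poisson_mean t : 0 <= t < 1 -> Ravg (poisson t) = 1.
Proof.
  intros Ht.
  assert (Hd : diskalg (fun x => / (1 + (- RtoC t) * x))%C).
  { apply diskalg_inv_lin. rewrite Cmod_opp, Cmod_R, Cmod_1, Rabs_pos_eq; lra. }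
  assert (Hc : Ccont (fun al => / (1 + (- RtoC t) * expi al))%C).
  { apply (Ccont_ext (fun al => / poisson_den t al)%C).
    - intros al. unfold poisson_den. f_equal. ring.
    - apply Ccont_inv; [apply Ccont_poisson_den|intros; apply poisson_den_nz, Ht]. }
  assert (Hcc : Ccont (fun al => / (1 + (- RtoC t) * Cconj (expi al)))%C).
  { apply (Ccont_ext (fun al => / (1 + (- RtoC t) * expi (- al)))%C).
    - intros al. now rewrite expi_neg.
    - apply (Ccont_comp (fun al => / (1 + (- RtoC t) * expi al))%C Ropp); auto.
      apply continuity_pt_Ropp. }
  assert (E : Cavg (fun al => RtoC (poisson t al)) = 1%C).
  { rewrite (Cavg_ext _ (fun al => / (1 + (- RtoC t) * expi al) + / (1 + (- RtoC t) * Cconj (expi al)) - 1)%C).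
    - rewrite Cavg_sub, Cavg_add, Cavg_const; auto using Ccont_add, Ccont_const.
      rewrite (diskalg_mean _ Hd Hc), (diskalg_mean_conj _ Hd Hc).
      rewrite !Cmult_0_r, !Cplus_0_r. field. 
    - intros al. rewrite poisson_eq by auto. do 3 f_equal; ring. }
  apply (f_equal Re) in E. exact E.
Qed.

Lemma poisson_nonneg t al : 0 <= t < 1 -> 0 <= poisson t al.
Proof.
  intros Ht. unfold poisson. apply Rmult_le_pos; [nra|].
  left. apply Rinv_0_lt_compat, pow_lt. pose proof (poisson_den_lower t al Ht). lra.
Qed.

(** A pointwise bound: with D = |1 - t zeta|^2 one has |zeta - 1|^2 <= 2 D, while
    the kernel is (1 - t^2) / D. *)
Lemma poisson_second_moment t al : 1 / 2 <= t < 1 ->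
  poisson t al * Cmod (expi al - 1) ^ 2 <= 4 * (1 - t).
Proof.
  intros Ht.
  assert (E : Cmod (expi al - 1) ^ 2 = 2 - 2 * cos al).
  { rewrite Cmod2_alt. unfold expi, Re, Im, Cminus, Cplus, Copp, RtoC; cbn [fst snd].
    pose proof (sin2_cos2 al) as H. unfold Rsqr in H. nra. }
  pose proof (poisson_den_sq t al) as Ed. pose proof (poisson_den_lower t al ltac:(lra)) as Hl.
  assert (Hp : 0 < Cmod (poisson_den t al) ^ 2) by (apply pow_lt; lra).
  unfold poisson. rewrite E. set (D := Cmod (poisson_den t al) ^ 2) in *.
  apply Rmult_le_reg_r with D; auto.
  replace ((1 - t ^ 2) / D * (2 - 2 * cos al) * D) with ((1 - t ^ 2) * (2 - 2 * cos al)) by (field; lra).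
  assert (Hc : 2 - 2 * cos al <= 2 * D) by (rewrite Ed; pose proof (COS_bound al); nra).
  assert (0 <= 2 - 2 * cos al) by (pose proof (COS_bound al); lra).
  assert ((1 - t ^ 2) * (2 - 2 * cos al) <= 2 * (1 - t) * (2 * D)).
  { apply Rmult_le_compat; nra. }
  lra.
Qed.

Definition abel_radius (k : nat) : R := 1 - (1 / 2) ^ S k.
(** The sum of (t x)^n over 1 <= n <= N. *)
Definition abel_kernel (N : nat) (t : R) (x : C) : C := (RtoC t * x * geom N (RtoC t * x))%C.
Definition abel_mean (f : C -> C) (N : nat -> nat) (k : nat) (z : C) : C :=
  Cavg (fun al => f (expi al * z) * abel_kernel (N k) (abel_radius k) (expi al))%C.

Lemma half_pow k : 0 < (1 / 2) ^ k <= 1.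
Proof.
  split; [apply pow_lt; lra|]. pose proof (pow_incr (1 / 2) 1 k ltac:(lra)) as H. now rewrite pow1 in H.
Qed.

Lemma abel_radius_range k : 1 / 2 <= abel_radius k < 1.
Proof. unfold abel_radius. pose proof (half_pow k). simpl. lra. Qed.

Lemma abel_kernel_poly N t : ispoly (abel_kernel N t).
Proof. unfold abel_kernel. apply ispoly_mul; [apply ispoly_scal, ispoly_id|apply geom_poly]. Qed.

Lemma ispoly_Ccont h : ispoly h -> Ccont (fun al => h (expi al)).
Proof.
  intros [l Hl]. apply (Ccont_ext (fun al => peval l (expi al))); [intros; auto|].
  apply Ccont_peval, Ccont_expi.
Qed.

Lemma abel_kernel_mean N t : Cavg (fun al => abel_kernel N t (expi al)) = 0%C.
Proof.
  destruct (abel_kernel_poly N t) as [l Hl]. rewrite (Cavg_ext _ (fun al => peval l (expi al))) by auto.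
  rewrite Cavg_peval, <- Hl. unfold abel_kernel. ring.
Qed.

(** Adding 1 to the kernel gives a partial sum of the geometric series. *)
Lemma abel_kernel_error N t (x : C) : 0 <= t < 1 -> Cmod x = 1 ->
  Cmod (/ (1 - RtoC t * x) - (1 + abel_kernel N t x)) <= t ^ S N * / (1 - t).
Proof.
  intros Ht Hx. change (1 + abel_kernel N t x)%C with (geom (S N) (RtoC t * x)).
  apply geom_error; [|lra]. rewrite Cmod_mult, Cmod_R, Hx, Rabs_pos_eq; lra.
Qed.

Section Estimates.
Variables (r1 r2 : R) (f : C -> C) (M q B : R) (N : nat -> nat).
Hypothesis Hr : 0 < r1 < r2.
Hypothesis HM : 0 <= M.
Hypothesis Hq : 0 < q < 1.
Hypothesis Hf : dyadic_holder (annulus r1 r2) f M q.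
Hypothesis HB : forall z, annulus r1 r2 z -> Cmod (f z) <= B.
Hypothesis HN : forall k, abel_radius k ^ S (N k) * 2 ^ S k <= q ^ k.

Let Hu : unif_cont_on (annulus r1 r2) f := dyadic_unif_cont _ _ _ _ HM Hq Hf.

Lemma abel_kernel_error_at k x : Cmod x = 1 ->
  Cmod (/ (1 - RtoC (abel_radius k) * x) - (1 + abel_kernel (N k) (abel_radius k) x)) <= q ^ k.
Proof.
  intros Hx. pose proof (abel_radius_range k). eapply Rle_trans; [apply abel_kernel_error; [lra|auto]|].
  replace (/ (1 - abel_radius k)) with (2 ^ S k); auto.
  unfold abel_radius. replace (1 - (1 - (1 / 2) ^ S k)) with ((1 / 2) ^ S k) by ring.
  replace (1 / 2) with (/ 2) by field. rewrite pow_inv, Rinv_inv. reflexivity.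
Qed.

(** At the radius t = 1 - 2^(-k-1) the bound of index k + 1 for f is the matching
    one: 2^(k+1) times the second moment of the kernel is bounded. *)
Lemma poisson_holder z k al : annulus r1 r2 z ->
  Cmod (f (expi al * z)%C - f z) * poisson (abel_radius k) al <=
    M * q ^ S k * (poisson (abel_radius k) al + 4 * r2 ^ 2).
Proof.
  intros Hz. pose proof (abel_radius_range k) as Ht.
    pose proof (poisson_nonneg (abel_radius k) al ltac:(lra)) as Hp.
  pose proof (poisson_second_moment (abel_radius k) al Ht) as H2.
  pose proof (Hf (S k) (expi al * z)%C z (annulus_rot _ _ _ _ Hz) Hz) as Hh.
  replace (expi al * z - z)%C with ((expi al - 1) * z)%C in Hh by ring.
  rewrite Cmod_mult in Hh. set (P := poisson (abel_radius k) al) in *.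
    set (x := Cmod (expi al - 1)) in *.
  assert (Hc : 0 <= M * q ^ S k) by (apply Rmult_le_pos; auto; apply pow_le; lra).
  eapply Rle_trans; [apply Rmult_le_compat_r; [exact Hp|exact Hh]|].
  rewrite Rmult_assoc. apply Rmult_le_compat_l; auto.
  assert (Hz2 : Cmod z ^ 2 <= r2 ^ 2) by (apply pow_incr; destruct Hz; pose proof (Cmod_ge_0 z); lra).
  assert (E : 2 ^ S k * (1 - abel_radius k) = 1).
  { unfold abel_radius. replace (1 - (1 - (1 / 2) ^ S k)) with ((1 / 2) ^ S k) by ring.
    rewrite <- Rpow_mult_distr. replace (2 * (1 / 2)) with 1 by field. apply pow1. }
  assert (H2k : 0 < 2 ^ S k) by (apply pow_lt; lra).
  set (T := 2 ^ S k) in *.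
  replace ((1 + T * (x * Cmod z) ^ 2) * P) with (P + T * (P * x ^ 2) * Cmod z ^ 2) by ring.
  apply Rplus_le_compat_l.
  apply Rmult_le_compat; [|apply pow2_ge_0| |exact Hz2].
  - apply Rmult_le_pos; [lra|]. apply Rmult_le_pos; [auto|apply pow2_ge_0].
  - apply Rle_trans with (T * (4 * (1 - abel_radius k))); [apply Rmult_le_compat_l; lra|lra].
Qed.

Lemma poisson_estimate z k g e : annulus r1 r2 z -> Ccont g ->
  (forall al, Cmod (g al) <= Cmod (f (expi al * z)%C - f z) * poisson (abel_radius k) al + e) ->
  Cmod (Cavg g) <= M * q ^ S k * (1 + 4 * r2 ^ 2) + e.
Proof.
  intros Hz Hg Hb. pose proof (abel_radius_range k) as Ht.
  set (phi := fun al => M * q ^ S k * poisson (abel_radius k) al + (M * q ^ S k * (4 * r2 ^ 2) + e)).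
  replace (M * q ^ S k * (1 + 4 * r2 ^ 2) + e) with (Ravg phi).
  - assert (Hc : forall al, continuity_pt phi al).
    { intros al. apply (continuity_pt_plus (fun al => M * q ^ S k * poisson (abel_radius k) al) (fun _ => _)).
      - apply continuity_pt_cmul, poisson_cont; lra.
      - apply continuity_pt_cst. }
    apply Cavg_norm; auto. intros al. eapply Rle_trans; [apply Hb|].
    pose proof (poisson_holder z k al Hz). unfold phi. lra.
  - unfold phi. rewrite Ravg_plus, Ravg_scal, Ravg_const, poisson_mean; try lra.
    + intros; apply poisson_cont; lra.
    + intros. apply continuity_pt_cmul, poisson_cont; lra.
    + intros; apply continuity_pt_cst.
Qed.

Lemma Ccont_f_rot z : annulus r1 r2 z -> Ccont (fun al => f (expi al * z)%C).
Proof. intros; eapply Ccont_rot; eauto. Qed.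

(** A kernel with mean c sees f(z) as a constant; subtracting it brings in the
    modulus of continuity of f. *)
Lemma Cavg_center z (K : R -> C) c : annulus r1 r2 z -> Ccont K -> Cavg K = c ->
  Cavg (fun al => (f (expi al * z) - f z) * K al)%C =
    (Cavg (fun al => f (expi al * z) * K al) - f z * c)%C.
Proof.
  intros Hz HK <-. rewrite <- Cavg_scal by auto. rewrite <- Cavg_sub.
  - apply Cavg_ext; intros; ring.
  - apply Ccont_mul; auto using Ccont_f_rot.
  - apply Ccont_mul; auto using Ccont_const.
Qed.

Lemma rotation_diff_bound z al : annulus r1 r2 z -> Cmod (f (expi al * z) - f z) <= 2 * B.
Proof.
  intros Hz. eapply Rle_trans; [apply Cmod_triangle|]. rewrite Cmod_opp.
  pose proof (HB z Hz). pose proof (HB (expi al * z)%C (annulus_rot _ _ _ _ Hz)). lra.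
Qed.

Lemma sup_bound_nonneg z : annulus r1 r2 z -> 0 <= B.
Proof. intros Hz. eapply Rle_trans; [apply Cmod_ge_0|apply (HB z Hz)]. Qed.

(** Since 1 - t is halved at each step, |1 - t zeta| <= 2 |1 - t' zeta|, so the
    difference (t' - t) zeta / ((1 - t zeta)(1 - t' zeta)) is at most
    (1 - t) / |1 - t zeta|^2. *)
Lemma kernel_step k al :
  Cmod (/ (1 - RtoC (abel_radius (S k)) * expi al) - / (1 - RtoC (abel_radius k) * expi al)) <=
    poisson (abel_radius k) al.
Proof.
  pose proof (abel_radius_range k) as Ht. pose proof (abel_radius_range (S k)) as Ht'.
  change (1 - RtoC (abel_radius (S k)) * expi al)%C with (poisson_den (abel_radius (S k)) al).
  change (1 - RtoC (abel_radius k) * expi al)%C with (poisson_den (abel_radius k) al).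
  set (d := poisson_den (abel_radius k) al). set (d' := poisson_den (abel_radius (S k)) al).
  assert (Hd : d <> 0%C) by (apply poisson_den_nz; lra).
    assert (Hd' : d' <> 0%C) by (apply poisson_den_nz; lra).
  set (eta := (1 / 2) ^ S (S k)).
  assert (Eeta : 1 - abel_radius k = 2 * eta) by (unfold abel_radius, eta; simpl; lra).
  assert (Eeta' : 1 - abel_radius (S k) = eta) by (unfold abel_radius, eta; simpl; lra).
  assert (E1 : (d - d')%C = (RtoC eta * expi al)%C).
  { unfold d, d', poisson_den.
    transitivity (RtoC (abel_radius (S k) - abel_radius k) * expi al)%C; [rewrite RtoC_minus; ring|].
    do 2 f_equal. lra. }
  assert (Heta : 0 < eta) by (apply half_pow).
  replace (/ d' - / d)%C with ((d - d') / (d' * d))%C by (field; auto).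
  rewrite E1, Cmod_div, !Cmod_mult, Cmod_expi, Cmod_R, Rabs_pos_eq by (try apply Cmult_neq_0; auto; lra).
  pose proof (poisson_den_lower (abel_radius k) al ltac:(lra)) as L1.
    pose proof (poisson_den_lower (abel_radius (S k)) al ltac:(lra)) as L2.
  fold d in L1. fold d' in L2.
  assert (L3 : Cmod d <= Cmod d' + eta).
  { replace d with (d' + (d - d'))%C by ring. eapply Rle_trans; [apply Cmod_triangle|].
    rewrite E1, Cmod_mult, Cmod_expi, Cmod_R, Rabs_pos_eq; lra. }
  unfold poisson. fold d. 
  apply Rmult_le_reg_r with (Cmod d' * Cmod d ^ 2); [apply Rmult_lt_0_compat; [lra|apply pow_lt; lra]|].
  replace (eta * 1 / (Cmod d' * Cmod d) * (Cmod d' * Cmod d ^ 2)) with (eta * Cmod d) by (field; lra).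
  replace ((1 - abel_radius k ^ 2) / Cmod d ^ 2 * (Cmod d' * Cmod d ^ 2))
    with ((1 - abel_radius k) * (1 + abel_radius k) * Cmod d')
    by (field; lra).
  rewrite Eeta. apply Rle_trans with (eta * (2 * Cmod d')); [apply Rmult_le_compat_l; lra|].
  assert (0 <= eta * Cmod d') by (apply Rmult_le_pos; lra). nra.
Qed.

(** Here 2 q^k is the truncation error of two Abel kernels. *)
Lemma kernel_mean_estimate z k (K : R -> C) : annulus r1 r2 z -> Ccont K ->
  (forall al, Cmod (K al) <= poisson (abel_radius k) al + 2 * q ^ k) ->
  Cmod (Cavg (fun al => (f (expi al * z) - f z) * K al)%C) <= (M * (1 + 4 * r2 ^ 2) + 4 * B) * q ^ k.
Proof.
  intros Hz HK HKb. pose proof (sup_bound_nonneg z Hz) as HB0.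
  assert (Hqk : 0 < q ^ k) by (apply pow_lt; lra).
  eapply Rle_trans; [apply (poisson_estimate z k _ (4 * B * q ^ k)); auto|].
  - apply Ccont_mul; auto. apply Ccont_sub; auto using Ccont_f_rot, Ccont_const.
  - intros al. rewrite Cmod_mult.
    pose proof (rotation_diff_bound z al Hz) as H4. pose proof (Cmod_ge_0 (f (expi al * z) - f z)) as H5.
    set (X := Cmod (f (expi al * z) - f z)) in *.
    apply Rle_trans with (X * (poisson (abel_radius k) al + 2 * q ^ k)); [apply Rmult_le_compat_l;
      auto|].
    assert (X * q ^ k <= 2 * B * q ^ k) by (apply Rmult_le_compat_r; lra). lra.
  - assert (M * q ^ S k * (1 + 4 * r2 ^ 2) <= M * q ^ k * (1 + 4 * r2 ^ 2)).
    { apply Rmult_le_compat_r; [nra|]. apply Rmult_le_compat_l; auto. simpl. nra. }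
    lra.
Qed.

(** The kernels of both means have mean zero, so f(zeta z) may be replaced by
    f(zeta z) - f(z). *)
Lemma abel_mean_step z k : annulus r1 r2 z ->
  Cmod (abel_mean f N (S k) z - abel_mean f N k z) <= (M * (1 + 4 * r2 ^ 2) + 4 * B) * q ^ k.
Proof.
  intros Hz. pose proof (sup_bound_nonneg z Hz) as HB0.
  assert (Hqk : 0 < q ^ k) by (apply pow_lt; lra).
  assert (CK : forall k, Ccont (fun al => abel_kernel (N k) (abel_radius k) (expi al)))
    by (intros; apply ispoly_Ccont, abel_kernel_poly).
  set (K := fun al => (abel_kernel (N (S k)) (abel_radius (S k)) (expi al) - abel_kernel (N k) (abel_radius k) (expi al))%C).
  assert (HK : Ccont K) by (apply Ccont_sub; auto).
  assert (E : (abel_mean f N (S k) z - abel_mean f N k z)%C =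
    Cavg (fun al => (f (expi al * z) - f z) * K al)%C).
  { rewrite (Cavg_center z K 0%C); auto.
    - unfold abel_mean. rewrite <- Cavg_sub by (apply Ccont_mul; auto using Ccont_f_rot).
      transitivity (Cavg (fun al => f (expi al * z) * K al)%C); [|ring].
      apply Cavg_ext; intros; unfold K; ring.
    - unfold K. rewrite Cavg_sub, !abel_kernel_mean by auto. ring. }
  rewrite E. apply kernel_mean_estimate; auto. intros al.
    pose proof (kernel_step k al) as H1.
    pose proof (abel_kernel_error_at k (expi al) (Cmod_expi al)) as H2.
    pose proof (abel_kernel_error_at (S k) (expi al) (Cmod_expi al)) as H3.
     set (a := (/ (1 - RtoC (abel_radius (S k)) * expi al))%C) in *.
       set (b := (/ (1 - RtoC (abel_radius k) * expi al))%C) in *.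
      unfold K. set (K1 := abel_kernel (N (S k)) (abel_radius (S k)) (expi al)) in *.
        set (K0 := abel_kernel (N k) (abel_radius k) (expi al)) in *.
      replace (K1 - K0)%C with ((a - b) + (- (a - (1 + K1)) + (b - (1 + K0))))%C by ring.
      eapply Rle_trans; [apply Cmod_triangle|]. apply Rplus_le_compat; auto.
      eapply Rle_trans; [apply Cmod_triangle|]. rewrite Cmod_opp.
      assert (q ^ S k <= q ^ k) by (simpl; nra). lra.
Qed.

Lemma abel_mean_bound0 z : annulus r1 r2 z -> Cmod (abel_mean f N 0 z) <= 4 * B.
Proof.
  intros Hz. unfold abel_mean. pose proof (sup_bound_nonneg z Hz). apply Cavg_norm_const.
  - apply Ccont_mul; [apply Ccont_f_rot; auto|]. apply ispoly_Ccont, abel_kernel_poly.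
  - intros al. rewrite Cmod_mult, Rmult_comm.
    pose proof (HB (expi al * z)%C (annulus_rot _ _ _ _ Hz)).
    apply Rmult_le_compat; auto using Cmod_ge_0.
    pose proof (abel_kernel_error_at 0 (expi al) (Cmod_expi al)) as H2. simpl pow in H2.
    pose proof (abel_radius_range 0) as Ht.
      pose proof (poisson_den_lower (abel_radius 0) al ltac:(lra)) as L.
    assert (Hn := poisson_den_nz (abel_radius 0) al ltac:(lra)).
    set (K := abel_kernel _ _ _) in *. 
    replace K with (- (/ poisson_den (abel_radius 0) al - (1 + K)) + (/ poisson_den (abel_radius 0) al + - (1)))%C by ring.
    eapply Rle_trans; [apply Cmod_triangle|]. rewrite Cmod_opp.
    assert (Cmod (/ poisson_den (abel_radius 0) al) <= 2).
    { rewrite Cmod_inv by auto. rewrite <- (Rinv_inv 2). apply Rinv_le_contravar; [lra|].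
      eapply Rle_trans; [|exact L]. unfold abel_radius. simpl. lra. }
    pose proof (Cmod_triangle (/ poisson_den (abel_radius 0) al) (- RtoC 1)%C) as H3.
      rewrite Cmod_opp, Cmod_1 in H3.
    change (1 - RtoC (abel_radius 0) * expi al)%C with (poisson_den (abel_radius 0) al) in H2. lra.
Qed.

(** The Abel mean of f(conj z) taken at conj z has the kernel reflected in zeta.
    Together with the component of frequency 0, which vanishes, the two kernels
    add up to the Poisson kernel, up to the truncation errors. *)
Lemma two_sided_means z k : annulus r1 r2 z -> fourier_coef f 0 z = 0%C ->
  Cmod (abel_mean f N k z + abel_mean (fun x => f (Cconj x)) N k (Cconj z) - f z)
   <= (M * (1 + 4 * r2 ^ 2) + 4 * B) * q ^ k.
Proof.
  intros Hz H0. pose proof (sup_bound_nonneg z Hz) as HB0.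
  assert (Hqk : 0 < q ^ k) by (apply pow_lt; lra). pose proof (abel_radius_range k) as Ht.
  set (K := fun al => abel_kernel (N k) (abel_radius k) (expi al)).
  assert (CK : Ccont K) by (apply ispoly_Ccont, abel_kernel_poly).
  assert (CK' : Ccont (fun al => K (- al)%R)) by (apply (Ccont_comp K Ropp);
    auto using continuity_pt_Ropp).
  set (L := fun al => (1 + K al + K (- al)%R)%C).
  assert (CL : Ccont L) by (apply Ccont_add; auto; apply Ccont_add; auto using Ccont_const).
  assert (KP : forall al, K (al + 2 * PI) = K al) by (intros; unfold K; now rewrite expi_period).
  assert (K0 : Cavg K = 0%C) by apply abel_kernel_mean.
  assert (L1 : Cavg L = 1%C).
  { unfold L. rewrite !Cavg_add, Cavg_const, K0; auto using Ccont_const, Ccont_add.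
    rewrite (Cavg_reflect K), K0 by auto. ring. }
  assert (E2 : abel_mean (fun x => f (Cconj x)) N k (Cconj z) =
    Cavg (fun al => f (expi al * z) * K (- al)%R)%C).
  { unfold abel_mean. rewrite <- (Cavg_reflect (fun al => f (expi al * z) * K (- al)%R)%C).
    - apply Cavg_ext. intros al. rewrite Cmult_conj, Cconj_conj, expi_neg, Ropp_involutive. reflexivity.
    - apply Ccont_mul; auto using Ccont_f_rot.
    - intros al. rewrite expi_period. f_equal. rewrite <- (KP (- (al + 2 * PI))). f_equal. ring. }
  assert (E : (abel_mean f N k z + abel_mean (fun x => f (Cconj x)) N k (Cconj z) - f z)%C =
      Cavg (fun al => (f (expi al * z) - f z) * L al)%C).
  { rewrite (Cavg_center z L 1%C) by auto. rewrite E2, Cmult_1_r. f_equal.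
    unfold abel_mean. fold K. unfold L.
    rewrite (Cavg_ext (fun al => f (expi al * z) * (1 + K al + K (- al)%R))%C
       (fun al => f (expi al * z) * expi al ^ 0 + f (expi al * z) * K al + f (expi al * z) * K (- al)%R)%C)
      by (intros; simpl; ring).
    pose proof (Ccont_f_rot z Hz) as Cf.
    rewrite !Cavg_add; auto using Ccont_mul, Ccont_add, Ccont_pow, Ccont_expi.
    fold (fourier_coef f 0 z). rewrite H0. unfold K. ring. }
  rewrite E. apply kernel_mean_estimate; auto. intros al.
    pose proof (abel_kernel_error_at k (expi al) (Cmod_expi al)) as H2.
    pose proof (abel_kernel_error_at k (expi (- al)) (Cmod_expi (- al))) as H3.
     pose proof (poisson_eq (abel_radius k) al ltac:(lra)) as EP. rewrite <- expi_neg in EP.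
      fold (K al) in H2. fold (K (- al)%R) in H3.
      set (a := (/ (1 - RtoC (abel_radius k) * expi al))%C) in *.
        set (b := (/ (1 - RtoC (abel_radius k) * expi (- al)%R))%C) in *.
      unfold L. replace (1 + K al + K (- al)%R)%C with
        (RtoC (poisson (abel_radius k) al) + (- (a - (1 + K al)) + - (b - (1 + K (- al)%R))))%C
          by (rewrite EP; ring).
      eapply Rle_trans; [apply Cmod_triangle|].
        rewrite Cmod_R, Rabs_pos_eq by (apply poisson_nonneg; lra).
      apply Rplus_le_compat_l. eapply Rle_trans; [apply Cmod_triangle|]. rewrite !Cmod_opp. lra.
Qed.
End Estimates.

(** * Limits of geometrically convergent sequences *)

(** Componentwise, since the limit operator on real sequences is total. *)
Definition climit (c : nat -> C) : C :=
  (real (Lim_seq (fun k => Re (c k))), real (Lim_seq (fun k => Im (c k)))).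

Lemma geometric_tail (c : nat -> C) D q : 0 < q < 1 -> (forall k, Cmod (c (S k) - c k) <= D * q ^ k) ->
  forall m k, Cmod (c (m + k)%nat - c k) <= D * q ^ k / (1 - q).
Proof.
  intros Hq H m k.
  assert (HD : 0 <= D).
  { specialize (H O). simpl in H. pose proof (Cmod_ge_0 (c 1%nat - c O)). lra. }
  assert (E : Cmod (c (m + k)%nat - c k) <= D * q ^ k * (1 - q ^ m) / (1 - q)).
  { induction m.
    - simpl. replace (c k - c k)%C with (RtoC 0) by ring. rewrite Cmod_0. right. field. lra.
    - replace (c (S m + k)%nat - c k)%C with ((c (S (m + k)) - c (m + k)%nat) + (c (m + k)%nat - c k))%C
        by (simpl; ring).
      eapply Rle_trans; [apply Cmod_triangle|].
      eapply Rle_trans; [apply Rplus_le_compat; [apply H|apply IHm]|].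
      right. rewrite pow_add. simpl. field. lra. }
  eapply Rle_trans; [exact E|]. unfold Rdiv.
    apply Rmult_le_compat_r; [left; apply Rinv_0_lt_compat; lra|].
  assert (0 < q ^ k) by (apply pow_lt; lra). assert (0 < q ^ m) by (apply pow_lt; lra).
  assert (0 <= D * q ^ k) by nra. nra.
Qed.

Lemma geometric_real_lim (u : nat -> R) D q : 0 < q < 1 ->
  (forall m k, Rabs (u (m + k)%nat - u k) <= D * q ^ k / (1 - q)) -> is_lim_seq u (real (Lim_seq u)).
Proof.
  intros Hq H.
  assert (Hc : ex_finite_lim_seq u).
  { apply ex_lim_seq_cauchy_corr. intros [e He].
    destruct (geometric_small q (D / (1 - q)) (e / 2) ltac:(lra) ltac:(lra)) as [N HN].
    exists N. intros n m Hn Hm. simpl.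
    pose proof (H (n - N)%nat N) as H1. pose proof (H (m - N)%nat N) as H2.
    replace (n - N + N)%nat with n in H1 by lia. replace (m - N + N)%nat with m in H2 by lia.
    replace (D * q ^ N / (1 - q)) with (q ^ N * (D / (1 - q))) in * by (field; lra).
    replace (u n - u m) with ((u n - u N) - (u m - u N)) by ring.
    eapply Rle_lt_trans; [apply Rabs_triang|]. rewrite Rabs_Ropp. lra. }
  apply Lim_seq_correct'. exact Hc.
Qed.

Lemma climit_tends (c : nat -> C) D q : 0 < q < 1 -> (forall k, Cmod (c (S k) - c k) <= D * q ^ k) ->
  Ctends c (climit c).
Proof.
  intros Hq H. pose proof (geometric_tail c D q Hq H) as HT.
  assert (H1 : is_lim_seq (fun k => Re (c k)) (real (Lim_seq (fun k => Re (c k))))).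
  { apply (geometric_real_lim _ D q); auto. intros m k. eapply Rle_trans; [|apply HT].
    apply (re_le_Cmod (c (m + k)%nat - c k)). }
  assert (H2 : is_lim_seq (fun k => Im (c k)) (real (Lim_seq (fun k => Im (c k))))).
  { apply (geometric_real_lim _ D q); auto. intros m k. eapply Rle_trans; [|apply HT].
    apply (Im_le_Cmod (c (m + k)%nat - c k)). }
  apply is_lim_seq_spec in H1. apply is_lim_seq_spec in H2.
  intros e He. assert (He2 : 0 < e / 2) by lra.
  destruct (H1 (mkposreal _ He2)) as [N1 B1]. destruct (H2 (mkposreal _ He2)) as [N2 B2]. simpl in *.
  exists (max N1 N2). intros j Hj. eapply Rle_lt_trans; [apply Cmod_le_Rabs|].
  specialize (B1 j ltac:(lia)). specialize (B2 j ltac:(lia)).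
  unfold climit, Re, Im, Rminus in *; simpl in *. lra.
Qed.

Lemma Ctends_le (u : nat -> C) a b K : Ctends u a -> (exists N, forall j, (N <= j)%nat ->
  Cmod (b - u j) <= K) ->
  Cmod (b - a) <= K.
Proof.
  intros Hu [N HN]. apply le_epsilon. intros e He. destruct (Hu e He) as [N2 H2].
  specialize (HN (max N N2) ltac:(lia)). specialize (H2 (max N N2) ltac:(lia)).
  replace (b - a)%C with ((b - u (max N N2)) + (u (max N N2) - a))%C by ring.
  eapply Rle_trans; [apply Cmod_triangle|]. lra.
Qed.

Lemma climit_geom (c : nat -> C) D q : 0 < q < 1 -> (forall k, Cmod (c (S k) - c k) <= D * q ^ k) ->
  forall k, Cmod (c k - climit c) <= D * q ^ k / (1 - q).
Proof.
  intros Hq H k. apply (Ctends_le c); [eapply climit_tends; eauto|].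
  exists k. intros j Hj. rewrite Cmod_sub_sym.
  replace j with ((j - k) + k)%nat by lia. apply geometric_tail; auto.
Qed.

(** * The varieties Lambda^- and the domain Omega^- *)

Lemma poly2_diskalg H a b : poly2 H -> diskalg a -> diskalg b -> diskalg (fun x => H (a x) (b x)).
Proof.
  intros HH Ha Hb. induction HH; auto using diskalg_const.
  - now apply diskalg_add.
  - now apply diskalg_mul.
Qed.

(** The variable xi = rho/(z-a) parametrizes Lambda^-: there
    w = conj a + rho xi and 1/z = xi/(rho + a xi), whose pole lies outside the
    closed disc as |a| < rho.  On |xi| = 1 the point is (y, conj y) with y on the
    circle. *)
Lemma Lambda_minus_max H (a : C) rho (z w : C) K : poly2 H -> Cmod a < rho ->
  Lambda_minus a rho (z, w) ->
  (forall x, circle a rho x -> Cmod (H (/ x)%C (Cconj x)) <= K) -> Cmod (H (/ z)%C w) <= K.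
Proof.
  intros HH Ha [E Hz] HK. pose proof (Cmod_ge_0 a) as Ha0.
  set (xi := (RtoC rho / (z - a))%C).
  assert (Hza : (z - a)%C <> 0%C) by (apply Cmod_gt_0; lra).
  assert (Hzn : z <> 0%C).
  { apply Cmod_gt_0. pose proof (Cmod_triangle z (- a)). rewrite Cmod_opp in H0.
    fold (Cminus z a) in H0. lra. }
  assert (Hrho : RtoC rho <> 0%C) by (apply Cmod_gt_0; rewrite Cmod_R, Rabs_pos_eq; lra).
  set (h := fun x => H (x * / (RtoC rho + a * x))%C (Cconj a + RtoC rho * x)%C).
  assert (Hh : diskalg h).
  { apply poly2_diskalg; auto.
    - apply diskalg_mul; [apply diskalg_id|]. apply diskalg_inv_lin. rewrite Cmod_R, Rabs_pos_eq; lra.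
    - apply diskalg_add; [apply diskalg_const|].
      apply diskalg_mul; [apply diskalg_const|apply diskalg_id]. }
  replace (H (/ z)%C w) with (h xi).
  - apply diskalg_max; auto.
    + intros x Hx. set (y := (a + RtoC rho * Cconj x)%C).
      assert (Hxc : (x * Cconj x)%C = 1%C) by (rewrite <- Cmod2_conj, Hx; f_equal; ring).
      assert (Hxn : x <> 0%C) by (apply Cmod_gt_0; lra).
      assert (Hy : (RtoC rho + a * x)%C = (x * y)%C).
      { unfold y. transitivity (a * x + RtoC rho * (x * Cconj x))%C; [rewrite Hxc; ring|ring]. }
      assert (Hcy : circle a rho y).
      { unfold circle, y. replace (a + RtoC rho * Cconj x - a)%C with (RtoC rho * Cconj x)%C by ring.
        rewrite Cmod_mult, Cmod_conj, Hx, Cmod_R, Rabs_pos_eq; lra. }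
      assert (Hyn : y <> 0%C).
      { apply circle_mod in Hcy. apply Cmod_gt_0. lra. }
      unfold h. rewrite Hy.
      replace (x * / (x * y))%C with (/ y)%C by (field; auto).
      replace (Cconj a + RtoC rho * x)%C with (Cconj y); [apply HK, Hcy|].
      unfold y. rewrite Cplus_conj, Cmult_conj, Cconj_conj. do 2 f_equal.
      unfold Cconj, RtoC; simpl. f_equal; ring.
    + unfold xi. rewrite Cmod_div, Cmod_R, Rabs_pos_eq by (auto; lra).
      apply Rmult_le_reg_r with (Cmod (z - a)); [lra|]. unfold Rdiv. rewrite Rmult_assoc, Rinv_l; lra.
  - unfold h. f_equal.
    + unfold xi. field. repeat split; auto.
      replace (RtoC rho * (z - a) + a * RtoC rho)%C with (RtoC rho * z)%C by ring.
      apply Cmult_neq_0; auto.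
    + unfold xi. replace w with (Cconj a + (z - a) * (w - Cconj a) / (z - a))%C at 1 by (field; auto).
      rewrite E, RtoC_pow. field. auto.
Qed.

Lemma unit_direction a : exists v, Cmod v = 1 /\ a = (RtoC (Cmod a) * v)%C.
Proof. destruct (polar a) as [phi E]. exists (expi phi); split; auto using Cmod_expi. Qed.

(** The nearest and the farthest point of the circle from the origin lie on the
    line through a and the origin. *)
Lemma circle_margin r1 r2 a rho : 0 < rho -> Cmod a < rho ->
  (forall z, circle a rho z -> int_annulus r1 r2 z) -> r1 < rho - Cmod a /\ rho + Cmod a < r2.
Proof.
  intros Hrho Ha H. pose proof (Cmod_ge_0 a). destruct (unit_direction a) as [v [Hv E]].
  set (m := Cmod a) in *.
  assert (P : forall t, (t = rho \/ t = - rho) -> circle a rho (a + RtoC t * v)%C).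
  { intros t Ht. unfold circle. replace (a + RtoC t * v - a)%C with (RtoC t * v)%C by ring.
    rewrite Cmod_mult, Hv, Cmod_R, Rmult_1_r. destruct Ht as [->| ->].
    - apply Rabs_pos_eq; lra.
    - rewrite Rabs_Ropp. apply Rabs_pos_eq; lra. }
  assert (Q : forall t, Cmod (a + RtoC t * v) = Rabs (m + t)).
  { intros t. rewrite E. rewrite <- Cmod_R, RtoC_plus.
    replace (RtoC m * v + RtoC t * v)%C with ((RtoC m + RtoC t) * v)%C by ring.
    rewrite Cmod_mult, Hv. ring. }
  pose proof (H _ (P (- rho) (or_intror eq_refl))) as [H1 _].
  pose proof (H _ (P rho (or_introl eq_refl))) as [_ H2].
  rewrite Q in H1, H2. rewrite Rabs_left in H1 by lra. rewrite Rabs_pos_eq in H2 by lra. lra.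
Qed.

Lemma circle_in_annulus r1 r2 a rho z : r1 < rho - Cmod a -> rho + Cmod a < r2 ->
  circle a rho z -> int_annulus r1 r2 z.
Proof. intros H1 H2 Hc. apply circle_mod in Hc. unfold int_annulus. lra. Qed.

Lemma Omega_minus_cases r1 r2 (z w : C) : Omega_minus r1 r2 (z, w) -> exists a rho,
  0 < rho /\ Cmod a < rho /\ r1 < rho - Cmod a /\ rho + Cmod a < r2 /\ Lambda_minus a rho (z, w).
Proof.
  intros [a [rho [H1 [H2 [H3 H4]]]]].
  assert (Ha : Cmod a < rho).
  { unfold surrounds_origin, Defs.disc in H3. rewrite Cmod_sub_sym in H3.
    replace (a - 0)%C with a in H3 by ring. auto. }
  destruct (circle_margin r1 r2 a rho H1 Ha H2). exists a, rho. auto.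
Qed.

Lemma Omega_minus_mod r1 r2 (z w : C) : Omega_minus r1 r2 (z, w) -> r1 < Cmod z.
Proof.
  intros H. apply Omega_minus_cases in H. destruct H as [a [rho [H1 [H2 [H3 [H4 [_ H6]]]]]]].
  pose proof (Cmod_triangle z (- a)) as H7. rewrite Cmod_opp in H7. fold (Cminus z a) in H7. lra.
Qed.

Lemma Omega_minus_intro r1 r2 (a : C) rho (z w : C) : 0 < r1 -> r1 < rho - Cmod a -> rho + Cmod a < r2 ->
  Lambda_minus a rho (z, w) -> Omega_minus r1 r2 (z, w).
Proof.
  intros Hr H1 H2 HL. pose proof (Cmod_ge_0 a). exists a, rho.
  split; [lra|]. split; [intros; eapply circle_in_annulus; eauto|]. split; [|exact HL].
  unfold surrounds_origin, Defs.disc. rewrite Cmod_sub_sym.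
  replace (a - 0)%C with a by ring. lra.
Qed.

Lemma RtoC_conj (x : R) : Cconj (RtoC x) = RtoC x.
Proof. unfold Cconj, RtoC; simpl; f_equal; ring. Qed.

(** On Lambda^-_(a,rho), conj w - a is lam (z - a) with 0 < lam < 1 and
    rho^2 = lam |z - a|^2.  Keeping lam fixed, every nearby point (z, w) lies on
    the variety with centre (conj w - lam z)/(1 - lam), which depends
    continuously on (z, w). *)
Lemma Omega_minus_open r1 r2 (z0 w0 : C) : 0 < r1 -> Omega_minus r1 r2 (z0, w0) ->
  exists d, 0 < d /\ forall z w : C, Cmod (z - z0) < d -> Cmod (w - w0) < d -> Omega_minus r1 r2 (z, w).
Proof.
  intros Hr H. apply Omega_minus_cases in H. destruct H as [a [rho [H1 [H2 [H3 [H4 [E0 H6]]]]]]].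
  pose proof (Cmod_ge_0 a) as Ha0.
  set (b := (z0 - a)%C) in *.
  assert (Hb : b <> 0%C) by (apply Cmod_gt_0; lra).
  assert (Hbb : 0 < Cmod b ^ 2) by (apply pow_lt; lra).
  set (lam := rho ^ 2 / Cmod b ^ 2).
  assert (Hlam : 0 < lam < 1).
  { unfold lam. split; [apply Rdiv_lt_0_compat; auto; apply pow_lt; lra|].
    apply Rmult_lt_reg_r with (Cmod b ^ 2); auto. unfold Rdiv. rewrite Rmult_assoc, Rinv_l by lra. nra. }
  set (sl := sqrt lam).
  assert (Hsl : 0 < sl) by (apply sqrt_lt_R0; lra).
  assert (Hsl2 : sl ^ 2 = lam) by (apply pow2_sqrt; lra).
  assert (Hsl1 : sl < 1) by nra.
  assert (Hl1 : RtoC (1 - lam) <> 0%C) by (intro E; apply (f_equal Re) in E; unfold Re in E;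
    simpl in E; lra).
  assert (Hl1' : (1 - RtoC lam)%C <> 0%C) by (rewrite <- RtoC_minus; exact Hl1).
  (* The point conj w0 lies on the line through a and z0. *)
  assert (Ew0 : (Cconj w0 - a)%C = (RtoC lam * b)%C).
  { assert (Hcb : Cconj b <> 0%C) by (apply Cmod_gt_0; rewrite Cmod_conj; lra).
    assert (E1 : (Cconj b * (Cconj w0 - a))%C = RtoC (rho ^ 2)).
    { rewrite <- (RtoC_conj (rho ^ 2)), <- E0. rewrite Cmult_conj, Cminus_conj, Cconj_conj.
      reflexivity. }
    assert (E2 : (RtoC lam * (b * Cconj b))%C = RtoC (rho ^ 2)).
    { rewrite <- Cmod2_conj, RtoC_pow, <- RtoC_pow, <- RtoC_mult. f_equal. unfold lam. field. lra. }
    replace (Cconj w0 - a)%C with (Cconj b * (Cconj w0 - a) / Cconj b)%C by (field; auto).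
    rewrite E1, <- E2. field. auto. }
  set (ce := fun z w : C => ((Cconj w - RtoC lam * z) / RtoC (1 - lam))%C).
  assert (Ea : ce z0 w0 = a).
  { unfold ce. replace (Cconj w0) with (a + RtoC lam * b)%C by (rewrite <- Ew0; ring).
    unfold b. rewrite RtoC_minus. field. exact Hl1'. }
  assert (Erho : rho = sl * Cmod b).
  { unfold sl, lam. rewrite sqrt_div_alt by auto. rewrite !sqrt_pow2 by (try apply Cmod_ge_0; lra).
    field.
    lra. }
  set (m := Rmin (rho - Cmod a - r1) (r2 - rho - Cmod a)).
  assert (Hm : 0 < m) by (apply Rmin_pos; lra).
  assert (Hm1 : m <= rho - Cmod a - r1) by apply Rmin_l.
  assert (Hm2 : m <= r2 - rho - Cmod a) by apply Rmin_r.
  exists (m * (1 - lam) / 10). split; [apply Rdiv_lt_0_compat; [apply Rmult_lt_0_compat; lra|lra]|].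
  intros z w Hz Hw. set (d := m * (1 - lam) / 10) in *.
  set (a' := ce z w). set (b' := (z - a')%C). set (rho' := sl * Cmod b').
  assert (Da : Cmod (a' - a) <= m / 5).
  { rewrite <- Ea. unfold a', ce.
    replace ((Cconj w - RtoC lam * z) / RtoC (1 - lam) - (Cconj w0 - RtoC lam * z0) / RtoC (1 - lam))%C with
      ((Cconj (w - w0) + - (RtoC lam * (z - z0))) / RtoC (1 - lam))%C
      by (rewrite Cminus_conj; field; auto).
    rewrite Cmod_div by auto. rewrite Cmod_R, Rabs_pos_eq by lra.
    assert (Cmod (Cconj (w - w0) + - (RtoC lam * (z - z0))) <= 2 * d).
    { eapply Rle_trans; [apply Cmod_triangle|].
      rewrite Cmod_opp, Cmod_conj, Cmod_mult, Cmod_R, Rabs_pos_eq by lra.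
      pose proof (Cmod_ge_0 (z - z0)). nra. }
    apply Rmult_le_reg_r with (1 - lam); [lra|]. unfold Rdiv. rewrite Rmult_assoc, Rinv_l by lra.
    unfold d in *. lra. }
  assert (Hdm : d <= m / 10) by (unfold d; nra).
  assert (Db : Cmod (b' - b) <= m / 3).
  { unfold b', b. replace (z - a' - (z0 - a))%C with ((z - z0) + - (a' - a))%C by ring.
    eapply Rle_trans; [apply Cmod_triangle|]. rewrite Cmod_opp. lra. }
  assert (Drho : Rabs (rho' - rho) <= m / 3).
  { unfold rho'. rewrite Erho. rewrite <- Rmult_minus_distr_l, Rabs_mult, Rabs_pos_eq by lra.
    assert (Rabs (Cmod b' - Cmod b) <= Cmod (b' - b)).
    { pose proof (Cmod_sub_ge b' b). pose proof (Cmod_sub_ge b b'). rewrite (Cmod_sub_sym b b') in H0.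
      apply Rabs_le. lra. }
    pose proof (Rabs_pos (Cmod b' - Cmod b)). nra. }
  assert (Dam : Cmod a' <= Cmod a + m / 5).
  { replace a' with (a + (a' - a))%C by ring. eapply Rle_trans; [apply Cmod_triangle|]. lra. }
  apply Rabs_le_between in Drho.
  assert (Hrho' : 0 < rho') by (pose proof (Cmod_ge_0 a'); lra).
  assert (Hb' : 0 < Cmod b') by (unfold rho' in Hrho'; nra).
  apply (Omega_minus_intro r1 r2 a' rho'); auto; try lra.
  split.
  - fold b'.
    assert (Ew : (w - Cconj a')%C = (RtoC lam * Cconj b')%C).
    { replace (w - Cconj a')%C with (Cconj (Cconj w - a'))%C by (rewrite Cminus_conj, Cconj_conj;
      reflexivity).
      rewrite <- (RtoC_conj lam), <- Cmult_conj. f_equal. unfold b', a', ce. rewrite RtoC_minus. field.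
      exact Hl1'. }
    rewrite Ew. transitivity (RtoC lam * (b' * Cconj b'))%C; [ring|].
    rewrite <- Cmod2_conj, RtoC_pow, <- RtoC_pow, <- RtoC_mult. f_equal.
    unfold rho'. rewrite <- Hsl2. ring.
  - fold b'. unfold rho'. nra.
Qed.

(** * Limits of polynomials on the closure of Omega^- *)

Lemma Cball_of_Cmod (c z : C) d : Cmod (z - c) < d -> ball (c : C_NormedModule) d (z : C_NormedModule).
Proof. intros H. apply (C_NormedModule_mixin_compat1 c z d). exact H. Qed.

(** The balls of the uniform structure of C are squares, whence the factor. *)
Lemma Cmod_of_Cball (c z : C) d : 0 < d -> ball (c : C_NormedModule) (d / 2) (z : C_NormedModule) ->
  Cmod (z - c) < d.
Proof.
  intros Hd H. assert (Hd2 : 0 < d / 2) by lra.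
  pose proof (C_NormedModule_mixin_compat2 c z (mkposreal _ Hd2) H) as B. simpl in B.
  eapply Rlt_le_trans; [exact B|].
  assert (sqrt 2 <= 2); [|nra].
  rewrite <- (sqrt_pow2 2) at 2 by lra. apply sqrt_le_1_alt. lra.
Qed.

Lemma locally_C2_intro (z0 w0 : C) (V : C2 -> Prop) d : 0 < d ->
  (forall z w : C, Cmod (z - z0) < d -> Cmod (w - w0) < d -> V (z, w)) -> locally ((z0, w0) : C2) V.
Proof.
  intros Hd H. assert (Hd2 : 0 < d / 2) by lra.
  exists (mkposreal _ Hd2). intros [z w] [H1 H2]. apply H; apply Cmod_of_Cball; auto.
Qed.

Lemma locally_C2_elim (z0 w0 : C) (V : C2 -> Prop) : locally ((z0, w0) : C2) V ->
  exists d, 0 < d /\ forall z w : C, Cmod (z - z0) < d -> Cmod (w - w0) < d -> V (z, w).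
Proof.
  intros [[d Hd] H]. exists d; split; auto. intros z w H1 H2. apply H.
  split; apply Cball_of_Cmod; auto.
Qed.

Lemma locally_C_intro (c : C) (V : C -> Prop) : locally (c : C_NormedModule) V ->
  exists d, 0 < d /\ forall z : C, Cmod (z - c) < d -> V z.
Proof. intros [[d Hd] H]. exists d; split; auto. intros z Hz. apply H, Cball_of_Cmod, Hz. Qed.

(** The topological closure; it is stable under the swap of coordinates in a
    simpler way than the boundary, whose definition involves the complement. *)
Definition closure2 (S : C2 -> Prop) : C2 -> Prop := fun p =>
  forall V : C2 -> Prop, locally p V -> exists q, V q /\ S q.

Lemma with_boundary_closure S p : with_boundary S p -> closure2 S p.
Proof.
  intros [H|H] V HV.
  - exists p; split; auto. apply (locally_singleton p V HV).
  - apply (H V HV).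
Qed.

Lemma closure2_eps S (z0 w0 : C) : closure2 S (z0, w0) -> forall d, 0 < d ->
  exists z w : C, Cmod (z - z0) < d /\ Cmod (w - w0) < d /\ S (z, w).
Proof.
  intros H d Hd. destruct (H (fun p => Cmod (fst p - z0) < d /\ Cmod (snd p - w0) < d)) as [[z w] [[H1 H2] H3]].
  - apply (locally_C2_intro z0 w0 _ d); auto.
  - exists z, w; auto.
Qed.

Lemma Cinv_cont (z0 : C) e : z0 <> 0%C -> 0 < e -> exists d, 0 < d /\ forall z : C, Cmod (z - z0) < d ->
  z <> 0%C /\ Cmod (/ z - / z0) < e.
Proof.
  intros Hz He. assert (H0 : 0 < Cmod z0) by (apply Cmod_gt_0; auto).
  set (r := Cmod z0) in *.
  exists (Rmin (r / 2) (e * r ^ 2 / 2)). split.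
  { apply Rmin_pos; [lra|]. assert (0 < r ^ 2) by (apply pow_lt; auto). nra. }
  intros z Hd. pose proof (Rmin_l (r / 2) (e * r ^ 2 / 2)). pose proof (Rmin_r (r / 2) (e * r ^ 2 / 2)).
  pose proof (Cmod_sub_ge z0 z) as Hs1. rewrite Cmod_sub_sym in Hs1. fold r in Hs1.
  assert (Hzr : r / 2 < Cmod z) by lra.
  assert (Hzn : z <> 0%C) by (apply Cmod_gt_0; lra). split; auto.
  replace (/ z - / z0)%C with (- (z - z0) / (z * z0))%C by (field; auto).
  rewrite Cmod_div, Cmod_opp, Cmod_mult by (apply Cmult_neq_0; auto). fold r.
  apply Rmult_lt_reg_r with (Cmod z * r); [nra|]. unfold Rdiv. rewrite Rmult_assoc, Rinv_l by nra.
  rewrite Rmult_1_r.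
  assert (e * r * (r / 2) <= e * r * Cmod z) by (apply Rmult_le_compat_l; [apply Rmult_le_pos|]; lra).
    nra.
Qed.

Lemma poly2_cont H : poly2 H -> forall (u0 w0 : C) e, 0 < e -> exists d, 0 < d /\ forall u w : C,
  Cmod (u - u0) < d -> Cmod (w - w0) < d -> Cmod (H u w - H u0 w0) < e.
Proof.
  intros HH u0 w0. induction HH as [c| | |P Q HP IHP HQ IHQ|P Q HP IHP HQ IHQ]; intros e He.
  - exists 1; split; [lra|]. intros. replace (c - c)%C with (RtoC 0) by ring. rewrite Cmod_0; lra.
  - exists e; auto.
  - exists e; auto.
  - destruct (IHP (e / 2) ltac:(lra)) as [d1 [D1 H1]]. destruct (IHQ (e / 2) ltac:(lra)) as [d2 [D2 H2]].
    exists (Rmin d1 d2); split; [apply Rmin_pos; auto|]. intros u w Hu Hw.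
    pose proof (Rmin_l d1 d2). pose proof (Rmin_r d1 d2).
    specialize (H1 u w ltac:(lra) ltac:(lra)). specialize (H2 u w ltac:(lra) ltac:(lra)).
    replace (P u w + Q u w - (P u0 w0 + Q u0 w0))%C
      with ((P u w - P u0 w0) + (Q u w - Q u0 w0))%C by ring.
    eapply Rle_lt_trans; [apply Cmod_triangle|]. lra.
  - set (p := Cmod (P u0 w0)). set (r := Cmod (Q u0 w0)).
    pose proof (Cmod_ge_0 (P u0 w0)) as Hp. pose proof (Cmod_ge_0 (Q u0 w0)) as Hr'. fold p in Hp.
      fold r in Hr'.
    assert (He1 : 0 < Rmin 1 (e / (2 * (r + 1)))) by (apply Rmin_pos; [lra|apply Rdiv_lt_0_compat; lra]).
    assert (He2 : 0 < e / (2 * (p + 1))) by (apply Rdiv_lt_0_compat; lra).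
    destruct (IHP _ He1) as [d1 [D1 H1]]. destruct (IHQ _ He2) as [d2 [D2 H2]].
    exists (Rmin d1 d2); split; [apply Rmin_pos; auto|]. intros u w Hu Hw.
    pose proof (Rmin_l d1 d2). pose proof (Rmin_r d1 d2).
    specialize (H1 u w ltac:(lra) ltac:(lra)). specialize (H2 u w ltac:(lra) ltac:(lra)).
    pose proof (Rmin_l 1 (e / (2 * (r + 1)))). pose proof (Rmin_r 1 (e / (2 * (r + 1)))).
    set (x := Cmod (P u w - P u0 w0)) in *. set (y := Cmod (Q u w - Q u0 w0)) in *.
    assert (Hx : x * (r + 1) < e / 2).
    { apply Rlt_le_trans with (e / (2 * (r + 1)) * (r + 1)); [apply Rmult_lt_compat_r; lra|].
      right. field. lra. }
    assert (Hy : y * (p + 1) < e / 2).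
    { apply Rlt_le_trans with (e / (2 * (p + 1)) * (p + 1)); [apply Rmult_lt_compat_r; lra|].
      right. field. lra. }
    replace (P u w * Q u w - P u0 w0 * Q u0 w0)%C with
      ((P u w - P u0 w0) * Q u0 w0 + (P u0 w0 * (Q u w - Q u0 w0) + (P u w - P u0 w0) * (Q u w - Q u0 w0)))%C by ring.
    eapply Rle_lt_trans; [apply Cmod_triangle|].
    eapply Rle_lt_trans; [apply Rplus_le_compat_l, Cmod_triangle|]. rewrite !Cmod_mult.
    fold p r x y. assert (0 <= x) by apply Cmod_ge_0. assert (0 <= y) by apply Cmod_ge_0. nra.
Qed.

Lemma poly2_eval_cont H : poly2 H -> forall (z0 w0 : C) e, z0 <> 0%C -> 0 < e ->
  exists d, 0 < d /\ forall z w : C,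
  Cmod (z - z0) < d -> Cmod (w - w0) < d -> Cmod (H (/ z)%C w - H (/ z0)%C w0) < e.
Proof.
  intros HH z0 w0 e Hz He. destruct (poly2_cont H HH (/ z0)%C w0 e He) as [d [Hd H1]].
  destruct (Cinv_cont z0 d Hz Hd) as [d2 [Hd2 H2]]. exists (Rmin d d2); split; [apply Rmin_pos; auto|].
  pose proof (Rmin_l d d2). pose proof (Rmin_r d d2).
  intros z w Hzd Hwd. apply H1; [apply H2; lra|lra].
Qed.

Lemma closure2_mod r1 r2 (z w : C) : closure2 (Omega_minus r1 r2) (z, w) -> r1 <= Cmod z.
Proof.
  intros H. apply le_epsilon. intros e He.
    destruct (closure2_eps _ _ _ H e He) as [z' [w' [H1 [H2 H3]]]].
  apply Omega_minus_mod in H3. pose proof (Cmod_sub_ge z' z). lra.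
Qed.

(** The closure stays away from z = 0, where 1/z is discontinuous. *)
Lemma closure2_bound r1 r2 H K : 0 < r1 -> poly2 H ->
  (forall z w : C, Omega_minus r1 r2 (z, w) -> Cmod (H (/ z)%C w) <= K) ->
  forall z w : C, closure2 (Omega_minus r1 r2) (z, w) -> Cmod (H (/ z)%C w) <= K.
Proof.
  intros Hr HH HK z w Hc. apply le_epsilon. intros e He.
  assert (Hz : z <> 0%C) by (apply Cmod_gt_0; pose proof (closure2_mod _ _ _ _ Hc); lra).
  destruct (poly2_eval_cont H HH z w e Hz He) as [d [Hd H1]].
  destruct (closure2_eps _ _ _ Hc d Hd) as [z' [w' [E1 [E2 E3]]]].
  specialize (H1 z' w' E1 E2). specialize (HK z' w' E3). rewrite Cmod_sub_sym in H1.
  pose proof (Cmod_sub_ge (H (/ z)%C w) (H (/ z')%C w')). lra.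
Qed.

(** First order expansion along every complex line through (u0, w0), with linear
    part independent of the line.  Restricting to lines reduces the estimates in
    two variables to the maximum principle in one. *)
Lemma poly2_line H (u0 w0 : C) : poly2 H -> exists al be : C, forall x y : C, exists Q, ispoly Q /\
  forall s, H (u0 + s * x)%C (w0 + s * y)%C = (H u0 w0 + s * (al * x + be * y) + s * s * Q s)%C.
Proof.
  induction 1 as [c| | |P1 P2 HP1 [a1 [b1 IH1]] HP2 [a2 [b2 IH2]]|P1 P2 HP1 [a1 [b1 IH1]] HP2 [a2 [b2 IH2]]].
  - exists (RtoC 0), (RtoC 0). intros x y. exists (fun _ => RtoC 0); split; [apply ispoly_const|].
    intros; ring.
  - exists (RtoC 1), (RtoC 0). intros x y. exists (fun _ => RtoC 0); split; [apply ispoly_const|].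
    intros; ring.
  - exists (RtoC 0), (RtoC 1). intros x y. exists (fun _ => RtoC 0); split; [apply ispoly_const|].
    intros; ring.
  - exists (a1 + a2)%C, (b1 + b2)%C. intros x y.
    destruct (IH1 x y) as [Q1 [E1 F1]]. destruct (IH2 x y) as [Q2 [E2 F2]].
    exists (fun s => Q1 s + Q2 s)%C; split; [now apply ispoly_add|]. intros s. rewrite F1, F2. ring.
  - set (A := P1 u0 w0). set (A' := P2 u0 w0).
    exists (A * a2 + A' * a1)%C, (A * b2 + A' * b1)%C. intros x y.
    destruct (IH1 x y) as [Q1 [E1 F1]]. destruct (IH2 x y) as [Q2 [E2 F2]].
    set (L1 := (a1 * x + b1 * y)%C) in *. set (L2 := (a2 * x + b2 * y)%C) in *.
    exists (fun s => L1 * L2 + A * Q2 s + A' * Q1 s + s * (L1 * Q2 s + L2 * Q1 s) + s * s * (Q1 s * Q2 s))%C.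
    split.
    + repeat apply ispoly_add; repeat apply ispoly_mul;
      auto using ispoly_const, ispoly_id, ispoly_mul, ispoly_add, ispoly_scal.
    + intros s. rewrite F1, F2. fold A A'. unfold L1, L2. ring.
Qed.

(** Cauchy estimates for c0 + s c1 + s^2 Q(s): subtract the known terms, divide
    by s, and apply the maximum principle, as |s| = 1 on the circle. *)
Lemma Cauchy_quadratic (c0 c1 : C) Q K : ispoly Q ->
  (forall s, Cmod s = 1 -> Cmod (c0 + s * c1 + s * s * Q s) <= K) ->
  Cmod c1 <= 2 * K /\ forall s, Cmod s <= 1 -> Cmod (s * s * Q s) <= 4 * K * Cmod s ^ 2.
Proof.
  intros HQ HK.
  assert (H0 : Cmod c0 <= K).
  { replace c0 with (c0 + 0 * c1 + 0 * 0 * Q 0)%C by ring.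
    apply (max_principle_poly (fun s => c0 + s * c1 + s * s * Q s)%C); auto.
    - repeat apply ispoly_add; repeat apply ispoly_mul; auto using ispoly_const, ispoly_id.
    - rewrite Cmod_0; lra. }
  assert (H1 : Cmod c1 <= 2 * K).
  { replace c1 with (c1 + 0 * Q 0)%C by ring.
    apply (max_principle_poly (fun s => c1 + s * Q s)%C).
    - apply ispoly_cons, HQ.
    - intros s Hs. replace (Cmod (c1 + s * Q s)) with (Cmod s * Cmod (c1 + s * Q s)) by (rewrite Hs;
      ring).
      rewrite <- Cmod_mult.
      replace (s * (c1 + s * Q s))%C with ((c0 + s * c1 + s * s * Q s) + - c0)%C by ring.
      eapply Rle_trans; [apply Cmod_triangle|]. rewrite Cmod_opp. specialize (HK s Hs). lra.
    - rewrite Cmod_0; lra. }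
  split; auto. intros s Hs.
  assert (H2 : Cmod (Q s) <= 4 * K).
  { apply (max_principle_poly Q); auto. intros x Hx.
    replace (Cmod (Q x)) with (Cmod x * Cmod x * Cmod (Q x)) by (rewrite Hx; ring).
    rewrite <- !Cmod_mult.
    replace (x * x * Q x)%C with ((c0 + x * c1 + x * x * Q x) + (- c0 + - (x * c1)))%C by ring.
    eapply Rle_trans; [apply Cmod_triangle|].
    eapply Rle_trans; [apply Rplus_le_compat_l, Cmod_triangle|]. rewrite !Cmod_opp, Cmod_mult, Hx.
    specialize (HK x Hx). lra. }
  rewrite !Cmod_mult. pose proof (Cmod_ge_0 s). assert (0 <= Cmod s * Cmod s) by nra.
  replace (4 * K * Cmod s ^ 2) with (Cmod s * Cmod s * (4 * K)) by ring.
  apply Rmult_le_compat_l; auto.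
Qed.

Section Limit.
Variables (r1 r2 C0 D q : R) (H : nat -> C -> C -> C).
Hypothesis Hr : 0 < r1.
Hypothesis Hq : 0 < q < 1.
Hypothesis HP : forall k, poly2 (H k).
Hypothesis H0b : forall z w : C, Omega_minus r1 r2 (z, w) -> Cmod (H 0 (/ z)%C w) <= C0.
Hypothesis Hstep : forall k (z w : C), Omega_minus r1 r2 (z, w) ->
  Cmod (H (S k) (/ z)%C w - H k (/ z)%C w) <= D * q ^ k.

Definition limit_fun (p : C2) : C := climit (fun k => H k (/ fst p)%C (snd p)).

Lemma poly2_diff P Q : poly2 P -> poly2 Q -> poly2 (fun u w => P u w - Q u w)%C.
Proof.
  intros HP' HQ. apply (poly2_add P (fun u w => - Q u w)%C); auto.
  assert (E : (fun u w => - Q u w)%C = (fun u w => (- RtoC 1) * Q u w)%C).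
  { apply FunctionalExtensionality.functional_extensionality; intros u.
    apply FunctionalExtensionality.functional_extensionality; intros w. ring. }
  rewrite E. apply (poly2_mul (fun _ _ => (- RtoC 1)%C)); auto using poly2_const.
Qed.

Lemma limit_step_closure k (z w : C) : closure2 (Omega_minus r1 r2) (z, w) ->
  Cmod (H (S k) (/ z)%C w - H k (/ z)%C w) <= D * q ^ k.
Proof.
  apply (closure2_bound r1 r2 (fun u w => H (S k) u w - H k u w)%C); auto.
  apply poly2_diff; auto.
Qed.

Lemma limit_error k (z w : C) : closure2 (Omega_minus r1 r2) (z, w) ->
  Cmod (H k (/ z)%C w - limit_fun (z, w)) <= D * q ^ k / (1 - q).
Proof.
  intros Hc. apply (climit_geom (fun k => H k (/ z)%C w) D q Hq). intros j. apply limit_step_closure, Hc.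
Qed.

Lemma limit_continuous S : (forall p, S p -> closure2 (Omega_minus r1 r2) p) ->
  continuous_on S (limit_fun : C2 -> C_NormedModule).
Proof.
  intros HS [z0 w0] Hp V HV. apply locally_C_intro in HV. destruct HV as [e [He HV]].
  pose proof (HS _ Hp) as Hc.
  assert (Hz : z0 <> RtoC 0) by (apply Cmod_gt_0; pose proof (closure2_mod _ _ _ _ Hc); lra).
  destruct (geometric_small q (D / (1 - q)) (e / 3) ltac:(lra) ltac:(lra)) as [k Hk].
  assert (Hk' : D * q ^ k / (1 - q) < e / 3).
  { replace (D * q ^ k / (1 - q)) with (q ^ k * (D / (1 - q))) by (field; lra). auto. }
  destruct (poly2_eval_cont (H k) (HP k) z0 w0 (e / 3) Hz ltac:(lra)) as [d [Hd H1]].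
  apply (locally_C2_intro z0 w0 _ d Hd). intros z w Ez Ew Hs. apply HV.
  pose proof (limit_error k z w (HS _ Hs)) as L1. pose proof (limit_error k z0 w0 Hc) as L2.
  specialize (H1 z w Ez Ew). rewrite Cmod_sub_sym in L1.
  replace (limit_fun (z, w) - limit_fun (z0, w0))%C with
    ((limit_fun (z, w) - H k (/ z)%C w) +
      ((H k (/ z)%C w - H k (/ z0)%C w0) + (H k (/ z0)%C w0 - limit_fun (z0, w0))))%C by ring.
  eapply Rle_lt_trans; [apply Cmod_triangle|].
  eapply Rle_lt_trans; [apply Rplus_le_compat_l, Cmod_triangle|].
  replace e with (e / 3 + (e / 3 + e / 3)) by field.
  apply Rplus_lt_compat; [eapply Rle_lt_trans; [exact L1|exact Hk']|].
  apply Rplus_lt_compat; [exact H1|eapply Rle_lt_trans; [exact L2|exact Hk']].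
Qed.

Lemma limit_bounded S : (forall p, S p -> closure2 (Omega_minus r1 r2) p) ->
  bounded_on S (limit_fun : C2 -> C_NormedModule).
Proof.
  intros HS. exists (C0 + D / (1 - q)). intros [z w] Hp. pose proof (HS _ Hp) as Hc.
  pose proof (limit_error 0 z w Hc) as L. simpl in L. rewrite Rmult_1_r in L.
  assert (B : Cmod (H 0 (/ z)%C w) <= C0) by (apply (closure2_bound r1 r2); auto).
  replace (limit_fun (z, w))
    with (H 0%nat (/ z)%C w + - (H 0%nat (/ z)%C w - limit_fun (z, w)))%C by ring.
  eapply Rle_trans; [apply Cmod_triangle|]. rewrite Cmod_opp. apply Rplus_le_compat; [exact B|exact L].
Qed.

Lemma Omega_minus_bound k (z w : C) : Omega_minus r1 r2 (z, w) ->
  Cmod (H k (/ z)%C w) <= C0 + D / (1 - q).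
Proof.
  intros Ho. pose proof (geometric_tail (fun k => H k (/ z)%C w) D q Hq (fun j => Hstep j z w Ho) k 0) as L.
  rewrite Nat.add_0_r in L. simpl in L. rewrite Rmult_1_r in L. specialize (H0b z w Ho).
  replace (H k (/ z)%C w) with (H 0%nat (/ z)%C w + (H k (/ z)%C w - H 0%nat (/ z)%C w))%C by ring.
  eapply Rle_trans; [apply Cmod_triangle|]. lra.
Qed.

Lemma Cmod_inv_0 : Cmod (/ 0) = 0.
Proof.
  unfold Cinv, Cmod; simpl. unfold Rdiv. rewrite Ropp_0, !Rmult_0_l, Rplus_0_l, sqrt_0. reflexivity.
Qed.

Lemma Omega_minus_polydisc (z0 w0 : C) : Omega_minus r1 r2 (z0, w0) -> z0 <> 0%C -> exists d, 0 < d /\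
  forall u w : C, Cmod (u - / z0) <= d -> Cmod (w - w0) <= d -> Omega_minus r1 r2 ((/ u)%C, w).
Proof.
  intros Ho Hz. destruct (Omega_minus_open r1 r2 z0 w0 Hr Ho) as [d [Hd H1]].
  assert (Hiz : (/ z0)%C <> 0%C).
  { intro E. apply C1_nz. transitivity (z0 * / z0)%C; [field; auto|rewrite E; ring]. }
  destruct (Cinv_cont (/ z0)%C d Hiz Hd) as [d2 [Hd2 H2]].
  exists (Rmin d d2 / 2). assert (0 < Rmin d d2) by (apply Rmin_pos; auto).
  pose proof (Rmin_l d d2). pose proof (Rmin_r d d2). split; [lra|].
  intros u w Hu Hw. apply H1; [|lra]. replace z0 with (/ / z0)%C by (field; auto). apply H2. lra.
Qed.

(** The linear parts of the polynomials form a geometric Cauchy sequence by the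
    Cauchy estimates for the differences, and the quadratic remainders are
    bounded uniformly; both pass to the limit. *)
Lemma limit_quadratic (z0 w0 : C) : Omega_minus r1 r2 (z0, w0) -> z0 <> 0%C ->
  exists (al be : C) d K, 0 < d /\ 0 <= K /\ forall (u w : C) (t : R), 0 < t <= 1 ->
    Cmod (u - / z0) <= t * d -> Cmod (w - w0) <= t * d ->
    Cmod (limit_fun ((/ u)%C, w) - limit_fun (z0, w0) - (al * (u - / z0) + be * (w - w0))) <= K * t ^ 2.
Proof.
  intros Ho Hz. destruct (Omega_minus_polydisc z0 w0 Ho Hz) as [d [Hd Hpd]].
  set (u0 := (/ z0)%C) in *. set (K := C0 + D / (1 - q)).
  destruct (functional_choice (fun k (ab : C * C) => forall x y : C, exists Q, ispoly Q /\
     forall s, H k (u0 + s * x)%C (w0 + s * y)%C =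
       (H k u0 w0 + s * (fst ab * x + snd ab * y) + s * s * Q s)%C)) as [ab Hab].
  { intros k. destruct (poly2_line (H k) u0 w0 (HP k)) as [al [be Hl]]. exists (al, be). exact Hl. }
  assert (Hin : forall x y s : C, Cmod x <= d -> Cmod y <= d -> Cmod s <= 1 ->
     Omega_minus r1 r2 ((/ (u0 + s * x))%C, (w0 + s * y)%C) /\
     forall k, H k (/ / (u0 + s * x))%C (w0 + s * y)%C = H k (u0 + s * x)%C (w0 + s * y)%C).
  { intros x y s Hx Hy Hs.
    assert (Ho' : Omega_minus r1 r2 ((/ (u0 + s * x))%C, (w0 + s * y)%C)).
    { apply Hpd.
      - replace (u0 + s * x - u0)%C with (s * x)%C by ring. rewrite Cmod_mult.
        pose proof (Cmod_ge_0 s). pose proof (Cmod_ge_0 x). nra.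
      - replace (w0 + s * y - w0)%C with (s * y)%C by ring. rewrite Cmod_mult.
        pose proof (Cmod_ge_0 s). pose proof (Cmod_ge_0 y). nra. }
    split; auto. intros k. f_equal.
    destruct (Ceq_dec (u0 + s * x) 0) as [E|E]; [|field; auto].
    exfalso. apply Omega_minus_mod in Ho'. rewrite E in Ho'.
    rewrite Cmod_inv_0 in Ho'. lra. }
  assert (Hd0 : forall k (x y : C), Cmod x <= d -> Cmod y <= d ->
     Cmod ((fst (ab (S k)) - fst (ab k)) * x + (snd (ab (S k)) - snd (ab k)) * y) <= 2 * (D * q ^ k)).
  { intros k x y Hx Hy. destruct (Hab k x y) as [Q1 [P1 E1]]. destruct (Hab (S k) x y) as [Q2 [P2 E2]].
    apply (Cauchy_quadratic (H (S k) u0 w0 - H k u0 w0)%C _ (fun s => Q2 s + (- RtoC 1) * Q1 s)%C).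
    - apply ispoly_add; auto. apply ispoly_scal; auto.
    - intros s Hs. destruct (Hin x y s Hx Hy ltac:(lra)) as [Ho' Ek].
      pose proof (Hstep k _ _ Ho') as B. rewrite !Ek, E1, E2 in B.
      eapply Rle_trans; [|exact B]. right. f_equal. ring. }
  assert (Hd1 : forall k, Cmod (fst (ab (S k)) - fst (ab k)) <= (2 * D / d) * q ^ k).
  { intros k. specialize (Hd0 k (RtoC d) (RtoC 0)).
    rewrite Cmod_0, Cmod_R, (Rabs_pos_eq d) in Hd0 by lra.
    specialize (Hd0 ltac:(lra) ltac:(lra)).
      rewrite Cmult_0_r, Cplus_0_r, Cmod_mult, Cmod_R, Rabs_pos_eq in Hd0 by lra.
    apply Rmult_le_reg_r with d; auto.
      replace (2 * D / d * q ^ k * d) with (2 * (D * q ^ k)) by (field; lra). auto. }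
  assert (Hd2 : forall k, Cmod (snd (ab (S k)) - snd (ab k)) <= (2 * D / d) * q ^ k).
  { intros k. specialize (Hd0 k (RtoC 0) (RtoC d)).
    rewrite Cmod_0, Cmod_R, (Rabs_pos_eq d) in Hd0 by lra.
    specialize (Hd0 ltac:(lra) ltac:(lra)).
      rewrite Cmult_0_r, Cplus_0_l, Cmod_mult, Cmod_R, Rabs_pos_eq in Hd0 by lra.
    apply Rmult_le_reg_r with d; auto.
      replace (2 * D / d * q ^ k * d) with (2 * (D * q ^ k)) by (field; lra). auto. }
  set (al := climit (fun k => fst (ab k))). set (be := climit (fun k => snd (ab k))).
  assert (Tal : Ctends (fun k => fst (ab k)) al) by (apply (climit_tends _ (2 * D / d) q); auto).
  assert (Tbe : Ctends (fun k => snd (ab k)) be) by (apply (climit_tends _ (2 * D / d) q); auto).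
  assert (TG : forall u w : C, Omega_minus r1 r2 ((/ u)%C, w) -> (/ / u)%C = u ->
     Ctends (fun k => H k u w) (limit_fun ((/ u)%C, w))).
  { intros u w Hou Eu. unfold limit_fun; simpl.
    replace (fun k => H k (/ / u)%C w) with (fun k => H k u w) by (rewrite Eu; reflexivity).
    apply (climit_tends _ D q); auto. intros k. pose proof (Hstep k _ _ Hou) as B. rewrite Eu in B.
      exact B. }
  assert (HK0 : 0 <= K) by (eapply Rle_trans; [apply Cmod_ge_0|apply (Omega_minus_bound 0 z0 w0 Ho)]).
  exists al, be, d, (4 * K). split; auto. split; [lra|].
  intros u w t Ht Hu Hw.
  (* The point (u, w) is the point of parameter t on the line with direction (x, y). *)
  set (x := ((u - u0) / RtoC t)%C). set (y := ((w - w0) / RtoC t)%C).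
  assert (Htn : RtoC t <> 0%C) by (apply Cmod_gt_0; rewrite Cmod_R, Rabs_pos_eq; lra).
  assert (Hdiv : forall c : C, Cmod c <= t * d -> Cmod (c / RtoC t) <= d).
  { intros c Hc. rewrite Cmod_div, Cmod_R, Rabs_pos_eq by (auto; lra).
    apply Rmult_le_reg_r with t; [lra|]. unfold Rdiv. rewrite Rmult_assoc, Rinv_l; lra. }
  assert (Hx : Cmod x <= d) by (apply Hdiv, Hu). assert (Hy : Cmod y <= d) by (apply Hdiv, Hw).
  assert (Eu : u = (u0 + RtoC t * x)%C) by (unfold x; field; auto).
  assert (Ew : w = (w0 + RtoC t * y)%C) by (unfold y; field; auto).
  assert (Hst : Cmod (RtoC t) <= 1) by (rewrite Cmod_R, Rabs_pos_eq; lra).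
  assert (Q : forall k, Cmod (H k u w - H k u0 w0 - (fst (ab k) * (u - u0) + snd (ab k) * (w - w0))) <= 4 * K * t ^ 2).
  { intros k. destruct (Hab k x y) as [Qk [Pk Ek]].
    destruct (Cauchy_quadratic (H k u0 w0) (fst (ab k) * x + snd (ab k) * y)%C Qk K Pk) as [_ B].
    - intros s Hs. destruct (Hin x y s Hx Hy ltac:(lra)) as [Ho' Eo].
      rewrite <- Ek, <- Eo. apply Omega_minus_bound, Ho'.
    - specialize (B (RtoC t) Hst). rewrite Cmod_R, Rabs_pos_eq in B by lra.
      eapply Rle_trans; [|exact B]. right. f_equal. rewrite Eu, Ew, Ek. ring. }
  destruct (Hin x y (RtoC t) Hx Hy Hst) as [Hou _]. rewrite <- Eu, <- Ew in Hou.
  assert (Eiu : (/ / u)%C = u).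
  { apply Omega_minus_mod in Hou. destruct (Ceq_dec u 0) as [E|E]; [|field; auto].
    exfalso. rewrite E, Cmod_inv_0 in Hou. lra. }
  assert (Ez : (/ u0)%C = z0) by (unfold u0; field; auto).
  assert (T0 : Ctends (fun k => H k u0 w0) (limit_fun (z0, w0))).
  { rewrite <- Ez. apply TG; rewrite Ez; auto. }
  assert (T1 := TG u w Hou Eiu).
  assert (TL : Ctends (fun k => (fst (ab k) * (u - u0) - (RtoC 0 - snd (ab k) * (w - w0)))%C)
    (al * (u - u0) - (RtoC 0 - be * (w - w0)))%C).
  { apply Ctends_sub; [apply Ctends_mul_r, Tal|].
    apply Ctends_sub; [apply Ctends_const|apply Ctends_mul_r, Tbe]. }
  pose proof (Ctends_sub _ _ _ _ (Ctends_sub _ _ _ _ T1 T0) TL) as TT.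
  replace (limit_fun ((/ u)%C, w) - limit_fun (z0, w0) - (al * (u - u0) + be * (w - w0)))%C with
    (- (RtoC 0 - (limit_fun ((/ u)%C, w) - limit_fun (z0, w0) - (al * (u - u0) - (RtoC 0 - be * (w - w0))))))%C by ring.
  rewrite Cmod_opp. apply (Ctends_le _ _ _ _ TT). exists O. intros j _.
  eapply Rle_trans; [|apply (Q j)]. right. rewrite <- Cmod_opp. f_equal. ring.
Qed.
End Limit.

(** * Holomorphy of the limit *)

Lemma norm_C2 (x : C2) : norm x = sqrt (Cmod (fst x) ^ 2 + Cmod (snd x) ^ 2).
Proof. reflexivity. Qed.

Lemma norm_C2_fst (x : C2) : Cmod (fst x) <= norm x.
Proof.
  rewrite norm_C2. rewrite <- (sqrt_pow2 (Cmod (fst x))) at 1 by apply Cmod_ge_0.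
  apply sqrt_le_1_alt. pose proof (pow2_ge_0 (Cmod (snd x))). lra.
Qed.

Lemma norm_C2_snd (x : C2) : Cmod (snd x) <= norm x.
Proof.
  rewrite norm_C2. rewrite <- (sqrt_pow2 (Cmod (snd x))) at 1 by apply Cmod_ge_0.
  apply sqrt_le_1_alt. pose proof (pow2_ge_0 (Cmod (fst x))). lra.
Qed.

Lemma linear_form (a b : C) :
  is_linear (U := C2) (V := C_NormedModule) (fun x : C2 => (a * fst x + b * snd x)%C).
Proof.
  split.
  - intros [x1 x2] [y1 y2].
    change ((a * (x1 + y1) + b * (x2 + y2))%C = (a * x1 + b * x2 + (a * y1 + b * y2))%C). ring.
  - intros k [x1 x2]. change ((a * (k * x1) + b * (k * x2))%C = (k * (a * x1 + b * x2))%C). ring.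
  - pose proof (Cmod_ge_0 a). pose proof (Cmod_ge_0 b).
    exists (Cmod a + Cmod b + 1). split; [lra|]. intros x.
    change (Cmod (a * fst x + b * snd x) <= (Cmod a + Cmod b + 1) * norm x).
    eapply Rle_trans; [apply Cmod_triangle|]. rewrite !Cmod_mult.
    pose proof (norm_C2_fst x) as H1. pose proof (norm_C2_snd x) as H2.
    pose proof (Cmod_ge_0 (fst x)) as H3. set (n := norm x) in *.
    assert (Cmod a * Cmod (fst x) <= Cmod a * n) by (apply Rmult_le_compat_l; auto).
    assert (Cmod b * Cmod (snd x) <= Cmod b * n) by (apply Rmult_le_compat_l; auto).
    lra.
Qed.

(** A quadratic remainder is o of the norm. *)
Lemma differentiable_of_quadratic (G : C2 -> C) (z0 w0 a b : C) d E : 0 < d -> 0 <= E ->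
  (forall z w : C, Cmod (z - z0) < d -> Cmod (w - w0) < d ->
     Cmod (G (z, w) - G (z0, w0) - (a * (z - z0) + b * (w - w0))) <=
       E * (Cmod (z - z0) + Cmod (w - w0)) ^ 2) ->
  ex_filterdiff (G : C2 -> C_NormedModule) (locally ((z0, w0) : C2)).
Proof.
  intros Hd HE H. exists (fun x : C2 => (a * fst x + b * snd x)%C). split; [apply linear_form|].
  intros p Hp. apply is_filter_lim_locally_unique in Hp. rewrite <- Hp. clear p Hp.
  intros [e He]. simpl.
  apply (locally_C2_intro z0 w0 _ (Rmin d (e / (4 * (E + 1))))).
  { apply Rmin_pos; auto. apply Rdiv_lt_0_compat; lra. }
  pose proof (Rmin_l d (e / (4 * (E + 1)))). pose proof (Rmin_r d (e / (4 * (E + 1)))).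
  intros z w Hz Hw. set (dl := Rmin _ _) in *.
  assert (Hn1 : Cmod (z - z0) <= norm (minus ((z, w) : C2) (z0, w0)))
    by apply (norm_C2_fst (minus ((z, w) : C2) (z0, w0))).
  assert (Hn2 : Cmod (w - w0) <= norm (minus ((z, w) : C2) (z0, w0)))
    by apply (norm_C2_snd (minus ((z, w) : C2) (z0, w0))).
  set (n := norm (minus ((z, w) : C2) (z0, w0))) in *.
  specialize (H z w ltac:(lra) ltac:(lra)).
  change (Cmod (G (z, w) - G (z0, w0) - (a * (z - z0) + b * (w - w0))) <= e * n).
  eapply Rle_trans; [exact H|].
  pose proof (Cmod_ge_0 (z - z0)). pose proof (Cmod_ge_0 (w - w0)).
  set (s := Cmod (z - z0) + Cmod (w - w0)) in *.
  assert (Hs : s <= 2 * dl) by (unfold s; lra).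
  assert (Hd4 : dl * (4 * (E + 1)) <= e).
  { apply Rle_trans with (e / (4 * (E + 1)) * (4 * (E + 1))); [apply Rmult_le_compat_r; lra|].
    right. field. lra. }
  assert (H0s : 0 <= s) by (unfold s; lra).
  assert (Hsn : s <= 2 * n) by (unfold s; lra).
  replace (E * s ^ 2) with (E * s * s) by ring.
  apply Rle_trans with (E * s * (2 * n)).
  - apply Rmult_le_compat_l; [apply Rmult_le_pos; lra|lra].
  - replace (E * s * (2 * n)) with (2 * (E * s) * n) by ring.
    apply Rmult_le_compat_r; [lra|].
    assert (E * s <= E * (2 * dl)) by (apply Rmult_le_compat_l; lra). nra.
Qed.

(** Change of variable from u = 1/z back to z in [limit_quadratic]: the
    difference 1/z - 1/z0 is -(z - z0)/z0^2 up to a quadratic error. *)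
Lemma limit_holomorphic r1 r2 C0 D q (H : nat -> C -> C -> C) : 0 < r1 -> 0 < q < 1 ->
  (forall k, poly2 (H k)) ->
  (forall z w : C, Omega_minus r1 r2 (z, w) -> Cmod (H 0%nat (/ z)%C w) <= C0) ->
  (forall k (z w : C), Omega_minus r1 r2 (z, w) ->
    Cmod (H (S k) (/ z)%C w - H k (/ z)%C w) <= D * q ^ k) ->
  holomorphic_on (Omega_minus r1 r2) (limit_fun H : C2 -> C_NormedModule).
Proof.
  intros Hr Hq HP H0b Hstep [z0 w0] Ho.
  assert (Hz : z0 <> RtoC 0) by (apply Cmod_gt_0; pose proof (Omega_minus_mod _ _ _ _ Ho); lra).
  destruct (limit_quadratic r1 r2 C0 D q H Hr Hq HP H0b Hstep z0 w0 Ho Hz) as [al [be [d [K [Hd [HK HQ]]]]]].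
  set (r := Cmod z0). assert (Hr0 : 0 < r) by (apply Cmod_gt_0; auto).
  (* For |z - z0| < r/2 one has |1/z - 1/z0| <= (2 / r^2) |z - z0|. *)
  set (ka := 2 / r ^ 2 + 1).
  assert (Hka : 0 < 2 / r ^ 2) by (apply Rdiv_lt_0_compat; [lra|apply pow_lt; auto]).
  set (d' := Rmin (r / 2) (d / (2 * ka))).
  assert (Hd' : 0 < d') by (apply Rmin_pos; [lra|apply Rdiv_lt_0_compat; unfold ka; lra]).
  assert (Hd1 : d' <= r / 2) by apply Rmin_l.
  assert (Hd2 : d' <= d / (2 * ka)) by apply Rmin_r.
  pose proof (Cmod_ge_0 al) as Hal.
  assert (Hr3 : 0 < r ^ 3) by (apply pow_lt; auto).
  apply (differentiable_of_quadratic _ z0 w0 (- al / (z0 * z0))%C be d' (K * (ka / d) ^ 2 + Cmod al * (2 / r ^ 3))).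
  - auto.
  - apply Rplus_le_le_0_compat; apply Rmult_le_pos; auto; [apply pow2_ge_0|].
    left. apply Rdiv_lt_0_compat; lra.
  - intros z w Hzd Hwd.
    set (a := Cmod (z - z0)) in *. set (b := Cmod (w - w0)) in *.
    assert (Ha : 0 <= a) by apply Cmod_ge_0. assert (Hb : 0 <= b) by apply Cmod_ge_0.
    destruct (Req_dec (a + b) 0) as [E|E].
    + assert (Ea : a = 0) by lra. assert (Eb : b = 0) by lra.
      apply Cmod_eq_0 in Ea. apply Cmod_eq_0 in Eb.
      assert (Ez : z = z0) by (replace z with (z - z0 + z0)%C by ring; rewrite Ea; ring).
      assert (Ew : w = w0) by (replace w with (w - w0 + w0)%C by ring; rewrite Eb; ring).
      rewrite E, Ez, Ew.
      match goal with |- Cmod ?X <= _ => replace X with (RtoC 0) by ring end.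
      rewrite Cmod_0. right; ring.
    + pose proof (Cmod_sub_ge z0 z) as Hs1. rewrite Cmod_sub_sym in Hs1. fold r a in Hs1.
      assert (Hzr : r / 2 <= Cmod z) by lra.
      assert (Hzn : z <> RtoC 0) by (apply Cmod_gt_0; lra).
      assert (Einv : (/ / z)%C = z) by (field; auto).
      set (t := ka * (a + b) / d).
      assert (Hka1 : 1 <= ka) by (unfold ka; lra).
      assert (Htd : t * d = ka * (a + b)) by (unfold t; field; lra).
      assert (Ht0 : 0 < t) by (unfold t; apply Rdiv_lt_0_compat; [apply Rmult_lt_0_compat; lra|lra]).
      assert (Ht1 : t <= 1).
      { apply Rmult_le_reg_r with d; auto. rewrite Htd.
        assert (Hd3 : d' * (2 * ka) <= d).
        { apply Rle_trans with (d / (2 * ka) * (2 * ka)); [apply Rmult_le_compat_r; lra|right; field;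
          lra]. }
        nra. }
      assert (Hu : Cmod (/ z - / z0) <= t * d).
      { rewrite Htd. replace (/ z - / z0)%C with (- (z - z0) / (z * z0))%C by (field; auto).
        rewrite Cmod_div, Cmod_opp, Cmod_mult by (apply Cmult_neq_0; auto). fold r a.
        apply Rle_trans with (2 / r ^ 2 * a).
        - assert (0 < Cmod z * r) by (apply Rmult_lt_0_compat; lra).
          apply Rmult_le_reg_r with (Cmod z * r); auto.
          replace (a / (Cmod z * r) * (Cmod z * r)) with a by (field; lra).
          replace (2 / r ^ 2 * a * (Cmod z * r)) with (a * (2 * Cmod z / r)) by (field; lra).
          rewrite <- (Rmult_1_r a) at 1. apply Rmult_le_compat_l; auto.
          apply Rmult_le_reg_r with r; auto.
            replace (2 * Cmod z / r * r) with (2 * Cmod z) by (field; lra). lra.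
        - unfold ka. nra. }
      assert (Hw : Cmod (w - w0) <= t * d) by (rewrite Htd; fold b; nra).
      pose proof (HQ (/ z)%C w t ltac:(lra) Hu Hw) as B. rewrite Einv in B.
      assert (Ex : (/ z - / z0 = - (z - z0) / (z0 * z0) + (z - z0) * (z - z0) / (z * (z0 * z0)))%C)
        by (field; auto).
      set (Gd := (limit_fun H (z, w) - limit_fun H (z0, w0))%C) in *.
      change (Cmod (Gd - (- al / (z0 * z0) * (z - z0) + be * (w - w0)))
        <= (K * (ka / d) ^ 2 + Cmod al * (2 / r ^ 3)) * (a + b) ^ 2).
      replace (Gd - (- al / (z0 * z0) * (z - z0) + be * (w - w0)))%C with
        ((Gd - (al * (/ z - / z0) + be * (w - w0))) + al * ((z - z0) * (z - z0) / (z * (z0 * z0))))%C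
        by (rewrite Ex; field; auto).
      eapply Rle_trans; [apply Cmod_triangle|]. rewrite Rmult_plus_distr_r. apply Rplus_le_compat.
      * eapply Rle_trans; [exact B|]. unfold t. right. field. lra.
      * rewrite Cmod_mult, Cmod_div, !Cmod_mult by (repeat apply Cmult_neq_0; auto). fold r a.
        rewrite Rmult_assoc. apply Rmult_le_compat_l; auto.
        apply Rle_trans with (2 / r ^ 3 * (a * a)).
        -- assert (0 < Cmod z * (r * r)) by (repeat apply Rmult_lt_0_compat; lra).
           apply Rmult_le_reg_r with (Cmod z * (r * r)); auto.
           replace (a * a / (Cmod z * (r * r)) * (Cmod z * (r * r))) with (a * a) by (field; lra).
           replace (2 / r ^ 3 * (a * a) * (Cmod z * (r * r)))
             with (a * a * (2 * Cmod z / r)) by (field; lra).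
           rewrite <- (Rmult_1_r (a * a)) at 1. apply Rmult_le_compat_l; [nra|].
           apply Rmult_le_reg_r with r; auto.
             replace (2 * Cmod z / r * r) with (2 * Cmod z) by (field; lra). lra.
        -- apply Rmult_le_compat_l; [left; apply Rdiv_lt_0_compat; lra|]. nra.
Qed.

(** * The decomposition *)

(** z times the Abel means are polynomials in (1/z, conj z) that converge
    uniformly on the annulus; the maximum principle carries the estimates of
    their differences to Omega^-. *)
Lemma minus_side r1 r2 f M q B N : 0 < r1 < r2 -> 0 <= M -> 0 < q < 1 ->
  dyadic_holder (annulus r1 r2) f M q -> (forall z, annulus r1 r2 z -> Cmod (f z) <= B) ->
  (forall k, abel_radius k ^ S (N k) * 2 ^ S k <= q ^ k) -> zero_averages r1 r2 f ->
  exists G : C2 -> C_NormedModule,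
    continuous_on (closure2 (Omega_minus r1 r2)) G /\
    bounded_on (closure2 (Omega_minus r1 r2)) G /\
    holomorphic_on (Omega_minus r1 r2) G /\
    forall z : C, annulus r1 r2 z -> Ctends (fun k => abel_mean f N k z) (/ z * G (z, Cconj z))%C.
Proof.
  intros Hr HM Hq Hf HB HN Hz.
  assert (Hu := dyadic_unif_cont _ _ _ _ HM Hq Hf).
  destruct (functional_choice (fun k (H : C -> C -> C) => poly2 H /\ forall z, annulus r1 r2 z ->
     (z * abel_mean f N k z)%C = H (/ z)%C (Cconj z))) as [H HH].
  { intros k. apply (kernel_mean_poly2 r1 r2 f (abel_kernel (N k) (abel_radius k))); auto.
    apply abel_kernel_poly. }
  assert (HP : forall k, poly2 (H k)) by (intros k; apply HH).
  set (D := r2 * (M * (1 + 4 * r2 ^ 2) + 4 * B)). set (C0 := r2 * (4 * B)).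
  assert (Hann : forall z, annulus r1 r2 z -> Cmod z <= r2) by (intros z Ha; apply Ha).
  assert (S0 : forall k z, annulus r1 r2 z ->
     Cmod (H (S k) (/ z)%C (Cconj z) - H k (/ z)%C (Cconj z)) <= D * q ^ k).
  { intros k z Ha. destruct (HH k) as [_ E1]. destruct (HH (S k)) as [_ E2].
    rewrite <- E1, <- E2 by auto.
    replace (z * abel_mean f N (S k) z - z * abel_mean f N k z)%C with
      (z * (abel_mean f N (S k) z - abel_mean f N k z))%C by ring.
    rewrite Cmod_mult. unfold D. rewrite Rmult_assoc.
    apply Rmult_le_compat; auto using Cmod_ge_0. eapply abel_mean_step; eauto. }
  assert (I0 : forall z, annulus r1 r2 z -> Cmod (H 0%nat (/ z)%C (Cconj z)) <= C0).
  { intros z Ha. destruct (HH O) as [_ E1]. rewrite <- E1 by auto. rewrite Cmod_mult. unfold C0.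
    apply Rmult_le_compat; auto using Cmod_ge_0. eapply abel_mean_bound0; eauto. }
  assert (Hcirc : forall a rho z, (forall z, circle a rho z -> int_annulus r1 r2 z) ->
    circle a rho z -> annulus r1 r2 z).
  { intros a rho z Hc Hcz. specialize (Hc z Hcz). unfold int_annulus in Hc. unfold annulus. lra. }
  assert (Hmax : forall P K, poly2 P -> (forall z, annulus r1 r2 z -> Cmod (P (/ z)%C (Cconj z)) <= K) ->
     forall z w : C, Omega_minus r1 r2 (z, w) -> Cmod (P (/ z)%C w) <= K).
  { intros P K HPP HK z w Ho. destruct Ho as [a [rho [R1 [R2 [R3 R4]]]]].
    apply (Lambda_minus_max P a rho z w K); auto.
    - unfold surrounds_origin, Defs.disc in R3. rewrite Cmod_sub_sym in R3.
      replace (a - 0)%C with a in R3 by ring. auto.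
    - intros x Hx. apply HK. eapply Hcirc; eauto. }
  assert (H0b : forall z w : C, Omega_minus r1 r2 (z, w) -> Cmod (H 0%nat (/ z)%C w) <= C0)
    by (apply Hmax; auto).
  assert (Hstep : forall k (z w : C), Omega_minus r1 r2 (z, w) ->
     Cmod (H (S k) (/ z)%C w - H k (/ z)%C w) <= D * q ^ k).
  { intros k. apply (Hmax (fun u w => H (S k) u w - H k u w)%C); auto. apply poly2_diff; auto. }
  assert (Hr1 : 0 < r1) by lra.
  exists (limit_fun H). split; [|split; [|split]].
  - eapply limit_continuous; eauto.
  - eapply limit_bounded; eauto.
  - eapply limit_holomorphic; eauto.
  - intros z Ha. assert (Hzn : z <> 0%C) by (eapply annulus_nz; [|eauto]; lra).
    pose proof (climit_tends (fun k => H k (/ z)%C (Cconj z)) D q Hq (fun k => S0 k z Ha)) as T.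
    apply (Ctends_mul_r _ _ (/ z)%C) in T.
    intros e He. destruct (T e He) as [n Hn]. exists n. intros j Hj. specialize (Hn j Hj).
    destruct (HH j) as [_ E1]. rewrite <- E1 in Hn by auto.
    replace (z * abel_mean f N j z * / z)%C with (abel_mean f N j z) in Hn by (field; auto).
    eapply Rle_lt_trans; [|exact Hn]. right. f_equal. unfold limit_fun. simpl. ring.
Qed.

Definition swap2 (p : C2) : C2 := (snd p, fst p).

(** Exchanging z and w turns Lambda^+_(a,rho) into Lambda^-_(conj a,rho), because
    |z - a| < rho forces |w - conj a| > rho. *)
Lemma Omega_plus_swap r1 r2 p : Omega_plus r1 r2 p -> Omega_minus r1 r2 (swap2 p).
Proof.
  destruct p as [z w]. intros [a [rho [H1 [H2 [H3 [E [H4 H5]]]]]]].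
  assert (Ca : forall x, Cmod (x - Cconj a) = Cmod (Cconj x - a)).
  { intros x. rewrite <- (Cmod_conj (x - Cconj a)), Cminus_conj, Cconj_conj. reflexivity. }
  exists (Cconj a), rho. split; [auto|]. split; [|split].
  - intros x Hx. unfold circle in *. rewrite Ca in Hx. specialize (H2 _ Hx).
    unfold int_annulus in *. now rewrite Cmod_conj in H2.
  - unfold surrounds_origin, Defs.disc in *. rewrite Ca.
    replace (Cconj 0) with (RtoC 0); auto. symmetry. apply RtoC_conj.
  - split.
    + rewrite Cconj_conj, <- E. apply Cmult_comm.
    + simpl. apply (f_equal Cmod) in E. rewrite Cmod_mult, Cmod_R, Rabs_pos_eq in E by (apply pow2_ge_0).
      set (x := Cmod (z - a)) in *. 
      change (Cmod (w - Cconj a) > rho). set (y := Cmod (w - Cconj a)) in *.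
      destruct (Rle_lt_dec y rho) as [Hy|Hy]; [|auto].
      assert (x * y < rho ^ 2); [|lra].
      assert (0 <= y) by apply Cmod_ge_0. nra.
Qed.

Lemma closure_swap r1 r2 p : closure2 (Omega_plus r1 r2) p -> closure2 (Omega_minus r1 r2) (swap2 p).
Proof.
  destruct p as [z0 w0]. intros H V HV. apply locally_C2_elim in HV. destruct HV as [d [Hd HV]].
  destruct (closure2_eps _ z0 w0 H d Hd) as [z [w [H1 [H2 H3]]]].
  exists (swap2 (z, w)). split; [apply HV; auto|apply Omega_plus_swap; auto].
Qed.

Lemma norm_swap (x : C2) : norm (swap2 x) = norm x.
Proof. rewrite !norm_C2. f_equal. apply Rplus_comm. Qed.

Lemma holomorphic_swap (G : C2 -> C_NormedModule) p :
  ex_filterdiff G (locally (swap2 p)) -> ex_filterdiff (fun q => G (swap2 q)) (locally p).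
Proof.
  intros [l [[L1 L2 [M [HM L3]]] H]]. exists (fun x => l (swap2 x)). split.
  - split.
    + intros x y. exact (L1 (swap2 x) (swap2 y)).
    + intros k x. exact (L2 k (swap2 x)).
    + exists M. split; auto. intros x. rewrite <- (norm_swap x). apply L3.
  - intros x Hx. apply is_filter_lim_locally_unique in Hx. rewrite <- Hx. clear x Hx.
    intros e. specialize (H (swap2 p) (fun P HP => HP) e).
    destruct p as [z0 w0]. apply locally_C2_elim in H. destruct H as [d [Hd H]].
    apply (locally_C2_intro z0 w0 _ d Hd). intros z w Hz Hw.
    rewrite <- (norm_swap (minus _ _)). exact (H w z Hw Hz).
Qed.

Lemma continuous_swap r1 r2 (G : C2 -> C_NormedModule) S :
  (forall p, S p -> closure2 (Omega_minus r1 r2) (swap2 p)) ->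
  continuous_on (closure2 (Omega_minus r1 r2)) G -> continuous_on S (fun p => G (swap2 p)).
Proof.
  intros HS H [z0 w0] Hp V HV. specialize (H _ (HS _ Hp) V HV).
  unfold filtermap, within in H. apply locally_C2_elim in H. destruct H as [d [Hd H]].
  apply (locally_C2_intro z0 w0 _ d Hd). intros z w Hz Hw Hq. apply (H w z Hw Hz). apply (HS _ Hq).
Qed.

Lemma continuous_on_sub (S1 S2 : C2 -> Prop) (G : C2 -> C_NormedModule) : (forall p, S1 p -> S2 p) ->
  continuous_on S2 G -> continuous_on S1 G.
Proof.
  intros HS H p Hp V HV. specialize (H p (HS p Hp) V HV). unfold filtermap, within in *.
  apply (filter_imp _ _ (fun x Hx Hs => Hx (HS x Hs)) H).
Qed.

Lemma annulus_conj r1 r2 z : annulus r1 r2 z -> annulus r1 r2 (Cconj z).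
Proof. unfold annulus. now rewrite Cmod_conj. Qed.

Lemma zero_averages_conj r1 r2 f : unif_cont_on (annulus r1 r2) f -> zero_averages r1 r2 f ->
  zero_averages r1 r2 (fun z => f (Cconj z)).
Proof.
  intros Hf H a rho Hrho Hc Hs.
  assert (Ccirc : forall c, Ccont (fun t => c + RtoC rho * expi t)%C).
  { intros c. auto with ccont. }
  assert (Hin : forall t, circle a rho (a + RtoC rho * expi t)%C).
  { intros t. unfold circle. replace (a + RtoC rho * expi t - a)%C with (RtoC rho * expi t)%C by ring.
    rewrite Cmod_mult, Cmod_expi, Cmod_R, Rabs_pos_eq; lra. }
  assert (Ec : forall t, Cconj (a + RtoC rho * expi t)%C = (Cconj a + RtoC rho * expi (- t))%C).
  { intros t. rewrite Cplus_conj, Cmult_conj, RtoC_conj, expi_neg. reflexivity. }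
  assert (Hc2 : forall z, circle (Cconj a) rho z -> annulus r1 r2 z).
  { intros z Hz. rewrite <- (Cconj_conj z). apply annulus_conj, Hc. unfold circle in *.
    rewrite <- Hz, <- (Cmod_conj (z - Cconj a)), Cminus_conj, Cconj_conj. reflexivity. }
  assert (Cf : Ccont (fun t => f (Cconj a + RtoC rho * expi t)%C)).
  { apply (Ccont_along (annulus r1 r2)); auto. intros t. apply Hc2. unfold circle.
    replace (Cconj a + RtoC rho * expi t - Cconj a)%C with (RtoC rho * expi t)%C by ring.
    rewrite Cmod_mult, Cmod_expi, Cmod_R, Rabs_pos_eq; lra. }
  rewrite circle_average_Cavg.
  - rewrite (Cavg_ext _ (fun t => f (Cconj a + RtoC rho * expi (- t))%C)) by (intros; now rewrite Ec).
    rewrite (Cavg_reflect (fun t => f (Cconj a + RtoC rho * expi t)%C)); auto.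
    + rewrite <- circle_average_Cavg by auto. apply H; auto.
      unfold surrounds_origin, Defs.disc in *.
      rewrite <- Cmod_conj, Cminus_conj, Cconj_conj, RtoC_conj. auto.
    + intros t. now rewrite expi_period.
  - apply (Ccont_along (annulus r1 r2) f (fun t => Cconj (a + RtoC rho * expi t)%C)); auto.
    + apply Ccont_conj; auto.
    + intros t. apply annulus_conj; auto.
Qed.

Theorem theorem1p2 :
  forall (r1 r2 : R) (f : C -> C),
    0 < r1 -> r1 < r2 ->
    holder_on (annulus r1 r2) f ->
    (forall (a : C) (rho : R),
        0 < rho ->
        (forall z : C, circle a rho z -> annulus r1 r2 z) ->
        surrounds_origin a rho ->
        circle_average f a rho = RtoC 0) ->
    exists Gp Gm : C2 -> C_NormedModule,
      (continuous_on (with_boundary (Omega_plus r1 r2)) Gp /\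
       bounded_on (with_boundary (Omega_plus r1 r2)) Gp /\
       holomorphic_on (Omega_plus r1 r2) Gp) /\
      (continuous_on (with_boundary (Omega_minus r1 r2)) Gm /\
       bounded_on (with_boundary (Omega_minus r1 r2)) Gm /\
       holomorphic_on (Omega_minus r1 r2) Gm) /\
      forall z : C, annulus r1 r2 z ->
        f z = (/ Cconj z * Gp (z, Cconj z) + / z * Gm (z, Cconj z))%C.
Proof.
  intros r1 r2 f Hr1 Hr2 Hh H0.
  assert (Hr : 0 < r1 < r2) by lra.
  destruct (holder_dyadic _ _ Hh) as [M [q [HM [Hq Hf]]]].
  assert (Hu := dyadic_unif_cont _ _ _ _ HM Hq Hf).
  assert (Hz : zero_averages r1 r2 f) by exact H0.
  set (B := Cmod (f (RtoC r1)) + M * (1 + 4 * r2 ^ 2)).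
  assert (Hr1a : annulus r1 r2 (RtoC r1)).
  { unfold annulus. rewrite Cmod_R, Rabs_pos_eq; lra. }
  assert (HB : forall z, annulus r1 r2 z -> Cmod (f z) <= B).
  { intros z Ha. pose proof (Hf O z (RtoC r1) Ha Hr1a) as E. simpl pow at 1 2 in E.
    replace (f z) with (f (RtoC r1) + (f z - f (RtoC r1)))%C by ring.
    eapply Rle_trans; [apply Cmod_triangle|]. apply Rplus_le_compat_l.
    eapply Rle_trans; [exact E|]. rewrite !Rmult_1_r, Rmult_1_l. apply Rmult_le_compat_l; auto.
    assert (Cmod (z - RtoC r1) <= 2 * r2).
    { eapply Rle_trans; [apply Cmod_triangle|]. rewrite Cmod_opp. destruct Ha, Hr1a. lra. }
    pose proof (Cmod_ge_0 (z - RtoC r1)). nra. }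
  (* The truncation orders make the errors at most q^k. *)
  destruct (functional_choice (fun k n => abel_radius k ^ S n * 2 ^ S k <= q ^ k)) as [N HN].
  { intros k. pose proof (abel_radius_range k).
    destruct (geometric_small (abel_radius k) (abel_radius k * 2 ^ S k) (q ^ k)
      ltac:(lra) ltac:(apply pow_lt; lra)) as [n Hn].
    exists n. rewrite <- tech_pow_Rmult. left. eapply Rle_lt_trans; [|exact Hn]. right; ring. }
  set (g := fun z => f (Cconj z)).
  assert (Hg : dyadic_holder (annulus r1 r2) g M q).
  { intros k z w Ha Hb. unfold g. eapply Rle_trans; [apply (Hf k); auto using annulus_conj|].
    rewrite <- Cminus_conj, Cmod_conj. lra. }
  destruct (minus_side r1 r2 f M q B N Hr HM Hq Hf HB HN Hz) as [Gm [Gm1 [Gm2 [Gm3 Gm4]]]].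
  destruct (minus_side r1 r2 g M q B N Hr HM Hq Hg) as [Gt [Gt1 [Gt2 [Gt3 Gt4]]]]; auto.
  { intros z Ha. apply HB, annulus_conj, Ha. }
  { apply zero_averages_conj; auto. }
  assert (Hplus : forall p, with_boundary (Omega_plus r1 r2) p ->
    closure2 (Omega_minus r1 r2) (swap2 p)).
  { intros p Hp. apply closure_swap, with_boundary_closure, Hp. }
  exists (fun p => Gt (swap2 p)), Gm. split; [split; [|split]|split; [split; [|split]|]].
  - eapply continuous_swap; eauto.
  - destruct Gt2 as [K HK]. exists K. intros p Hp. apply HK, Hplus, Hp.
  - intros p Hp. apply holomorphic_swap. apply Gt3, Omega_plus_swap, Hp.
  - eapply continuous_on_sub; [apply with_boundary_closure|auto].
  - destruct Gm2 as [K HK]. exists K. intros p Hp. apply HK, with_boundary_closure, Hp.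
  - exact Gm3.
  - intros z Ha.
    pose proof (Gm4 z Ha) as T1. pose proof (Gt4 (Cconj z) (annulus_conj _ _ _ Ha)) as T2.
    rewrite Cconj_conj in T2.
    set (X := (/ z * Gm (z, Cconj z))%C) in *. set (Y := (/ Cconj z * Gt (Cconj z, z))%C) in *.
    change (f z = (Y + X)%C).
    assert (T3 : Ctends (fun k => abel_mean f N k z + abel_mean g N k (Cconj z))%C (f z)).
    { intros e He.
      destruct (geometric_small q (M * (1 + 4 * r2 ^ 2) + 4 * B) e ltac:(lra) He) as [n Hn].
      exists n. intros j Hj.
        eapply Rle_lt_trans; [apply (two_sided_means r1 r2 f M q B N HM Hq Hf HB HN z j Ha
        (fourier_coef_zero r1 r2 f z Hr Hu Hz Ha))|].
      eapply Rle_lt_trans; [|exact Hn]. rewrite Rmult_comm. apply Rmult_le_compat_r.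
      - assert (0 <= B) by (eapply Rle_trans; [apply Cmod_ge_0|apply (HB _ Ha)]).
        assert (0 <= M * (1 + 4 * r2 ^ 2)) by (apply Rmult_le_pos; auto; pose proof (pow2_ge_0 r2);
          lra). lra.
      - replace j with (n + (j - n))%nat by lia. rewrite pow_add.
        assert (0 < q ^ n) by (apply pow_lt; lra).
        assert (q ^ (j - n) <= 1) by (rewrite <- (pow1 (j - n)); apply pow_incr; lra). nra. }
    assert (T4 : Ctends (fun k => abel_mean f N k z + abel_mean g N k (Cconj z))%C (X - (RtoC 0 - Y))%C).
    { pose proof (Ctends_sub _ _ _ _ T1 (Ctends_sub _ _ _ _ (Ctends_const (RtoC 0)) T2)) as T5.
      intros e He. destruct (T5 e He) as [n Hn]. exists n. intros j Hj. specialize (Hn j Hj).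
      eapply Rle_lt_trans; [|exact Hn]. right. f_equal. ring. }
    rewrite (Ctends_unique _ _ _ T3 T4). ring.
Qed.
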